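(* Let $n\ge 3$ and let $F$ be an infinite field of characteristic $\ne 2$ which is an NFT-field, with $T$ the torsion subgroup of $F^\times$. If $H$ is a group with $H\equiv \mathrm{GL}_n(F)$, then $H\cong \mathrm{GL}_n(L,h,B)$ for some field $L\equiv F$, some abelian group $B\equiv F^\times/T$, and some symmetric 2-cocycle $h\in S^2(A/A^n,B)$, where $L^\times=A\times T(L)$ with $T(L)$ the torsion subgroup of $L^\times$ and $A$ torsion-free.
   Context: $\equiv$ denotes elementary equivalence (language of groups for groups, language of rings for fields). A field $L$ is an NFT-field if the torsion subgroup $T(L)$ of $L^\times$ is finite; then $L^\times=A\times T(L)$ with $A=A(L)$ torsion-free. $S^2(C,B)$, for abelian groups $C,B$, is the group of symmetric 2-cocycles: functions $h:C\times C\to B$ with $h(xy,z)h(x,y)=h(x,yz)h(y,z)$, $h(1,x)=h(x,1)=1$, $h(x,y)=h(y,x)$. Let $L$ be an NFT-field and $K=\mathrm{GL}_n(L)$. An addition of $K$ is a subgroup $K_0\le Z(K)$ that is a complement of the torsion subgroup of $Z(K)$ in $Z(K)$; the quotient $K_f=K/K_0$ is the corresponding foundation of $K$. For a subgroup $M\le K$, $\mathrm{Is}_K(M)=\{g\in K: g^m\in M \text{ for some } m\ge 1\}$; in particular $\mathrm{Is}_K(K')=\{g\in K:\det g \in T(L)\}$. Let $\pi:K\to K_f$ be the canonical epimorphism and $K_1=\pi(\mathrm{Is}_K(K'))$. Let $\Delta_1\le K_f$ be the image under $\pi$ of the subgroup $\{\mathrm{diag}(\alpha,1,\dots,1):\alpha\in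 L^\times\}\cdot Z(K)$. Then $K_f=K_1\Delta_1$, and the determinant induces an isomorphism $K_f/K_1\cong \Delta_1/(\Delta_1\cap K_1)\cong L^\times/(T(L)(L^\times)^n)\cong A/A^n$; for $x\in K_f$ let $\bar x\in A/A^n$ be its image. For an abelian group $B\equiv A$ and $h\in S^2(A/A^n,B)$, the abelian deformation $\mathrm{GL}_n(L,h,B)$ (formed with respect to some addition $K_0$ of $K$) is the central extension $1\to B\to E\to K_f\to1$ given on the set $B\times K_f$ by $$(b_1,x_1)(b_2,x_2)=(b_1b_2\,h(\bar x_1,\bar x_2),\ x_1x_2).$$ Equivalently, writing $x_i=c_ia_i$ with $c_i\in K_1$, $a_i\in\Delta_1$, the cocycle is evaluated at the classes of $a_1,a_2$ in $A/A^n$. *)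

(* Defs.v *)
From HB Require Import structures.
From mathcomp Require Import all_boot all_order all_algebra.
From mathcomp Require Import boolp classical_sets cardinality.

Set Implicit Arguments.
Unset Strict Implicit.
Unset Printing Implicit Defensive.

Import GRing.Theory.

Record signature := Signature { op : Type; arity : op -> nat }.

Section FirstOrder.
Variable S : signature.

(* [term k] and [formula k] have their free variables among k variables,
   numbered by 'I_k; a quantifier binds the variable numbered 0. *)
Inductive term (k : nat) : Type :=
| Var of 'I_k
| App (f : op S) of ('I_(arity f) -> term k).

Inductive formula : nat -> Type :=
| Equal k of term k & term k : formula k
| Falsum k : formula k
| Imp k of formula k & formula k : formula k
| And k of formula k & formula k : formula k
| Or k of formula k & formula k : formula k
| Forall k of formula k.+1 : formula k
| Exists k of formula k.+1 : formula k.

Definition sentence := formula 0.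

Record model := Model {
  carrier :> Type;
  interp : forall f : op S, ('I_(arity f) -> carrier) -> carrier }.

Variable M : model.

Definition scons k (x : M) (e : 'I_k -> M) (i : 'I_k.+1) : M :=
  if unlift ord0 i is Some j then e j else x.

Fixpoint eval k (e : 'I_k -> M) (t : term k) : M :=
  match t with
  | Var i => e i
  | App f a => interp (fun i => eval e (a i))
  end.

Fixpoint holds k (p : formula k) : ('I_k -> M) -> Prop :=
  match p with
  | Equal _ t u => fun e => eval e t = eval e u
  | Falsum _ => fun=> False
  | Imp _ p q => fun e => holds p e -> holds q e
  | And _ p q => fun e => holds p e /\ holds q e
  | Or _ p q => fun e => holds p e \/ holds q e
  | Forall _ p => fun e => forall x, holds p (scons x e)
  | Exists _ p => fun e => exists x, holds p (scons x e)
  end.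

Definition satisfies (p : sentence) : Prop :=
  holds p (fun i : 'I_0 => match notF (ltn_ord i) with end).

End FirstOrder.

Definition elem_equiv (S : signature) (M N : model S) : Prop :=
  forall p : sentence S, satisfies M p <-> satisfies N p.

Variant group_op := GroupOne | GroupInv | GroupMul.

Definition group_signature : signature :=
  @Signature group_op
    (fun f => match f with GroupOne => 0 | GroupInv => 1 | GroupMul => 2 end).

Definition group_model (G : groupType) : model group_signature :=
  @Model group_signature G
    (fun f => match f return ('I_(@arity group_signature f) -> G) -> G with
      | GroupOne => fun=> 1%g
      | GroupInv => fun a => ((a ord0)^-1)%g
      | GroupMul => fun a => (a ord0 * a ord_max)%g
      end).

Variant ring_op := RingZero | RingOne | RingOpp | RingAdd | RingMul.

Definition ring_signature : signature :=
  @Signature ring_op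
    (fun f => match f with
      | RingZero | RingOne => 0
      | RingOpp => 1
      | RingAdd | RingMul => 2
      end).

Definition ring_model (R : nzRingType) : model ring_signature :=
  @Model ring_signature R
    (fun f => match f return ('I_(@arity ring_signature f) -> R) -> R with
      | RingZero => fun=> 0%R
      | RingOne => fun=> 1%R
      | RingOpp => fun a => (- a ord0)%R
      | RingAdd => fun a => (a ord0 + a ord_max)%R
      | RingMul => fun a => (a ord0 * a ord_max)%R
      end).

Local Open Scope group_scope.

HB.mixin Record Group_isAbelian G of Group G := {
  mulgC : @commutative G G *%g
}.

#[short(type="abelianGroupType")]
HB.structure Definition AbelianGroup := {G of Group_isAbelian G & Group G}.

HB.mixin Record isNormalClosed (G : groupType) (S : {pred G}) := {
  gpredJr : forall x y, y \in S -> y ^ x \in S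
}.

#[short(type="normalClosed")]
HB.structure Definition NormalClosed (G : groupType) :=
  {S of isNormalClosed G S & GroupClosed G S}.

Definition isomorphic (G H : groupType) : Prop :=
  exists f : {multiplicative G -> H}, bijective f.

Definition center (G : groupType) : {pred G} :=
  [pred z | `[< forall x, commute z x >]].

Arguments center : clear implicits.

Definition torsion (G : groupType) : {pred G} :=
  [pred x | `[< exists2 m, (0 < m)%N & x ^+ m = 1 >]].
Arguments torsion : clear implicits.

Definition powers (G : groupType) (n : nat) : {pred G} :=
  [pred x | `[< exists y, x = y ^+ n >]].
Arguments powers : clear implicits.

Section AbelianSubgroups.
Variable G : abelianGroupType.

Lemma expgMnC (x y : G) n : (x * y) ^+ n = x ^+ n * y ^+ n.
Proof. exact/expgMn/mulgC. Qed.

Lemma torsion_group_closed : group_closed (torsion G).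
Proof.
split=> [|x y /asboolP[m m0 xm] /asboolP[p p0 yp]].
  by apply/asboolP; exists 1%N.
apply/asboolP; exists (m * p)%N; first by rewrite muln_gt0 m0.
rewrite expgMnC expVgn expgnA xm expg1n mul1g.
by rewrite mulnC expgnA yp expg1n invg1.
Qed.

Lemma powers_group_closed n : group_closed (powers G n).
Proof.
split=> [|_ _ /asboolP[x ->] /asboolP[y ->]].
  by apply/asboolP; exists 1; rewrite expg1n.
by apply/asboolP; exists (x / y); rewrite expgMnC expVgn.
Qed.

Lemma abelian_conjg (x y : G) : y ^ x = y.
Proof. by rewrite /conjg [y * x]mulgC mulKg. Qed.

HB.instance Definition _ :=
  isMulClosed.Build G (torsion G) (group_closedM torsion_group_closed).
HB.instance Definition _ :=
  isMul1Closed.Build G (torsion G) torsion_group_closed.1.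
HB.instance Definition _ :=
  isInvClosed.Build G (torsion G) (group_closedV torsion_group_closed).
HB.instance Definition _ := isNormalClosed.Build G (torsion G)
  (fun x y yT => eq_ind_r (fun z => z \in torsion G) yT (abelian_conjg x y)).

HB.instance Definition _ n :=
  isMulClosed.Build G (powers G n) (group_closedM (powers_group_closed n)).
HB.instance Definition _ n :=
  isMul1Closed.Build G (powers G n) (powers_group_closed n).1.
HB.instance Definition _ n :=
  isInvClosed.Build G (powers G n) (group_closedV (powers_group_closed n)).
HB.instance Definition _ n := isNormalClosed.Build G (powers G n)
  (fun x y yT => eq_ind_r (fun z => z \in powers G n) yT (abelian_conjg x y)).

End AbelianSubgroups.

Section Subgroup.
Variables (G : groupType) (S : groupClosed G).

Record subgroup := Subgroup { sgval : G; sgvalP : sgval \in S }.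

HB.instance Definition _ := [isSub for sgval].
HB.instance Definition _ := [Choice of subgroup by <:].

Lemma subgroup_closed : group_closed S.
Proof. by split=> [|x y xS yS]; [exact: gpred1 | exact: gpredF]. Qed.

HB.instance Definition _ :=
  SubChoice_isSubGroup.Build G [pred x | x \in S] subgroup subgroup_closed.

End Subgroup.

Section AbelianSubgroup.
Variables (G : abelianGroupType) (S : groupClosed G).

Lemma subgroup_mulgC : @commutative (subgroup S) (subgroup S) *%g.
Proof. by move=> x y; apply: val_inj; rewrite /= mulgC. Qed.

HB.instance Definition _ := Group_isAbelian.Build (subgroup S) subgroup_mulgC.

End AbelianSubgroup.

Section Quotient.
Variables (G : groupType) (N : normalClosed G).

Definition quotient_rel (x y : G) := x^-1 * y \in N.

Lemma quotient_rel_refl : reflexive quotient_rel.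
Proof. by move=> x; rewrite /quotient_rel mulVg gpred1. Qed.

Lemma quotient_rel_sym : symmetric quotient_rel.
Proof.
by move=> x y; rewrite /quotient_rel -[LHS](gpredV N) invgM invgK.
Qed.

Lemma quotient_rel_trans : transitive quotient_rel.
Proof.
move=> y x z xy yz; rewrite /quotient_rel.
have -> : x^-1 * z = (x^-1 * y) * (y^-1 * z) by rewrite -mulgA mulVKg.
exact: gpredM.
Qed.

Canonical quotient_equiv :=
  EquivRel quotient_rel quotient_rel_refl quotient_rel_sym quotient_rel_trans.

Definition quotient := {eq_quot quotient_rel}%qT.

HB.instance Definition _ := Choice.on quotient.
HB.instance Definition _ : EqQuotient G quotient_rel quotient :=
  EqQuotient.on quotient.

Definition quotient_pi (x : G) : quotient := (\pi_quotient x)%qT.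

Lemma quotient_piP x y :
  reflect (quotient_pi x = quotient_pi y) (x^-1 * y \in N).
Proof. exact: (iffP (eqmodP quotient_equiv x y)). Qed.

Definition quotient_mul (x y : quotient) : quotient :=
  quotient_pi (repr x * repr y).
Definition quotient_inv (x : quotient) : quotient := quotient_pi (repr x)^-1.

Lemma quotient_repr x : (repr (quotient_pi x))^-1 * x \in N.
Proof. by apply/quotient_piP; rewrite /quotient_pi reprK. Qed.

Lemma quotient_reprK x : quotient_pi (repr x) = x.
Proof. by rewrite /quotient_pi reprK. Qed.

Lemma quotient_mulE x y :
  quotient_mul (quotient_pi x) (quotient_pi y) = quotient_pi (x * y).
Proof.
apply/quotient_piP; set x' := repr _; set y' := repr _.
have -> : (x' * y')^-1 * (x * y) = ((x'^-1 * x) ^ y') * (y'^-1 * y).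
  by rewrite /conjg invgM -!mulgA mulVKg.
by apply: gpredM; [apply: gpredJr|]; apply: quotient_repr.
Qed.

Lemma quotient_invE x : quotient_inv (quotient_pi x) = quotient_pi x^-1.
Proof.
apply/quotient_piP; set x' := repr _; rewrite invgK.
have -> : x' * x^-1 = ((x'^-1 * x)^-1) ^ x'^-1.
  by rewrite /conjg invgK invgM invgK -!mulgA mulgV mulg1.
by apply: gpredJr; rewrite gpredV; apply: quotient_repr.
Qed.

Lemma quotient_mulA : associative quotient_mul.
Proof.
move=> x y z; rewrite -[x]quotient_reprK -[y]quotient_reprK.
by rewrite -[z]quotient_reprK !quotient_mulE mulgA.
Qed.

Lemma quotient_mul1 : left_id (quotient_pi 1) quotient_mul.
Proof. by move=> x; rewrite -[x]quotient_reprK quotient_mulE mul1g. Qed.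

Lemma quotient_mulr1 : right_id (quotient_pi 1) quotient_mul.
Proof. by move=> x; rewrite -[x]quotient_reprK quotient_mulE mulg1. Qed.

Lemma quotient_mulV : left_inverse (quotient_pi 1) quotient_inv quotient_mul.
Proof.
by move=> x; rewrite -[x]quotient_reprK quotient_invE quotient_mulE mulVg.
Qed.

Lemma quotient_mulrV : right_inverse (quotient_pi 1) quotient_inv quotient_mul.
Proof.
by move=> x; rewrite -[x]quotient_reprK quotient_invE quotient_mulE mulgV.
Qed.

HB.instance Definition _ := isGroup.Build quotient quotient_mulA quotient_mul1
  quotient_mulr1 quotient_mulV quotient_mulrV.

Lemma quotient_piM : {morph quotient_pi : x y / x * y}.
Proof. by move=> x y; rewrite -quotient_mulE. Qed.

HB.instance Definition _ := isMultiplicative.Build G quotient quotient_pi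
  quotient_piM.

End Quotient.

Section AbelianQuotient.
Variables (G : abelianGroupType) (N : normalClosed G).

Lemma quotient_mulgC : @commutative (quotient N) (quotient N) *%g.
Proof.
move=> x y; rewrite -[x]quotient_reprK -[y]quotient_reprK.
by rewrite -!quotient_piM mulgC.
Qed.

HB.instance Definition _ := Group_isAbelian.Build (quotient N) quotient_mulgC.

End AbelianQuotient.

Definition is_complement (G : groupType) (Z T C : {pred G}) : Prop :=
  [/\ group_closed C,
      {subset C <= Z},
      forall x, x \in C -> x \in T -> x = 1
    & forall z, z \in Z -> exists2 c, c \in C & exists2 t, t \in T & z = c * t].

Section Units.
Variable R : comUnitRingType.

Record units := Units { uval : R; uvalP : uval \is a GRing.unit }.

HB.instance Definition _ := [isSub for uval].
HB.instance Definition _ := [Choice of units by <:].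

Implicit Types x y z : units.

Lemma units_mul_subproof x y : (uval x * uval y)%R \is a GRing.unit.
Proof. by rewrite unitrM !uvalP. Qed.

Lemma units_inv_subproof x : (uval x)^-1%R \is a GRing.unit.
Proof. by rewrite unitrV uvalP. Qed.

Definition units_one := Units (unitr1 R).
Definition units_mul x y := Units (units_mul_subproof x y).
Definition units_inv x := Units (units_inv_subproof x).

Lemma units_mulA : associative units_mul.
Proof. by move=> x y z; apply: val_inj; rewrite /= mulrA. Qed.

Lemma units_mul1 : left_id units_one units_mul.
Proof. by move=> x; apply: val_inj; rewrite /= mul1r. Qed.

Lemma units_mulr1 : right_id units_one units_mul.
Proof. by move=> x; apply: val_inj; rewrite /= mulr1. Qed.

Lemma units_mulV : left_inverse units_one units_inv units_mul.
Proof. by move=> x; apply: val_inj; rewrite /= mulVr ?uvalP. Qed.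

Lemma units_mulrV : right_inverse units_one units_inv units_mul.
Proof. by move=> x; apply: val_inj; rewrite /= mulrV ?uvalP. Qed.

HB.instance Definition _ := isGroup.Build units units_mulA units_mul1
  units_mulr1 units_mulV units_mulrV.

Lemma units_mulC : @commutative units units *%g.
Proof. by move=> x y; apply: val_inj; rewrite /= mulrC. Qed.

HB.instance Definition _ := Group_isAbelian.Build units units_mulC.

End Units.

Section GeneralLinear.
Variables (n : nat) (L : fieldType).

Record GL := MkGL { mxval : 'M[L]_n; mxvalP : mxval \in unitmx }.

HB.instance Definition _ := [isSub for mxval].
HB.instance Definition _ := [Choice of GL by <:].

Implicit Types g h : GL.

Lemma GL_mul_subproof g h : (mxval g *m mxval h)%R \in unitmx.
Proof. by rewrite unitmx_mul !mxvalP. Qed.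

Lemma GL_inv_subproof g : invmx (mxval g) \in unitmx.
Proof. by rewrite unitmx_inv mxvalP. Qed.

Definition GL_one := MkGL (unitmx1 L n).
Definition GL_mul g h := MkGL (GL_mul_subproof g h).
Definition GL_inv g := MkGL (GL_inv_subproof g).

Lemma GL_mulA : associative GL_mul.
Proof. by move=> x y z; apply: val_inj; rewrite /= mulmxA. Qed.

Lemma GL_mul1 : left_id GL_one GL_mul.
Proof. by move=> x; apply: val_inj; rewrite /= mul1mx. Qed.

Lemma GL_mulr1 : right_id GL_one GL_mul.
Proof. by move=> x; apply: val_inj; rewrite /= mulmx1. Qed.

Lemma GL_mulV : left_inverse GL_one GL_inv GL_mul.
Proof. by move=> x; apply: val_inj; rewrite /= mulVmx ?mxvalP. Qed.

Lemma GL_mulrV : right_inverse GL_one GL_inv GL_mul.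
Proof. by move=> x; apply: val_inj; rewrite /= mulmxV ?mxvalP. Qed.

HB.instance Definition _ := isGroup.Build GL GL_mulA GL_mul1 GL_mulr1
  GL_mulV GL_mulrV.

Lemma GL_det_subproof g : (\det (mxval g))%R \is a GRing.unit.
Proof. by rewrite -unitmxE mxvalP. Qed.

Definition GL_det g : units L := Units (GL_det_subproof g).

Lemma GL_detM : {morph GL_det : g h / g * h}.
Proof. by move=> g h; apply: val_inj; rewrite /= det_mulmx. Qed.

Lemma GL_center_det g : g \in center GL ->
  exists a : units L, GL_det g = a ^+ n.
Proof.
move=> /asboolP gC.
suff [a aU ga] : exists2 a, a \is a GRing.unit & mxval g = (a%:M)%R.
  exists (Units aU); apply: val_inj; rewrite /= ga det_scalar.
  by elim: (n) => [|m IHm]; rewrite ?expg0 ?expr0 // expgS exprS /= -IHm.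
have comm_delta (i j : 'I_n) : i != j ->
    (mxval g *m delta_mx i j = delta_mx i j *m mxval g)%R.
  move=> neq_ij.
  have eU : (1%:M + delta_mx i j : 'M[L]_n)%R \in unitmx.
    have sq0 : (delta_mx i j *m delta_mx i j = 0 :> 'M[L]_n)%R.
      by rewrite mul_delta_mx_cond eq_sym (negPf neq_ij) mulr0n.
    have /mulmx1_unit[] // :
        ((1%:M + delta_mx i j) *m (1%:M - delta_mx i j) = 1%:M :> 'M[L]_n)%R.
    by rewrite mulmxDl mul1mx mulmxBr mulmx1 sq0 subr0 addrNK.
  have /(congr1 mxval) /= := gC (MkGL eU).
  by rewrite mulmxDr mulmxDl mulmx1 mul1mx => /addrI.
have gmx (k l i j : 'I_n) : i != j ->
    (mxval g k i *+ (l == j) = (k == i)%:R * mxval g j l)%R.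
  move=> /comm_delta /matrixP /(_ k l); rewrite !mxE.
  rewrite (bigD1 i) //= [in X in _ = X](bigD1 j) //= !mxE !eqxx /=.
  rewrite big1 ?addr0 => [|s /negPf si]; last by rewrite mxE si mulr0.
  rewrite big1 ?addr0 => [|s /negPf sj]; last by rewrite mxE sj andbF mul0r.
  by rewrite andbT mulr_natr.
move: (mxval g) (mxvalP g) gmx {gC comm_delta}.
case: (n) => [|m] M Mu gmx.
  by exists 1%R; [exact: unitr1 | apply/matrixP => - []].
have ME : (M = (M ord0 ord0)%:M)%R.
  apply/matrixP => k l; rewrite mxE.
  have [<- | neq_kl] := eqVneq k l.
    have [-> // | neq_k0] := eqVneq k ord0.
    by have := gmx k ord0 k ord0 neq_k0; rewrite !eqxx mulr1n mul1r.
  have := gmx k k l k; rewrite eq_sym neq_kl eqxx (negPf neq_kl) mulr1n mul0r.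
  exact.
exists (M ord0 ord0) => //.
rewrite unitfE; apply: contraTneq Mu => M00.
by rewrite unitmxE ME M00 det_scalar expr0n /= unitr0.
Qed.

End GeneralLinear.

Definition NFT (L : fieldType) : Prop :=
  finite_set [set x | x \in torsion (units L)].

(* A torsion_complement of L^* is a choice of A = A(L) with L^* = A x T(L): it
   is torsion-free, as it meets the torsion subgroup trivially. *)
Section TorsionComplement.
Variable G : abelianGroupType.

Record torsion_complement := TorsionComplement {
  tcompl :> {pred G};
  tcomplP : is_complement predT (torsion G) tcompl }.

Variable A : torsion_complement.

Let tcompl_closed : group_closed A. Proof. by case: (tcomplP A). Qed.

HB.instance Definition _ :=
  isMulClosed.Build G (tcompl A) (group_closedM tcompl_closed).
HB.instance Definition _ := isMul1Closed.Build G (tcompl A) tcompl_closed.1.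
HB.instance Definition _ :=
  isInvClosed.Build G (tcompl A) (group_closedV tcompl_closed).

Definition tcompl_proj (x : G) : subgroup (tcompl A) :=
  xget 1 [set a | exists2 t, t \in torsion G & x = sgval a * t].

Lemma tcompl_projP x :
  exists2 t, t \in torsion G & x = sgval (tcompl_proj x) * t.
Proof.
have [_ _ _ /(_ x isT)[a aA [t tT ->]]] := tcomplP A.
rewrite /tcompl_proj; case: xgetP => [b -> //| /(_ (Subgroup aA))[]].
by exists t.
Qed.

Lemma tcompl_projE (a : subgroup (tcompl A)) t :
  t \in torsion G -> tcompl_proj (sgval a * t) = a.
Proof.
move=> tT; have [u uT e] := tcompl_projP (sgval a * t).
have [_ _ AT1 _] := tcomplP A.
apply: val_inj => /=; set b := tcompl_proj _ in e *.
apply/esym/eqP; rewrite -(inj_eq (mulgI (sgval b)^-1)) mulVg; apply/eqP.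
apply: AT1; first by rewrite gpredM ?gpredV ?sgvalP.
have -> : (sgval b)^-1 * sgval a = u / t.
  by apply: (mulIg t); rewrite mulgVK -mulgA e mulKg.
exact: gpredF.
Qed.

Lemma tcompl_projM : {morph tcompl_proj : x y / x * y}.
Proof.
move=> x y; have [t tT ex] := tcompl_projP x; have [u uT ey] := tcompl_projP y.
rewrite {1}ex {1}ey -mulgA [t * _]mulgC -mulgA mulgA -[_ * sgval _]/(sgval (_ * _)).
by apply: tcompl_projE; rewrite gpredM.
Qed.

HB.instance Definition _ :=
  isMultiplicative.Build G (subgroup (tcompl A)) tcompl_proj tcompl_projM.

End TorsionComplement.

Section Addition.
Variable K : groupType.

Record addition := Addition {
  addition_pred :> {pred K};
  additionP :
    is_complement (center K) (predI (torsion K) (center K)) addition_pred }.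

Variable K0 : addition.

Lemma addition_closed : group_closed K0. Proof. by case: (additionP K0). Qed.

Lemma addition_center : {subset K0 <= center K}.
Proof. by case: (additionP K0). Qed.

Lemma addition_normal x y : y \in K0 -> y ^ x \in K0.
Proof.
by move=> yK; have /asboolP/(_ x) yx := addition_center yK; rewrite /conjg yx mulKg.
Qed.

HB.instance Definition _ :=
  isMulClosed.Build K (addition_pred K0) (group_closedM addition_closed).
HB.instance Definition _ :=
  isMul1Closed.Build K (addition_pred K0) addition_closed.1.
HB.instance Definition _ :=
  isInvClosed.Build K (addition_pred K0) (group_closedV addition_closed).
HB.instance Definition _ :=
  isNormalClosed.Build K (addition_pred K0) addition_normal.

End Addition.

Record sym_cocycle (C B : abelianGroupType) := SymCocycle {
  cocycle :> C -> C -> B;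
  cocycleM : forall x y z,
    cocycle (x * y) z * cocycle x y = cocycle x (y * z) * cocycle y z;
  cocycle1g : forall x, cocycle 1 x = 1;
  cocycleg1 : forall x, cocycle x 1 = 1;
  cocycleC : forall x y, cocycle x y = cocycle y x }.

(* The type mentions bar and h only so that the group law can be inferred. *)
Definition extension (Q : groupType) (C B : abelianGroupType)
  (bar : {multiplicative Q -> C}) (h : sym_cocycle C B) : Type := (B * Q)%type.

Section Extension.
Variables (Q : groupType) (C B : abelianGroupType).
Variables (bar : {multiplicative Q -> C}) (h : sym_cocycle C B).

Local Notation extension := (extension bar h).

HB.instance Definition _ := Choice.copy extension (B * Q)%type.

Definition extension_mul (u v : extension) : extension :=
  (u.1 * v.1 * h (bar u.2) (bar v.2), u.2 * v.2).
Definition extension_one : extension := (1, 1).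
Definition extension_inv (u : extension) : extension :=
  ((u.1 * h (bar u.2^-1) (bar u.2))^-1, u.2^-1).

Let bar1 : bar 1 = 1.
Proof. by apply: (mulgI (bar 1)); rewrite -gmulfM !mulg1. Qed.

Lemma extension_mulA : associative extension_mul.
Proof.
move=> [a x] [b y] [c z]; rewrite /extension_mul /= !gmulfM.
congr (_, _); last exact: mulgA.
set hyz := h (bar y) _; set hx_yz := h _ (_ * _).
set hxy := h (bar x) _; set hxy_z := h (_ * _) _.
have -> : a * (b * c * hyz) * hx_yz = a * b * c * (hx_yz * hyz).
  by rewrite [hx_yz * _]mulgC !mulgA.
by rewrite -cocycleM -/hxy -/hxy_z [hxy_z * hxy]mulgC -[_ * hxy * c]mulgA [hxy * c]mulgC !mulgA.
Qed.

Lemma extension_mul1 : left_id extension_one extension_mul.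
Proof.
by move=> [a x]; rewrite /extension_mul /= bar1 cocycle1g mulg1 !mul1g.
Qed.

Lemma extension_mulr1 : right_id extension_one extension_mul.
Proof. by move=> [a x]; rewrite /extension_mul /= bar1 cocycleg1 !mulg1. Qed.

Lemma extension_mulV :
  left_inverse extension_one extension_inv extension_mul.
Proof.
by move=> [a x]; rewrite /extension_mul /= -mulgA !mulVg.
Qed.

Lemma extension_mulrV :
  right_inverse extension_one extension_inv extension_mul.
Proof.
move=> [a x]; rewrite /extension_mul /= mulgV [h (bar x) _]cocycleC.
by rewrite [a * _]mulgC -mulgA mulVg.
Qed.

HB.instance Definition _ := isGroup.Build extension extension_mulA
  extension_mul1 extension_mulr1 extension_mulV extension_mulrV.

Lemma extension_mulE (u v : extension) :
  u * v = (u.1 * v.1 * h (bar u.2) (bar v.2), u.2 * v.2).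
Proof. by []. Qed.

End Extension.

Section AbelianDeformation.
Variables (n : nat) (L : fieldType).
Variables (A : torsion_complement (units L)) (K0 : addition (GL n L)).

Definition AmodAn : abelianGroupType := quotient (powers (subgroup (tcompl A)) n).

(* The map x |-> \bar x from K_f = K / K_0 to A / A^n: take the class of the
   A-component of the determinant of a representative. *)
Definition det_bar (x : quotient (addition_pred K0)) : AmodAn :=
  quotient_pi _ (tcompl_proj A (GL_det (repr x))).

Lemma det_barE (g : GL n L) :
  det_bar (quotient_pi (addition_pred K0) g) = quotient_pi _ (tcompl_proj A (GL_det g)).
Proof.
apply/quotient_piP; have /addition_center/GL_center_det[a] := quotient_repr (addition_pred K0) g.
set g' := repr _ => da.
have -> : g = g' * (g'^-1 * g) by rewrite mulVKg.
rewrite GL_detM da gmulfM mulKg; apply/asboolP; exists (tcompl_proj A a).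
elim: n {g g' da} => [|m IHm].
  rewrite !expg0; apply: (mulgI (tcompl_proj A 1)).
  by rewrite -gmulfM !mulg1.
by rewrite !expgS gmulfM IHm.
Qed.

Lemma det_barM : {morph det_bar : x y / x * y}.
Proof.
move=> x y; rewrite -[x]quotient_reprK -[y]quotient_reprK -quotient_piM.
by rewrite !det_barE GL_detM gmulfM quotient_piM.
Qed.

HB.instance Definition _ :=
  isMultiplicative.Build (quotient (addition_pred K0)) AmodAn det_bar det_barM.

Definition GL_deformation (B : abelianGroupType) (h : sym_cocycle AmodAn B) :
  groupType := extension det_bar h.

End AbelianDeformation.

(* Main.v *)
From HB Require Import structures.
From mathcomp Require Import perm.
From mathcomp Require cyclic.
Require Import Defs.
From mathcomp Require Import all_boot all_order all_algebra.
From mathcomp Require Import boolp classical_sets cardinality.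

Set Implicit Arguments.
Unset Strict Implicit.
Unset Printing Implicit Defensive.

Import GRing.Theory.

(* Let d_i be the diagonal matrix with -1 at place i, w_ij suitable permutation
   matrices and u = 1 + E_01.  In terms of these parameters the field F is
   first-order definable in GL_n(F): its elements are the root elements 1 + a E_01,
   that is 1 and the conjugates of u by the centralizer of the d_i, with the group
   law as addition and the commutators [x_02(a), x_21(b)] = x_01(ab) as
   multiplication.  That this defines a field is a first-order condition on the
   parameters, and in GL_n(F) every choice satisfying it yields a copy of F.  So in
   H every such choice yields a field L = F elementarily.
   By Gauss elimination with a bounded number of elementary factors, matrices with
   torsion determinant embed definably in the group; conjugation on them makes every
   group element correspond to a matrix, up to scalars and central elements.  These
   are first-order facts, so they hold in H, with L in place of F.
   Inside H, torsion of exponent N is split off from the centre (leaving B) and from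
   the group of elements over diag(1, .., 1, a) that have their n-th power in B times
   the image of SL_n(L).  The complements determine A and K_0, and comparing the
   chosen lifts of representatives of A / A^n gives the cocycle h.  Finally A and B
   are interpreted as L^* and Z(H) modulo elements of exponent N, so both are
   elementarily equivalent to F^* / T. *)

(** * Uniform definability *)

(** [H] need not be saturated, so an existential sentence yields parameters with finitely many
    prescribed properties only, whereas elementary equivalence of L and F, and the bound [N] on all
    torsion, are infinite families. This is what rigidity is for: as every admissible tuple in
    GL_n(F) gives F, each further property is a universal statement about tuples and passes to the
    one tuple already chosen in [H]. The constants are [N], the order of T, and [K], the number of
    elementary factors. Characteristic different from 2 makes the reflections cut out the diagonal
    matrices and removes a quadratic term in the rigidity argument; an infinite field has a scalar
    besides 0, 1, -1; n >= 3 gives the third index in the commutator. A cocycle remains because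
    diag(1, .., 1, a) has no canonical lift to [H]: its conjugation action fixes a lift only up to
    the centre. But a^n has one, through the matrix diag(a^-1, .., a^-1, a^(n-1)) of determinant 1,
    so the ambiguity lives on A / A^n. *)

Section Definability.
Variables (S : signature) (I : Type) (M : I -> model S).
Variables (PV : Type) (par : forall i, PV -> M i).

(* A context describes assignments [env i] of objects built from the models
   [M i]; each assignment is read off through elements of [M i] indexed by
   [vars]. *)
Record context := Context {
  env : I -> Type;
  vars : Type;
  rd : forall i, env i -> vars -> M i }.

(** Any placement of parameters and variables among [k] formula variables is allowed, injective or
    not. As [definable] asks for a formula for each placement, weakening, identifying and permuting
    variables is only a change of [r]. *)
Definition reads (G : context) k (r : PV + vars G -> 'I_k) i (eps : env G i)
    (e : 'I_k -> M i) : Prop :=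
  (forall p, e (r (inl p)) = par i p) /\ (forall v, e (r (inr v)) = rd eps v).

(* The formula does not depend on [i]: definability is uniform in the class [M]. *)
Definition definable (G : context) (P : forall i, env G i -> Prop) : Prop :=
  forall k (r : PV + vars G -> 'I_k), exists phi : formula S k,
    forall i (eps : env G i) e, reads r eps e -> (holds phi e <-> P i eps).

Definition dterm (G : context) (t : forall i, env G i -> M i) : Prop :=
  forall k (r : PV + vars G -> 'I_k), exists s : term S k,
    forall i (eps : env G i) e, reads r eps e -> eval e s = t i eps.

Definition tuple_context (J : Type) : context :=
  @Context (fun i => J -> M i) J (fun i y => y).

Definition empty_context : context :=
  @Context (fun=> unit) void (fun i _ v => match v with end).

Section Closure.
Variable G : context.
Implicit Types P Q : forall i, env G i -> Prop.

Lemma definable_iff P Q :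
  (forall i eps, P i eps <-> Q i eps) -> definable P -> definable Q.
Proof.
move=> PQ dP k r; have [phi phiP] := dP k r; exists phi => i eps e er.
by rewrite phiP // PQ.
Qed.

Lemma definable_imp P Q :
  definable P -> definable Q -> definable (fun i eps => P i eps -> Q i eps).
Proof.
move=> dP dQ k r; have [phi phiP] := dP k r; have [psi psiP] := dQ k r.
by exists (Imp phi psi) => i eps e er /=; rewrite (phiP _ _ _ er) (psiP _ _ _ er).
Qed.

Lemma definable_and P Q :
  definable P -> definable Q -> definable (fun i eps => P i eps /\ Q i eps).
Proof.
move=> dP dQ k r; have [phi phiP] := dP k r; have [psi psiP] := dQ k r.
by exists (And phi psi) => i eps e er /=; rewrite (phiP _ _ _ er) (psiP _ _ _ er).
Qed.

Lemma definable_or P Q :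
  definable P -> definable Q -> definable (fun i eps => P i eps \/ Q i eps).
Proof.
move=> dP dQ k r; have [phi phiP] := dP k r; have [psi psiP] := dQ k r.
by exists (Or phi psi) => i eps e er /=; rewrite (phiP _ _ _ er) (psiP _ _ _ er).
Qed.

Lemma definable_cst (b : Prop) : definable (fun i (_ : env G i) => b).
Proof.
move=> k r; have [b1|b0] := pselect b.
  by exists (Imp (Falsum S k) (Falsum S k)) => i eps e er /=; split.
by exists (Falsum S k) => i eps e er /=.
Qed.

Lemma definable_not P : definable P -> definable (fun i eps => ~ P i eps).
Proof. by move=> dP; apply: definable_imp => //; apply: definable_cst. Qed.

Lemma definable_allfin (J : finType) (P : J -> forall i, env G i -> Prop) :
  (forall j, definable (P j)) -> definable (fun i eps => forall j, P j i eps).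
Proof.
move=> dP.
suff /(_ (enum J)) : forall s : seq J, definable (fun i eps => forall j, j \in s -> P j i eps).
  by apply: definable_iff => i eps; split=> h j *; apply: h; rewrite ?mem_enum.
elim=> [|a s IHs].
  by apply: definable_iff (definable_cst True) => i eps; split.
apply: definable_iff (definable_and (dP a) IHs) => i eps; split.
  by move=> [Pa Ps] j; rewrite inE => /predU1P[->|/Ps].
by move=> h; split=> [|j js]; apply: h; rewrite inE ?eqxx ?js ?orbT.
Qed.

Lemma definable_exfin (J : finType) (P : J -> forall i, env G i -> Prop) :
  (forall j, definable (P j)) -> definable (fun i eps => exists j, P j i eps).
Proof.
move=> dP; have := definable_not (definable_allfin (fun j => definable_not (dP j))).
apply: definable_iff => i eps; split=> [|[j Pj] /(_ j)//].
by apply: contra_notP => nP j Pj; apply: nP; exists j.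
Qed.

Lemma definable_eq (t u : forall i, env G i -> M i) :
  dterm t -> dterm u -> definable (fun i eps => t i eps = u i eps).
Proof.
move=> dt du k r; have [s sP] := dt k r; have [v vP] := du k r.
by exists (Equal s v) => i eps e er /=; rewrite (sP _ _ _ er) (vP _ _ _ er).
Qed.

Lemma dterm_param p : dterm (fun i (_ : env G i) => par i p).
Proof. by move=> k r; exists (Var S (r (inl p))) => i eps e [/= ->]. Qed.

Lemma dterm_app (f : op S) (t : 'I_(arity f) -> forall i, env G i -> M i) :
  (forall j, dterm (t j)) ->
  dterm (fun i eps => interp (fun j => t j i eps)).
Proof.
move=> dt k r; have /choice[s sP] := fun j => dt j k r.
exists (App s) => i eps e er /=; congr interp.
by apply: funext => j; apply: sP.
Qed.

End Closure.

(* The elements of a sort are given by finite tuples of elements of the model,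
   and those tuples form a definable set. *)
Record coded_sort := CodedSort {
  scar : I -> Type;
  sidx : finType;
  scode : forall i, scar i -> sidx -> M i;
  sdom : definable (G := tuple_context sidx)
    (fun i y => exists x : scar i, forall j, scode x j = y j) }.

Definition extend (G : context) (s : coded_sort) : context :=
  @Context (fun i => env G i * scar s i)%type (vars G + sidx s)%type
    (fun i eps v => match v with
       inl v => rd eps.1 v | inr j => scode eps.2 j end).

Fixpoint Foralls q k : formula S (q + k) -> formula S k :=
  if q is q'.+1 then fun phi => Foralls (Forall phi : formula S (q' + k))
  else id.

Lemma scons_split k i (e : 'I_k.+1 -> M i) :
  scons (e ord0) (fun j => e (lift ord0 j)) = e.
Proof.
by apply: funext => j; rewrite /scons; case: unliftP => [j' ->|->].
Qed.

Lemma holds_Foralls i q k (phi : formula S (q + k)) (e : 'I_k -> M i) :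
  holds (Foralls phi) e <->
  forall e' : 'I_(q + k) -> M i,
    (forall b, e' (rshift q b) = e b) -> holds phi e'.
Proof.
elim: q => [|q IHq] in phi *.
  have rs b : rshift 0 b = b :> 'I_k by apply: val_inj.
  split=> [h e' he|]; last by apply=> b; rewrite rs.
  by rewrite (_ : e' = e) //; apply: funext => b; rewrite -he rs.
have rl (b : 'I_k) : rshift q.+1 b = lift ord0 (rshift q b) :> 'I_(q + k).+1.
  exact: val_inj.
rewrite /= IHq; split=> [h e' he | h e' he x].
  rewrite -(scons_split e'); apply: (h (fun j => e' (lift ord0 j))) => b.
  by rewrite -he rl.
by apply: h => b; rewrite rl /scons liftK.
Qed.

(** A variable of a sort is replaced by a block of element variables holding its code; the
    quantifier is relativised to the tuples that are codes, which [sdom] makes definable. *)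
Lemma definable_all (G : context) (s : coded_sort)
    (Q : forall i, env G i -> scar s i -> Prop) :
  definable (G := extend G s) (fun i eps => Q i eps.1 eps.2) ->
  definable (fun i eps => forall x, Q i eps x).
Proof.
move=> dQ k r; set q := #|sidx s|.
pose r1 (v : PV + (vars G + sidx s)) : 'I_(q + k) := match v with
  | inl p => rshift q (r (inl p))
  | inr (inl v) => rshift q (r (inr v))
  | inr (inr j) => lshift k (enum_rank j) end.
pose r2 (v : PV + sidx s) : 'I_(q + k) := match v with
  | inl p => rshift q (r (inl p))
  | inr j => lshift k (enum_rank j) end.
have [phi phiP] := dQ _ r1; have [psi psiP] := @sdom s _ r2.
exists (Foralls (Imp psi phi)) => i eps e [ep ev].
rewrite holds_Foralls /=; split=> [h x | h e' he'].
  pose e' (j : 'I_(q + k)) : M i := match split j with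
    inl a => scode x (enum_val (a : 'I_#|sidx s|)) | inr b => e b end.
  have e'r b : e' (rshift q b) = e b.
    by rewrite /e' -[rshift q b]/(unsplit (inr b)) unsplitK.
  have e'l a : e' (lshift k a) = scode x (enum_val (a : 'I_#|sidx s|)).
    by rewrite /e' -[lshift k a]/(unsplit (inl a)) unsplitK.
  apply/(phiP i (eps, x) e').
    split=> [p|[v|j]] /=; rewrite ?e'r ?ep ?ev //.
    by rewrite e'l enum_rankK.
  apply: h => //; apply/(psiP i (scode x)); last by exists x.
  by split=> [p|j] /=; rewrite ?e'r ?e'l ?enum_rankK.
pose y j := e' (lshift k (enum_rank j)).
move=> /(psiP i y)[]; first by split=> // p; rewrite /= he' ep.
move=> x xy; apply/(phiP i (eps, x)) => //.
by split=> [p|[v|j]] /=; rewrite ?he' ?ep ?ev // xy.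
Qed.

Lemma definable_ex (G : context) (s : coded_sort)
    (Q : forall i, env G i -> scar s i -> Prop) :
  definable (G := extend G s) (fun i eps => Q i eps.1 eps.2) ->
  definable (fun i eps => exists x, Q i eps x).
Proof.
move=> dQ; have := definable_not (definable_all
  (Q := fun i eps x => ~ Q i eps x) (definable_not dQ)).
apply: definable_iff => i eps; split=> [|[x Qx] /(_ x)//].
by apply: contra_notP => nQ x Qx; apply: nQ; exists x.
Qed.

Lemma dterm_weak (G : context) s (t : forall i, env G i -> M i)
    (t' : forall i, env (extend G s) i -> M i) :
  (forall i eps x, t' i (eps, x) = t i eps) -> dterm t -> dterm t'.
Proof.
move=> t't dt k r; have [u uP] := dt k (fun v => match v with
  inl p => r (inl p) | inr v => r (inr (inl v)) end).
exists u => i [eps x] e [ep ev]; rewrite t't; apply: uP.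
by split=> // v; apply: (ev (inl v)).
Qed.

Lemma dterm_new (G : context) s (j : sidx s) :
  dterm (G := extend G s) (fun i eps => scode eps.2 j).
Proof.
by move=> k r; exists (Var S (r (inr (inr j)))) => i eps e [_ ev]; rewrite /= (ev (inr j)).
Qed.

Lemma point_dom : definable (G := tuple_context unit)
  (fun i y => exists x : M i, forall j : unit, x = y j).
Proof.
apply: (definable_iff _ (definable_cst (G := tuple_context unit) True)) => i y.
by split=> // _; exists (y tt) => -[].
Qed.

Definition point_sort : coded_sort :=
  @CodedSort (fun i => M i) unit (fun i x _ => x) point_dom.

Lemma family_dom (J : finType) : definable (G := tuple_context J)
  (fun i y => exists x : J -> M i, forall j : J, x j = y j).
Proof.
apply: (definable_iff _ (definable_cst (G := tuple_context J) True)) => i y.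
by split=> // _; exists y.
Qed.

Definition family_sort (J : finType) : coded_sort :=
  @CodedSort (fun i => J -> M i) J (fun i x => x) (@family_dom J).

End Definability.

Arguments empty_context {S I} M.
Arguments definable {S I M PV} par {G} P.
Arguments dterm {S I M PV} par {G} t.
Arguments extend {S I M PV par} G s.

Lemma definable_sentence S I (M : I -> model S) (par : forall i, void -> M i)
    (P : I -> Prop) :
  definable par (G := empty_context M) (fun i _ => P i) ->
  exists p : sentence S, forall i, satisfies (M i) p <-> P i.
Proof.
move=> dP; have [phi phiP] := dP 0 (fun v => match v with
  inl p => match p with end | inr v => match v with end end).
by exists phi => i; apply: (phiP i tt); split=> -[].
Qed.

(** * Interpretation of one structure in another *)

Section Interpretation.
Variables (S : signature) (I : Type) (M : I -> model S).
Variables (PV : Type) (par : forall i, PV -> M i).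

Lemma definable_reindex (G1 G2 : context M) (P : forall i, env G1 i -> Prop)
    (f : forall i, env G2 i -> env G1 i) (s : vars G1 -> vars G2) :
  (forall i (eps : env G2 i) v, rd (f i eps) v = rd eps (s v)) ->
  definable par P -> definable par (fun i eps => P i (f i eps)).
Proof.
move=> fs dP k r; have [phi phiP] := dP k (fun v => match v with
  inl p => r (inl p) | inr v => r (inr (s v)) end).
exists phi => i eps e [ep ev]; apply: phiP.
by split=> //= v; rewrite fs ev.
Qed.

Variables (S' : signature) (N : forall i : I, model S').
(** A relation and not a map, because an element of a quotient group is coded by all its
    representatives. *)
Variable code : forall i, N i -> M i -> Prop.

Local Notation pt := (point_sort par).
Local Notation tup J := (tuple_context M J).

Hypothesis code_ex : forall i (a : N i), exists x, code a x.
Hypothesis code_inj : forall i (a b : N i) x, code a x -> code b x -> a = b.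
Hypothesis code_eq : definable par (G := extend (extend (empty_context M) pt) pt)
  (fun i eps => exists2 a : N i, code a eps.1.2 & code a eps.2).
Hypothesis code_op : forall f : op S', exists2 R : forall i, ('I_(arity f) -> M i) * M i -> Prop,
  definable par (G := extend (tup 'I_(arity f)) pt) R &
  forall i (a : 'I_(arity f) -> N i) xs y, (forall j, code (a j) (xs j)) ->
    (R i (xs, y) <-> code (interp a) y).

(** Operations are known only through their graphs on codes, so the values of subterms have to be
    quantified over. *)
Lemma interp_term k (t : term S' k) :
  exists2 V : forall i, ('I_k -> M i) * M i -> Prop,
  definable par (G := extend (tup 'I_k) pt) V &
  forall i (a : 'I_k -> N i) xs y, (forall j, code (a j) (xs j)) ->
    (V i (xs, y) <-> code (eval a t) y).
Proof.
elim: t => [j|f t IHt].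
  exists (fun i eps => exists2 a : N i, code a (eps.1 j) & code a eps.2).
    apply: (definable_reindex (f := fun i (eps : env (extend (tup 'I_k) pt) i) =>
      (tt, eps.1 j, eps.2) : env (extend (extend (empty_context M) pt) pt) i)
      (s := fun v : (void + unit) + unit => match v with
        inl (inl w) => match w with end | inl (inr _) => inl j | inr w => inr w end)) code_eq.
    by move=> i eps [[[]|[]]|[]].
  move=> i a xs y cxs; split=> [[b bx by_]|cy]; last by exists (a j).
  by rewrite /= -(code_inj bx (cxs j)).
have /choice[V VP] : forall j, exists V : forall i, ('I_k -> M i) * M i -> Prop,
    definable par (G := extend (tup 'I_k) pt) V /\
    forall i (a : 'I_k -> N i) xs y, (forall j, code (a j) (xs j)) ->
      (V i (xs, y) <-> code (eval a (t j)) y).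
  by move=> j; have [V] := IHt j; exists V.
have [R dR RP] := code_op f.
exists (fun i eps => exists zs : 'I_(arity f) -> M i,
    (forall j, V j i (eps.1, zs j)) /\ R i (zs, eps.2)).
  apply: (definable_ex (s := family_sort par 'I_(arity f))
    (Q := fun i (eps : env (extend (tup 'I_k) pt) i) zs =>
      (forall j, V j i (eps.1, zs j)) /\ R i (zs, eps.2))).
  apply: definable_and.
    apply: definable_allfin => j; have [dV _] := VP j.
    apply: (definable_reindex (f := fun i (eps : env (extend (extend (tup 'I_k) pt)
        (family_sort par 'I_(arity f))) i) =>
        (eps.1.1, eps.2 j) : env (extend (tup 'I_k) pt) i)
      (s := fun v : 'I_k + unit => match v with
        inl w => inl (inl w) | inr _ => inr j end)) dV.
    by move=> i eps [w|[]].
  apply: (definable_reindex (f := fun i (eps : env (extend (extend (tup 'I_k) pt)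
        (family_sort par 'I_(arity f))) i) =>
        (eps.2, eps.1.2) : env (extend (tup 'I_(arity f)) pt) i)
      (s := fun v : 'I_(arity f) + unit => match v with
        inl w => inr w | inr w => inl (inr w) end)) dR.
  by move=> i eps [w|w].
move=> i a xs y cxs; split=> [[zs [/= Vz Rz]]|cy].
  by apply/(RP i (fun j => eval a (t j)) zs) => // j; apply/((VP j).2 i a xs).
have /choice[zs zsP] : forall j, exists z, code (eval a (t j)) z by move=> j.
exists zs; split=> [j|]; first by apply/((VP j).2 i a xs).
by apply/(RP i (fun j => eval a (t j)) zs).
Qed.

Lemma interp_formula k (phi : formula S' k) :
  exists2 P : forall i, ('I_k -> M i) -> Prop,
  definable par (G := tup 'I_k) P &
  forall i (a : 'I_k -> N i) xs, (forall j, code (a j) (xs j)) ->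
    (P i xs <-> holds phi a).
Proof.
have quant k' (P : forall i, ('I_k'.+1 -> M i) -> Prop) :
    definable par (G := tup 'I_k'.+1) P ->
    definable par (G := extend (tup 'I_k') pt) (fun i eps => P i (scons eps.2 eps.1)).
  apply: (definable_reindex (f := fun i (eps : env (extend (tup 'I_k') pt) i) =>
      scons eps.2 eps.1 : env (tup 'I_k'.+1) i)
    (s := fun v => if unlift ord0 v is Some j then inl j else inr tt)).
  by move=> i eps v /=; rewrite /scons; case: unliftP.
have dom k' : definable par (G := extend (tup 'I_k') pt)
    (fun i eps => exists a : N i, code a eps.2).
  have := definable_reindex (f := fun i (eps : env (extend (tup 'I_k') pt) i) =>
      (tt, eps.2, eps.2) : env (extend (extend (empty_context M) pt) pt) i)
      (s := fun v : (void + unit) + unit => match v with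
        inl (inl w) => match w with end | _ => inr tt end) _ code_eq.
  move=> h; apply: (definable_iff _ (h _)); last by move=> i eps [[[]|[]]|[]].
  by move=> i eps; split=> [[a /= cx _]|[a cx]]; exists a.
have cons i k' (a : 'I_k' -> N i) xs b x : (forall j, code (a j) (xs j)) -> code b x ->
    forall j, code (scons b a j) (scons x xs j).
  by move=> cxs cx j; rewrite /scons; case: unliftP.
elim: phi => {k} [k t u|k|k p [P dP PP] q [Q dQ QP]|k p [P dP PP] q [Q dQ QP]
    |k p [P dP PP] q [Q dQ QP]|k p [P dP PP]|k p [P dP PP]].
- have [V dV VP] := interp_term t; have [W dW WP] := interp_term u.
  exists (fun i xs => exists y : M i, V i (xs, y) /\ W i (xs, y)).
    apply: (definable_ex (s := pt)
      (Q := fun i (xs : env (tup 'I_k) i) y => V i (xs, y) /\ W i (xs, y))).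
    apply: definable_and; [apply: definable_iff dV|apply: definable_iff dW];
      by move=> i [].
  move=> i a xs cxs; split=> /= [[y [Vy Wy]]|e].
    by apply: (@code_inj _ _ _ y); [apply/(VP _ a)|apply/(WP _ a)]; eauto.
  have [y cy] := code_ex (eval a t); exists y.
  by split; [apply/(VP _ a)|apply/(WP _ a)]; rewrite -?e.
- by exists (fun=> fun=> False) => //; apply: definable_cst.
- exists (fun i xs => P i xs -> Q i xs); first exact: definable_imp.
  by move=> i a xs cxs /=; rewrite (PP _ _ _ cxs) (QP _ _ _ cxs).
- exists (fun i xs => P i xs /\ Q i xs); first exact: definable_and.
  by move=> i a xs cxs /=; rewrite (PP _ _ _ cxs) (QP _ _ _ cxs).
- exists (fun i xs => P i xs \/ Q i xs); first exact: definable_or.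
  by move=> i a xs cxs /=; rewrite (PP _ _ _ cxs) (QP _ _ _ cxs).
- exists (fun i xs => forall x : M i, (exists a : N i, code a x) -> P i (scons x xs)).
    apply: (definable_all (s := pt) (Q := fun i (xs : env (tup 'I_k) i) (x : M i) =>
      (exists a : N i, code a x) -> P i (scons x xs))).
    by apply: definable_imp; [apply: dom|apply: quant].
  move=> i a xs cxs; split=> /= [h b|h x [b bx]].
    have [x bx] := code_ex b; apply/(PP _ _ (scons x xs)); first exact: cons.
    by apply: h; exists b.
  by apply/(PP _ (scons b a)); [exact: cons|exact: h].
- exists (fun i xs => exists x : M i, (exists a : N i, code a x) /\ P i (scons x xs)).
    apply: (definable_ex (s := pt) (Q := fun i (xs : env (tup 'I_k) i) (x : M i) =>
      (exists a : N i, code a x) /\ P i (scons x xs))).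
    by apply: definable_and; [apply: dom|apply: quant].
  move=> i a xs cxs; split=> /= [[x [[b bx] Px]]|[b hb]].
    by exists b; apply/(PP _ _ (scons x xs)) => //; apply: cons.
  have [x bx] := code_ex b; exists x; split; first by exists b.
  by apply/(PP _ (scons b a)) => //; apply: cons.
Qed.

Lemma interp_sentence (p : sentence S') :
  definable par (G := empty_context M) (fun i _ => satisfies (N i) p).
Proof.
have [P dP PP] := interp_formula p.
have := definable_reindex (f := fun i (eps : env (empty_context M) i) =>
   (fun j : 'I_0 => match notF (ltn_ord j) with end) : env (tup 'I_0) i)
   (s := fun v : 'I_0 => match notF (ltn_ord v) with end) _ dP.
move=> h; apply: (definable_iff _ (h _)); last by move=> i eps [].
by move=> i eps; apply: PP => -[].
Qed.

End Interpretation.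

(** * Complements of finite cyclic torsion *)

Local Open Scope group_scope.

Section SubgroupSets.
Variable G : groupType.

Definition is_subgroup (X : G -> Prop) :=
  X 1 /\ forall x y, X x -> X y -> X (x * y^-1).

Variables (X : G -> Prop) (gX : is_subgroup X).

Lemma is_subgroupV x : X x -> X x^-1.
Proof. by move=> Xx; rewrite -[x^-1]mul1g; apply: gX.2 => //; apply: gX.1. Qed.

Lemma is_subgroupM x y : X x -> X y -> X (x * y).
Proof. by move=> Xx Xy; rewrite -[y]invgK; apply: gX.2 => //; apply: is_subgroupV. Qed.

Lemma is_subgroupX x k : X x -> X (x ^+ k).
Proof.
move=> Xx; elim: k => [|k IHk]; first exact: gX.1.
by rewrite expgS; apply: is_subgroupM.
Qed.

Lemma is_subgroup_gcd x a b : (0 < a)%N -> X (x ^+ a) -> X (x ^+ b) -> X (x ^+ gcdn a b).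
Proof.
move=> a0 Xa Xb; have [u _ /dvdnP[q e]] := Bezoutl b a0.
have : X (x ^+ (gcdn a b + u * b)) by rewrite e mulnC expgnA; apply: is_subgroupX.
rewrite expgnDr => h; rewrite -(mulgK (x ^+ (u * b)) (x ^+ _)).
by apply: gX.2 => //; rewrite mulnC expgnA; apply: is_subgroupX.
Qed.

End SubgroupSets.

Section Complement.
Variables (G : abelianGroupType) (B0 : G -> Prop) (zeta : G) (N : nat).
Hypotheses (gB0 : is_subgroup B0) (N0 : (0 < N)%N) (zetaN : zeta ^+ N = 1).
Hypothesis zeta_free : forall i, B0 (zeta ^+ i) -> N %| i.
Hypothesis tors : forall x k, (0 < k)%N -> B0 (x ^+ k) ->
  exists2 b, B0 b & exists i, x = b * zeta ^+ i.

Lemma mulgACA (x y z t : G) : x * y * (z * t) = x * z * (y * t).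
Proof. by rewrite -!mulgA [y * (z * t)]mulgA [y * z]mulgC !mulgA. Qed.

(** Candidates for the complement. Containing all [N]-th powers keeps the quotient by a candidate of
    exponent dividing [N], on which the maximality argument rests. *)
Let good (X : G -> Prop) :=
  [/\ is_subgroup X, forall x, B0 x -> X x, forall x, X (x ^+ N) &
      forall i, X (zeta ^+ i) -> N %| i].

Let zetaV i : zeta ^- i = zeta ^+ (i * N.-1).
Proof.
apply/mulg1_eq; rewrite -expgnDr -{1}[i]muln1 -mulnDr add1n prednK //.
by rewrite mulnC expgnA zetaN expg1n.
Qed.

(** If zeta^i = y^N b, then y^(N*N) lies in [B0], so [tors] writes y as an element of [B0] times a
    power of [zeta]; then y^N, and with it zeta^i, lies in [B0]. *)
Lemma good_base : good (fun x => exists y, exists2 b, B0 b & x = y ^+ N * b).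
Proof.
split.
- split; first by exists 1; exists 1; [exact: gB0.1|rewrite expg1n mulg1].
  move=> _ _ [x [b Bb ->]] [y [c Bc ->]]; exists (x / y); exists (b / c).
    exact: gB0.2.
  by rewrite expgMnC expVgn invgM [c^-1 * _]mulgC mulgACA.
- by move=> x Bx; exists 1; exists x => //; rewrite expg1n mul1g.
- by move=> x; exists x; exists 1; [exact: gB0.1|rewrite mulg1].
- move=> i [x [b Bb e]]; have : B0 ((x ^+ N) ^+ N).
    have -> : x ^+ N = zeta ^+ i * b^-1 by rewrite e mulgK.
    rewrite expgMnC -expgnA mulnC expgnA zetaN expg1n mul1g.
    by apply: is_subgroupX => //; apply: is_subgroupV.
  rewrite -expgnA => /tors[|c Bc [j xE]]; first by rewrite muln_gt0 N0.
  apply: zeta_free; rewrite e; apply: is_subgroupM => //.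
  by rewrite xE expgMnC expgnAC zetaN expg1n mulg1; apply: is_subgroupX.
Qed.

Lemma complement_max : exists2 C, good C &
  forall D : G -> Prop, good D -> (forall x, C x -> D x) -> forall x, D x -> C x.
Proof.
have [F FP Ftot|C [[C0|gC] maxC]] := @Zorn_bigcup G (fun X => X = set0 \/ good X).
- have [[X [FX gX]]|nX] := pselect (exists X, F X /\ good X); last first.
    left; apply/seteqP; split=> // x [X FX Xx]; case: (FP X FX) => [X0|gX].
      by rewrite X0 in Xx.
    by case: nX; exists X.
  right; have [sX BX NX zX] := gX.
  split.
  + split; first by exists X => //; apply: sX.1.
    move=> x y [Y FY Yx] [Z FZ Zy].
    have close W : F W -> W x -> W y -> (\bigcup_(X in F) X)%classic (x * y^-1).
      move=> FW Wx Wy; exists W => //; case: (FP W FW) => [W0|[sW _ _ _]].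
        by rewrite W0 in Wx.
      exact: sW.2.
    by case: (Ftot Y Z FY FZ) => YZ; [apply: (close Z)|apply: (close Y)] => //; apply: YZ.
  + by move=> x /BX Xx; exists X.
  + by move=> x; exists X.
  + move=> i [Y FY Yi]; case: (FP Y FY) => [Y0|[_ _ _ zY]]; last exact: zY.
    by rewrite Y0 in Yi.
- have := maxC _ _ (or_intror good_base); case.
  rewrite C0; split; first by move=> x.
  move=> /(_ 1) []; exists 1; exists 1; first exact: gB0.1.
  by rewrite expg1n mulg1.
- exists C => // D gD CD x Dx; apply: contrapT => nCx.
  by case: (maxC D); [split=> // /(_ x Dx)|right].
Qed.

(** If a maximal [C] together with [zeta] missed x, some power of x, corrected by a power of [zeta],
    would be an element z with z^p in [C] for a prime p, and [C] extended by z would be a larger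
    candidate. *)
Lemma complement_ex : exists C : G -> Prop,
  [/\ is_subgroup C, forall x, B0 x -> C x, forall i, C (zeta ^+ i) -> N %| i &
      forall x, exists2 c, C c & exists i, x = c * zeta ^+ i].
Proof.
have [C gC maxC] := complement_max; have [sC BC NC zC] := gC.
exists C; split=> // x; pose CT x := exists2 c, C c & exists i, x = c * zeta ^+ i.
have sCT : is_subgroup CT.
  split; first by exists 1; [exact: sC.1|exists 0; rewrite expg0 mulg1].
  move=> _ _ [c Cc [i ->]] [d Cd [j ->]]; exists (c / d); first exact: sC.2.
  by exists (i + j * N.-1)%N; rewrite expgnDr -zetaV invgM [_ * d^-1]mulgC mulgACA.
have CCT c : C c -> CT c by move=> Cc; exists c => //; exists 0; rewrite mulg1.
rewrite -/(CT x); apply: contrapT => nx.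
(* The least exponent [k] that brings x into [CT] divides [N]; for a prime [p] dividing it, y =
   x^(k/p) is outside [CT] and y^p inside. *)
have exk : exists k, (0 < k)%N && `[< CT (x ^+ k) >].
  by exists N; rewrite N0; apply/asboolP/CCT/NC.
case: (ex_minnP exk) => k /andP[k0 /asboolP xk] kmin.
have k1 : (1 < k)%N.
  by rewrite ltn_neqAle k0 andbT; apply: contra_notN nx => /eqP k1; rewrite -[x]expg1 k1.
have kN : k %| N.
  have := is_subgroup_gcd sCT k0 xk (CCT _ (NC x)) => xg.
  have := kmin (gcdn k N); rewrite gcdn_gt0 k0 /= (asboolT xg) => /(_ isT) kg.
  by rewrite -[k](@gcdn_idPl k N _) ?dvdn_gcdr //; apply/gcdn_idPl/eqP;
     rewrite eqn_leq kg dvdn_leq ?dvdn_gcdl.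
pose p := pdiv k; have pp : prime p := pdiv_prime k1.
have pk : p %| k := pdiv_dvd k.
pose y := x ^+ (k %/ p).
have ny : ~ CT y.
  move=> yCT; have := kmin (k %/ p); rewrite divn_gt0 ?prime_gt0 // dvdn_leq //=.
  rewrite (asboolT yCT) => /(_ isT); rewrite leqNgt ltn_Pdiv // prime_gt1 //.
have [c Cc [j yp]] : CT (y ^+ p) by rewrite -expgnA divnK.
have pN : p %| N := dvdn_trans pk kN.
(* y^N lies in [C], which forces [N] to divide j * (N / p). Hence zeta^j is a p-th power and can be
   removed from y^p. *)
have pj : p %| j.
  have : C (zeta ^+ (j * (N %/ p))).
    have e : y ^+ N = c ^+ (N %/ p) * zeta ^+ (j * (N %/ p)).
      by rewrite -{1}(divnK pN) mulnC expgnA yp expgMnC -expgnA.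
    have -> : zeta ^+ (j * (N %/ p)) = c ^- (N %/ p) * y ^+ N by rewrite e mulKg.
    by apply: is_subgroupM => //; apply: is_subgroupV => //; apply: is_subgroupX.
  by move=> /zC; rewrite -{1}(divnK pN) [(j * _)%N]mulnC dvdn_pmul2l // divn_gt0 ?prime_gt0 // dvdn_leq.
pose z := y * zeta ^- (j %/ p).
have nz : ~ CT z.
  move=> zCT; apply: ny; rewrite -[y](mulgVK (zeta ^+ (j %/ p))); apply: is_subgroupM => //.
  by exists 1; [exact: sC.1|exists (j %/ p)%N; rewrite mul1g].
have zp : z ^+ p = c.
  by rewrite /z expgMnC yp expVgn -expgnA divnK // mulgK.
pose D x := exists2 d, C d & exists i, x = d * z ^+ i.
have gD : good D; last first.
  apply: nz; apply: CCT; apply: (maxC D gD).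
    by move=> d Cd; exists d => //; exists 0; rewrite mulg1.
  by exists 1; [exact: sC.1|exists 1%N; rewrite mul1g].
split.
- split; first by exists 1; [exact: sC.1|exists 0; rewrite mulg1].
  move=> _ _ [d Cd [i ->]] [e Ce [l ->]]; exists (d / e * c ^- l).
    by apply: sC.2; [apply: sC.2|apply: is_subgroupX].
  exists (i + l * p.-1)%N; rewrite expgnDr invgM [_ * e^-1]mulgC mulgACA -!mulgA.
  congr (_ * (_ * _)); rewrite mulgA [_ * z ^+ i]mulgC -mulgA; congr (_ * _).
  have -> : c ^+ l = z ^+ l * z ^+ (l * p.-1).
    by rewrite -expgnDr -mulnS prednK ?prime_gt0 // mulnC expgnA zp.
  by rewrite invgM [_ * (z ^+ l)^-1]mulgC -mulgA mulVg mulg1.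
- by move=> b /BC Cb; exists b => //; exists 0; rewrite mulg1.
- by move=> b; exists (b ^+ N) => //; exists 0; rewrite mulg1.
(* If [p] does not divide [l], then z^p and z^l in [CT] put z itself into [CT], by Bezout. *)
- move=> i [d Cd [l e]].
  have zl : CT (z ^+ l).
    exists d^-1; first exact: is_subgroupV.
    by exists i; rewrite e mulKg.
  have [pl|npl] := boolP (p %| l).
    apply: zC; rewrite e; apply: is_subgroupM => //.
    by rewrite -(divnK pl) mulnC expgnA zp; apply: is_subgroupX.
  case: nz; rewrite -[z]expg1; have <- : gcdn p l = 1%N by apply/eqP; rewrite -/(coprime p l) prime_coprime.
  by apply: is_subgroup_gcd; rewrite ?prime_gt0 // zp; apply: CCT.
Qed.

End Complement.

(** * Elementary matrices *)

Section Elementary.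
Local Open Scope ring_scope.
Variable L : fieldType.

Definition elem n (i j : 'I_n) (a : L) : 'M[L]_n := 1%:M + a *: delta_mx i j.

Lemma elem0 n (i j : 'I_n) : elem i j 0 = 1%:M.
Proof. by rewrite /elem scale0r addr0. Qed.

Lemma elemD n (i j : 'I_n) a b : i != j -> elem i j (a + b) = elem i j a *m elem i j b.
Proof.
move=> ij; rewrite /elem mulmxDl mul1mx mulmxDr mulmx1 -scalemxAl -scalemxAr.
by rewrite mul_delta_mx_0 1?eq_sym // !scaler0 addr0 scalerDl addrA addrAC.
Qed.

Lemma elemE n (i j : 'I_n) a k l :
  elem i j a k l = (k == l)%:R + a *+ ((k == i) && (l == j)).
Proof. by rewrite !mxE; case: (_ && _); rewrite ?mulr1 ?mulr0 ?mulr1n ?mulr0n. Qed.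

Lemma det_elem n (i j : 'I_n) a : i != j -> \det (elem i j a) = 1.
Proof.
wlog ij : i j / (j < i)%N.
  move=> wl nij; case: (ltngtP j i) => [ji|ij|/val_inj e]; first exact: wl.
    rewrite -det_tr /elem linearD linearZ /= trmx1 trmx_delta.
    by apply: wl; rewrite // eq_sym.
  by rewrite e eqxx in nij.
move=> nij; rewrite det_trig.
  by rewrite big1 // => k _; rewrite elemE eqxx; case: eqP => [->|_]; rewrite ?(negPf nij) addr0.
apply/is_trig_mxP => k l kl; rewrite elemE.
case: eqP kl => [->|_]; first by rewrite ltnn.
rewrite add0r; case: eqP => [->|_ _] //=.
by case: eqP => [->|_ _] //=; rewrite ltnNge ltnW.
Qed.

Lemma elem_unit n (i j : 'I_n) a : i != j -> elem i j a \in unitmx.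
Proof. by move=> ij; rewrite unitmxE det_elem ?unitr1. Qed.

Lemma comm_delta_scalar n (m : 'M[L]_n) :
  (forall i j : 'I_n, i != j -> m *m delta_mx i j = delta_mx i j *m m) ->
  exists a, m = a%:M.
Proof.
move=> h; have gmx (k l i j : 'I_n) : i != j -> m k i *+ (l == j) = (k == i)%:R * m j l.
  move=> /h /matrixP /(_ k l); rewrite !mxE.
  rewrite (bigD1 i) //= [in X in _ = X](bigD1 j) //= !mxE !eqxx /=.
  rewrite big1 ?addr0 => [|s /negPf si]; last by rewrite mxE si mulr0.
  rewrite big1 ?addr0 => [|s /negPf sj]; last by rewrite mxE sj andbF mul0r.
  by rewrite andbT mulr_natr.
case: n m {h} gmx => [|n] m gmx; first by exists 0; apply/matrixP => -[].
exists (m ord0 ord0); apply/matrixP => k l; rewrite mxE.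
have [<- | neq_kl] := eqVneq k l.
  have [-> // | neq_k0] := eqVneq k ord0.
  by have := gmx k ord0 k ord0 neq_k0; rewrite !eqxx mulr1n mul1r.
have := gmx k k l k; rewrite eq_sym neq_kl eqxx (negPf neq_kl) mulr1n mul0r.
exact.
Qed.

Lemma comm_elem_scalar n (m : 'M[L]_n) :
  (forall i j : 'I_n, i != j -> m *m elem i j 1 = elem i j 1 *m m) ->
  exists a, m = a%:M.
Proof.
move=> h; apply: comm_delta_scalar => i j /h.
by rewrite /elem mulmxDr mulmxDl mulmx1 mul1mx scale1r => /addrI.
Qed.

(** Recursion on the bound lets [word_rel] repeat the definition as a formula of fixed length; the
    first alternative admits shorter products. *)
Fixpoint elem_prod n k (m : 'M[L]_n) : Prop :=
  if k is k'.+1 then elem_prod k' m \/ exists i j, i != j /\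
    exists a m', m = elem i j a *m m' /\ elem_prod k' m'
  else m = 1%:M.

Lemma elem_prodW n k l (m : 'M_n) : (k <= l)%N -> elem_prod k m -> elem_prod l m.
Proof. by move=> /subnK <- ; elim: (l - k)%N => [|d IHd] //= mk; left; apply: IHd. Qed.

Lemma elem_prodM n k l (m m' : 'M_n) :
  elem_prod k m -> elem_prod l m' -> elem_prod (k + l) (m *m m').
Proof.
elim: k m => [|k IHk] m /=; first by move=> ->; rewrite mul1mx.
move=> [mk|[i [j [ij [a [m1 [-> m1k]]]]]]] m'l; first by left; apply: IHk.
by right; exists i, j; split=> //; exists a, (m1 *m m'); rewrite mulmxA; split=> //; apply: IHk.
Qed.

Lemma elem_prod_elem n (i j : 'I_n) a : i != j -> elem_prod 1 (elem i j a).
Proof. by move=> ij; right; exists i, j; split=> //; exists a, 1%:M; rewrite mulmx1. Qed.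

Lemma elem_prodV n k (m : 'M_n) : elem_prod k m ->
  exists m', [/\ elem_prod k m', m *m m' = 1%:M & m' *m m = 1%:M].
Proof.
elim: k m => [|k IHk] m /=; first by move=> ->; exists 1%:M; rewrite mulmx1.
move=> [/IHk[m' [? ? ?]]|[i [j [ij [a [m1 [-> /IHk[m' [m'k e1 e2]]]]]]]]].
  by exists m'; split=> //; left.
exists (m' *m elem i j (- a)); split.
- change (elem_prod k.+1 (m' *m elem i j (- a))).
  by rewrite -addn1; apply: elem_prodM => //; apply: elem_prod_elem.
- by rewrite mulmxA -(mulmxA (elem i j a)) e1 mulmx1 -elemD // subrr elem0.
- by rewrite mulmxA -(mulmxA m') -elemD // addNr elem0 mulmx1.
Qed.

Lemma det_elem_prod n k (m : 'M_n) : elem_prod k m -> \det m = 1.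
Proof.
elim: k m => [|k IHk] m /=; first by move=> ->; rewrite det1.
move=> [/IHk//|[i [j [ij [a [m1 [-> /IHk e]]]]]]].
by rewrite det_mulmx det_elem // e mulr1.
Qed.

Lemma elem_prod_block n k (m : 'M_n) :
  elem_prod k m -> elem_prod k (block_mx 1%:M 0 0 m : 'M_(1 + n)).
Proof.
elim: k m => [|k IHk] m /=; first by move=> ->; rewrite -scalar_mx_block.
move=> [/IHk|[i [j [ij [a [m1 [-> /IHk e]]]]]]]; first by left.
right; exists (rshift 1 i), (rshift 1 j); split; first by rewrite eq_rshift.
exists a, (block_mx 1%:M 0 0 m1); split=> //.
have -> : elem (rshift 1 i) (rshift 1 j) a = block_mx 1%:M 0 0 (elem i j a).
  rewrite /elem (scalar_mx_block 1 n) delta_mx_dshift delta_mx_rshift.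
  by rewrite -[X in col_mx X _]row_mx0 -block_mxEv scale_block_mx !scaler0 add_block_mx !addr0.
by rewrite mulmx_block !(mulmx0, mul0mx, mul1mx, mulmx1, addr0, add0r).
Qed.

Lemma elem_prod_col n (c : 'cV_n) : elem_prod n (block_mx 1%:M 0 c 1%:M : 'M_(1 + n)).
Proof.
have -> : c = \sum_(i <- enum 'I_n) c i 0 *: delta_mx i 0.
  rewrite big_enum /= [LHS]matrix_sum_delta.
  by apply: eq_bigr => i _; rewrite big_ord1.
rewrite -[X in elem_prod X](size_enum_ord n).
elim: (enum 'I_n) => [|i s IHs]; first by rewrite big_nil -scalar_mx_block.
rewrite big_cons /=; right; exists (rshift 1 i), (lshift n 0); split; first by rewrite eq_rlshift.
exists (c i 0), (block_mx 1%:M 0 (\sum_(i <- s) c i 0 *: delta_mx i 0) 1%:M); split=> //.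
have -> : elem (rshift 1 i) (lshift n 0) (c i 0) = block_mx 1%:M 0 (c i 0 *: delta_mx i 0) 1%:M.
  rewrite /elem (scalar_mx_block 1 n) delta_mx_dshift delta_mx_lshift.
  by rewrite -[X in col_mx X _]row_mx0 -block_mxEv scale_block_mx !scaler0 add_block_mx !addr0 add0r.
by rewrite mulmx_block !(mulmx0, mul0mx, mul1mx, mulmx1, addr0, add0r).
Qed.

Lemma elem_prod_row n (r : 'rV_n) : elem_prod n (block_mx 1%:M r 0 1%:M : 'M_(1 + n)).
Proof.
have -> : r = \sum_(i <- enum 'I_n) r 0 i *: delta_mx 0 i.
  by rewrite big_enum /=; apply: row_sum_delta.
rewrite -[X in elem_prod X](size_enum_ord n).
elim: (enum 'I_n) => [|i s IHs]; first by rewrite big_nil -scalar_mx_block.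
rewrite big_cons /=; right; exists (lshift n 0), (rshift 1 i); split; first by rewrite eq_lrshift.
exists (r 0 i), (block_mx 1%:M (\sum_(i <- s) r 0 i *: delta_mx 0 i) 0 1%:M); split=> //.
have -> : elem (lshift n 0) (rshift 1 i) (r 0 i) = block_mx 1%:M (r 0 i *: delta_mx 0 i) 0 1%:M.
  rewrite /elem (scalar_mx_block 1 n) delta_mx_ushift delta_mx_rshift.
  by rewrite -[X in col_mx _ X]row_mx0 -block_mxEv scale_block_mx !scaler0 add_block_mx !addr0 add0r.
by rewrite mulmx_block !(mulmx0, mul0mx, mul1mx, mulmx1, addr0, add0r) addrC.
Qed.

Definition diag_last n (a : L) : 'M[L]_n.+1 :=
  diag_mx (\row_i if i == ord_max then a else 1).

Lemma det_diag_last n a : \det (diag_last n a) = a.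
Proof.
rewrite det_diag (bigD1 ord_max) //= mxE eqxx big1 ?mulr1 // => i /negPf ni.
by rewrite mxE ni.
Qed.

Lemma diag_last_block n a :
  diag_last n.+1 a = block_mx 1%:M 0 0 (diag_last n a) :> 'M_(1 + n.+1).
Proof.
apply/matrixP => i j; case: (split_ordP i) => i' ->; case: (split_ordP j) => j' ->.
- by rewrite block_mxEul !mxE !ord1.
- rewrite block_mxEur !mxE; have -> : (lshift n.+1 i' == rshift 1 j' :> 'I_n.+2) = false.
    by apply/eqP => /(congr1 (@nat_of_ord _)); rewrite ord1.
  by [].
- rewrite block_mxEdl !mxE; have -> : (rshift 1 i' == lshift n.+1 j' :> 'I_n.+2) = false.
    by apply/eqP => /(congr1 (@nat_of_ord _)); rewrite ord1.
  by [].
by rewrite block_mxEdr !mxE.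
Qed.

(** No scaling is available, so the corner is corrected by a multiple of a row whose first entry is
    nonzero; if only the corner is nonzero in its column, its row is first added to another one. *)
Lemma corner_unit n (m : 'M[L]_(1 + n.+1)) : m \in unitmx ->
  exists2 e, elem_prod 2 e & (e *m m) (lshift _ 0) (lshift _ 0) = 1.
Proof.
move=> mU; set o := lshift _ _.
have step (m' : 'M[L]_(1 + n.+1)) i : i != o -> m' i o != 0 ->
    (elem o i ((1 - m' o o) / m' i o) *m m') o o = 1.
  move=> io mio; rewrite /elem mulmxDl mul1mx -scalemxAl mxE [X in _ + X]mxE.
  rewrite [X in _ * X]mxE (bigD1 i) //= big1 ?addr0 => [|k /negPf ki].
    by rewrite mxE !eqxx mul1r divfK // addrC subrK.
  by rewrite mxE ki andbF mul0r.
have [[i io mio]|h] := pselect (exists2 i, i != o & m i o != 0).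
  exists (elem o i ((1 - m o o) / m i o)); last exact: step.
  by apply: (@elem_prodW _ 1) => //; apply: elem_prod_elem; rewrite eq_sym.
have m0 i : i != o -> m i o = 0.
  by move=> io; apply/eqP; apply: contra_notT h => mi; exists i.
have moo : m o o != 0.
  apply: contraTneq mU => moo; rewrite unitmxE (expand_det_col _ o) big1 ?unitr0 // => i _.
  by have [->|/m0 ->] := eqVneq i o; rewrite ?moo mul0r.
pose i := rshift 1 (0 : 'I_n.+1); have io : i != o by rewrite eq_rlshift.
have m1 : (elem i o 1 *m m) i o != 0.
  rewrite /elem scale1r mulmxDl mul1mx mxE m0 // add0r mxE (bigD1 o) //= big1 ?addr0.
    by rewrite mxE !eqxx mul1r.
  by move=> k /negPf ko; rewrite mxE ko andbF mul0r.
exists (elem o i ((1 - (elem i o 1 *m m) o o) / (elem i o 1 *m m) i o) *m elem i o 1).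
  by apply: (@elem_prodM _ 1 1); apply: elem_prod_elem; rewrite // eq_sym.
by rewrite -mulmxA; apply: step.
Qed.

Lemma elem_reduction n : exists M, forall m : 'M[L]_n.+1, m \in unitmx ->
  exists e1 e2, [/\ elem_prod M e1, elem_prod M e2 & e1 *m m *m e2 = diag_last n (\det m)].
Proof.
elim: n => [|n [M IHn]].
  exists 0 => m mU; exists 1%:M, 1%:M; split=> //; rewrite mul1mx mulmx1.
  by apply/matrixP => i j; rewrite !mxE !ord1 !eqxx /= mulr1n det_mx11.
(* Two factors produce the corner 1 and [n.+1] clear the column below it; on the right the row needs
   only [n.+1]. *)
exists (M + (n.+1 + 2))%N => m mU.
have [e0 e0P] := @corner_unit n m mU.
have [m0 m0E] : exists m0 : 'M_(1 + n.+1), m0 = e0 *m m by exists (e0 *m m).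
rewrite -m0E => m00.
have m0U : m0 \in unitmx.
  by rewrite m0E unitmx_mul mU andbT unitmxE (det_elem_prod e0P) unitr1.
have dm0 : \det m0 = \det m by rewrite m0E det_mulmx (det_elem_prod e0P) mul1r.
have ulE : ulsubmx m0 = 1%:M.
  by apply/matrixP => i j; rewrite !mxE !ord1 -m00.
pose c := dlsubmx m0; pose r := ursubmx m0; pose d := drsubmx m0 - c *m r.
have e : block_mx 1%:M 0 (- c) 1%:M *m m0 *m block_mx 1%:M (- r) 0 1%:M =
    block_mx 1%:M 0 0 d.
  rewrite -[m0]submxK ulE -/c -/r !mulmx_block.
  rewrite !(mulmx0, mul0mx, mul1mx, mulmx1, addr0, add0r) mulNmx.
  by rewrite [- r + r]addNr [- c + c]addNr mul0mx add0r addrC.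
have dd : \det d = \det m.
  have := congr1 determinant e; rewrite !det_mulmx det_lblock det_ublock !det1 !mulr1.
  by rewrite det_ublock det1 !mul1r dm0.
have dU : d \in unitmx by rewrite unitmxE dd -unitmxE.
have [e1 [e2 [e1P e2P e12]]] := IHn d dU.
exists (block_mx 1%:M 0 0 e1 *m (block_mx 1%:M 0 (- c) 1%:M *m e0)).
exists (block_mx 1%:M (- r) 0 1%:M *m block_mx 1%:M 0 0 e2); split.
- apply: elem_prodM; first exact: elem_prod_block.
  by apply: elem_prodM => //; apply: elem_prod_col.
- apply: (@elem_prodW _ (n.+1 + M)%N); first by rewrite addnC leq_add2l leq_addr.
  by apply: elem_prodM; [apply: elem_prod_row|apply: elem_prod_block].
have -> : block_mx 1%:M 0 0 e1 *m (block_mx 1%:M 0 (- c) 1%:M *m e0) *m m *m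
   (block_mx 1%:M (- r) 0 1%:M *m block_mx 1%:M 0 0 e2) =
   block_mx 1%:M 0 0 e1 *m (block_mx 1%:M 0 (- c) 1%:M *m m0 *m
   block_mx 1%:M (- r) 0 1%:M) *m block_mx 1%:M 0 0 e2 by rewrite m0E !mulmxA.
rewrite e !mulmx_block !(mulmx0, mul0mx, mul1mx, mulmx1, addr0, add0r) e12 dd.
by rewrite diag_last_block.
Qed.

Lemma diag_last_elem n a (i j : 'I_n.+1) b : i != j -> a != 0 -> exists b',
  elem i j b *m diag_last n a = diag_last n a *m elem i j b'.
Proof.
move=> ij a0; pose d i := if i == ord_max :> 'I_n.+1 then a else 1.
have d0 k : d k != 0 by rewrite /d; case: ifP => //; rewrite oner_eq0.
exists ((d i)^-1 * b * d j); rewrite /elem mulmxDl mulmxDr mul1mx mulmx1; congr (_ + _).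
rewrite /diag_last -[LHS]scalemxAl -[RHS]scalemxAr; apply/matrixP => k l.
rewrite mxE mul_mx_diag [RHS]mxE mul_diag_mx !mxE -/(d l) -/(d k).
case: eqP => [->|_]; last by rewrite !(mul0r, mulr0).
case: eqP => [->|_]; last by rewrite !(mul0r, mulr0).
by rewrite mul1r mulr1 [RHS]mulrC -!mulrA mulVKf ?d0.
Qed.

Lemma diag_last_elem_prod n a k (m : 'M_n.+1) : a != 0 -> elem_prod k m ->
  exists2 m', elem_prod k m' & m *m diag_last n a = diag_last n a *m m'.
Proof.
move=> a0; elim: k m => [|k IHk] m /=.
  by move=> ->; exists 1%:M => //; rewrite mul1mx mulmx1.
move=> [/IHk[m' m'P e]|[i [j [ij [b [m1 [-> /IHk[m' m'P e]]]]]]]].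
  by exists m' => //; left.
have [b' e'] := diag_last_elem b ij a0.
exists (elem i j b' *m m').
  by right; exists i, j; split=> //; exists b', m'.
by rewrite -mulmxA e !mulmxA e'.
Qed.

(** Diagonal matrices normalise each root subgroup, so the left factors from [elem_reduction] can be
    carried past the diagonal without a change in their number. *)
Lemma elem_generation n : exists M, forall m : 'M[L]_n.+1, m \in unitmx ->
  exists2 e, elem_prod M e & m = diag_last n (\det m) *m e.
Proof.
have [M MP] := elem_reduction n; exists (M + M)%N => m mU.
have [e1 [e2 [/elem_prodV[f1 [f1P e1f1 f1e1]] /elem_prodV[f2 [f2P e2f2 f2e2]] e]]] := MP m mU.
have d0 : \det m != 0 by rewrite -unitfE -unitmxE.
have [f1' f1'P ef1] := diag_last_elem_prod d0 f1P.
exists (f1' *m f2); first exact: elem_prodM.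
by rewrite mulmxA -ef1 -e !mulmxA f1e1 mul1mx -mulmxA e2f2 mulmx1.
Qed.

End Elementary.

(** * Reconstruction of a deformation *)

Section AbelianSub.
Variable H : groupType.

Record abelian_sub := AbelianSub {
  asub :> {pred H};
  asub_closed : group_closed asub;
  asub_comm : {in asub &, forall x y, x * y = y * x} }.

Variable S : abelian_sub.

HB.instance Definition _ :=
  isMulClosed.Build H (asub S) (group_closedM (asub_closed S)).
HB.instance Definition _ := isMul1Closed.Build H (asub S) (asub_closed S).1.
HB.instance Definition _ :=
  isInvClosed.Build H (asub S) (group_closedV (asub_closed S)).

Definition asub_group := subgroup (asub S).
HB.instance Definition _ := Choice.on asub_group.
HB.instance Definition _ := Group.copy asub_group (subgroup (asub S)).

Lemma asub_groupC : @commutative asub_group asub_group *%g.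
Proof. by move=> x y; apply: val_inj; apply: asub_comm; apply: sgvalP. Qed.

HB.instance Definition _ := Group_isAbelian.Build asub_group asub_groupC.

Definition aval (x : asub_group) : H := sgval x.

Lemma aval_inj : injective aval. Proof. exact: val_inj. Qed.

Lemma avalP x : aval x \in S. Proof. exact: sgvalP. Qed.

Lemma avalM x y : aval (x * y) = aval x * aval y. Proof. by []. Qed.

Lemma avalV x : aval x^-1 = (aval x)^-1. Proof. by []. Qed.

Lemma avalX x k : aval (x ^+ k) = aval x ^+ k.
Proof. by elim: k => // k IHk; rewrite !expgS avalM IHk. Qed.

Lemma aval_ex (x : H) : x \in S -> exists y, aval y = x.
Proof. by move=> xS; exists (Subgroup xS). Qed.

End AbelianSub.

(** [complement_ex] speaks of abelian groups; here it is applied to an abelian subgroup [M] of [H],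
    taken as a group of its own. *)
Lemma asub_complement (H : groupType) (M : abelian_sub H) (B0 : H -> Prop) (zeta : H) N :
  is_subgroup B0 -> (forall x, B0 x -> x \in M) -> zeta \in M -> (0 < N)%N ->
  zeta ^+ N = 1 -> (forall i, B0 (zeta ^+ i) -> N %| i) ->
  (forall x k, x \in M -> (0 < k)%N -> B0 (x ^+ k) ->
    exists2 b, B0 b & exists i, x = b * zeta ^+ i) ->
  exists C : abelian_sub H, [/\ forall x, B0 x -> x \in C, {subset C <= M},
    forall i, zeta ^+ i \in C -> N %| i &
    forall x, x \in M -> exists2 c, c \in C & exists i, x = c * zeta ^+ i].
Proof.
move=> gB0 B0M /aval_ex[z <-] N0 zN zfree tors.
have gB1 : is_subgroup (fun x : asub_group M => B0 (aval x)).
  by split=> [|x y]; [exact: gB0.1|exact: gB0.2].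
have [|||C [sC BC zC CM]] := complement_ex (zeta := z) gB1 N0.
- by apply: aval_inj; rewrite avalX.
- by move=> i; rewrite avalX; apply: zfree.
- move=> x k k0; rewrite avalX => /(tors _ _ (avalP x) k0)[b Bb [i e]].
  have [b' b'E] := aval_ex (B0M _ Bb); exists b'; first by rewrite b'E.
  by exists i; apply: aval_inj; rewrite avalM avalX b'E.
pose P := [pred x | `[< exists2 c, C c & x = aval c >]].
have gP : group_closed P.
  split; first by apply/asboolP; exists 1 => //; exact: sC.1.
  move=> _ _ /asboolP[x Cx ->] /asboolP[y Cy ->]; apply/asboolP.
  by exists (x * y^-1) => //; apply: sC.2.
have PC : {in P &, forall x y, x * y = y * x}.
  by move=> _ _ /asboolP[x Cx ->] /asboolP[y Cy ->]; apply: asub_comm; apply: avalP.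
exists (AbelianSub gP PC); split.
- move=> x B0x; have [y yE] := aval_ex (B0M _ B0x); apply/asboolP; exists y => //.
  by apply: BC; rewrite yE.
- by move=> _ /asboolP[x _ ->]; apply: avalP.
- move=> i /asboolP[x Cx]; rewrite -avalX => /aval_inj e; apply: zC; by rewrite e.
- move=> x /aval_ex[y <-]; have [c Cc [i ->]] := CM y; exists (aval c).
    by apply/asboolP; exists c.
  by exists i; rewrite avalM avalX.
Qed.

Section DiagLast.
Variables (L : fieldType) (n : nat).
Local Open Scope ring_scope.

Local Notation dg := (diag_last n).

Lemma diag_lastE (a : L) i j : dg a i j = (if i == ord_max then a else 1) *+ (i == j).
Proof. by rewrite !mxE. Qed.

Lemma diag_last1 : dg (1 : L) = 1.
Proof. by apply/matrixP => i j; rewrite diag_lastE mxE; case: ifP. Qed.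

Lemma diag_lastM (a b : L) : dg (a * b) = dg a * dg b.
Proof.
rewrite -[RHS]/(_ *m _) mulmx_diag; congr diag_mx.
by apply/rowP => i; rewrite !mxE; case: ifP; rewrite ?mulr1.
Qed.

Lemma diag_lastX (a : L) k : dg (a ^+ k) = dg a ^+ k.
Proof. by elim: k => [|k IHk]; rewrite ?diag_last1 // !exprS diag_lastM IHk. Qed.

Lemma diag_last_unit (a : L) : a != 0 -> dg a \is a GRing.unit.
Proof. by move=> a0; rewrite -[_ \is a _]/(_ \in unitmx) unitmxE det_diag_last unitfE. Qed.

Lemma diag_lastV (a : L) : a != 0 -> dg a^-1 = (dg a)^-1.
Proof.
move=> a0; apply: (mulrI (diag_last_unit a0)).
by rewrite mulrV ?diag_last_unit // -diag_lastM mulfV // diag_last1.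
Qed.

Lemma diag_lastC (a b : L) : dg a * dg b = dg b * dg a.
Proof. by rewrite -!diag_lastM mulrC. Qed.

Lemma diag_last_scalar (a b : L) : (0 < n)%N -> dg a = b%:M -> a = 1 /\ b = 1.
Proof.
move=> n0 e; have om : ord0 != ord_max :> 'I_n.+1 by rewrite -(inj_eq val_inj) /= ltn_eqF.
have /esym := congr1 (fun m : 'M_n.+1 => m ord0 ord0) e.
have := congr1 (fun m : 'M_n.+1 => m ord_max ord_max) e.
rewrite !diag_lastE !mxE !eqxx /= !mulr1n => -> ->.
by rewrite (negPf om).
Qed.

(* [scaled_diag a = diag (a^-1, .., a^-1, a^n)], of determinant 1, differs from
   [diag (1, .., 1, a^(n+1))] by a scalar. *)
Definition scaled_diag (a : L) : 'M[L]_n.+1 := a^-1 *: dg (a ^+ n.+1).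

Lemma det_scaled_diag (a : L) : a != 0 -> \det (scaled_diag a) = 1.
Proof. by move=> a0; rewrite detZ det_diag_last exprVn mulVf ?expf_neq0. Qed.

Lemma scaled_diagM (a b : L) : scaled_diag (a * b) = scaled_diag a * scaled_diag b.
Proof.
by rewrite /scaled_diag exprMn diag_lastM invfM -scalerAl -scalerAr scalerA.
Qed.

Lemma scaled_diag1 : scaled_diag 1 = 1.
Proof. by rewrite /scaled_diag expr1n diag_last1 invr1 scale1r. Qed.

End DiagLast.

HB.instance Definition _ (G : abelianGroupType) :=
  SemiGroup.isCommutativeLaw.Build G *%g mulgC.

Lemma mxvalX (n : nat) (L : fieldType) (x : GL n.+1 L) k :
  mxval (x ^+ k) = (mxval x ^+ k)%R.
Proof. by elim: k => // k IHk; rewrite expgS exprS -IHk. Qed.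

Section Reconstruction.
Variables (n' : nat) (L : fieldType) (H : groupType) (N : nat) (w : L).
Local Notation n := n'.+2.
Variable rho : 'M[L]_n -> H.

Local Open Scope ring_scope.

Local Notation dg := (diag_last n'.+1).
Local Notation sd := (scaled_diag n'.+1).

(** The group Is_K(K'), once [N] annihilates the torsion of L^*. *)
Definition det_torsion (s : 'M[L]_n) := \det s ^+ N = 1.

(** A relation in both directions: under the hypotheses below, g determines m up to scalars, and m
    determines g up to the centre of [H]. *)
Definition covers (m : 'M[L]_n) (g : H) := forall s, det_torsion s ->
  rho (m * s * m^-1) = (g * rho s * g^-1)%g.

Hypothesis w_prim : N.-primitive_root w.
Hypothesis torsL : forall (x : L) k, (0 < k)%N -> x ^+ k = 1 -> x ^+ N = 1.
Hypothesis rhoM : forall s t, det_torsion s -> det_torsion t ->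
  rho (s * t) = (rho s * rho t)%g.
Hypothesis rho_inj : forall s, det_torsion s -> rho s = 1%g -> s = 1.
Hypothesis covers_surj : forall g, exists2 m : 'M[L]_n, m \is a GRing.unit & covers m g.
Hypothesis covers_total : forall m : 'M[L]_n, m \is a GRing.unit -> exists g, covers m g.
Hypothesis covers1_center : forall g, covers 1 g -> g \in center H.
Hypothesis center_torsion : forall z k, z \in center H -> (0 < k)%N ->
  (z ^+ k = 1)%g -> exists i, z = rho (w ^+ i)%:M.
(** Makes the elements over the matrices diag(1, .., 1, a) an abelian group, from which torsion can
    be split off. *)
Hypothesis covers_diag_comm : forall (a b : L) g g', a != 0 -> b != 0 ->
  covers (dg a) g -> covers (dg b) g' -> (g * g' = g' * g)%g.

Let N0 : (0 < N)%N. Proof. exact: prim_order_gt0 w_prim. Qed.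
Let wN : w ^+ N = 1. Proof. exact: prim_expr_order w_prim. Qed.
Let w0 : w != 0.
Proof. by apply/eqP => w0; move: wN; rewrite w0 expr0n gtn_eqF // => /esym/eqP; rewrite oner_eq0. Qed.
Let wi0 i : w ^+ i != 0. Proof. exact: expf_neq0. Qed.
Let wiN i : (w ^+ i) ^+ N = 1. Proof. by rewrite exprAC wN expr1n. Qed.

Lemma det_torsion1 : det_torsion 1.
Proof. by rewrite /det_torsion det1 expr1n. Qed.

Lemma det_torsionM s t : det_torsion s -> det_torsion t -> det_torsion (s * t).
Proof. by rewrite /det_torsion detM exprMn => -> ->; rewrite mulr1. Qed.

Lemma det_torsionV s : det_torsion s -> det_torsion s^-1.
Proof. by rewrite /det_torsion detV exprVn => ->; rewrite invr1. Qed.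

Lemma det_torsionX s k : det_torsion s -> det_torsion (s ^+ k).
Proof.
move=> ds; elim: k => [|k IHk]; first exact: det_torsion1.
by rewrite exprS; apply: det_torsionM.
Qed.

Lemma det_torsion_unit s : det_torsion s -> s \is a GRing.unit.
Proof.
move=> ds; rewrite -[_ \is a _]/(_ \in unitmx) unitmxE unitfE.
by apply/eqP => d0; move: ds; rewrite /det_torsion d0 expr0n gtn_eqF // => /esym/eqP; rewrite oner_eq0.
Qed.

Lemma det_torsionJ m s : m \is a GRing.unit -> det_torsion s -> det_torsion (m * s * m^-1).
Proof.
move=> mU; rewrite /det_torsion !detM detV mulrAC mulfV ?mul1r //.
by rewrite -unitfE -unitmxE.
Qed.

Lemma det_torsion1s s : \det s = 1 -> det_torsion s.
Proof. by rewrite /det_torsion => ->; rewrite expr1n. Qed.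

Lemma det_torsion_scalar i : det_torsion (w ^+ i)%:M.
Proof. by rewrite /det_torsion det_scalar exprAC wiN expr1n. Qed.

Lemma det_torsion_dg i : det_torsion (dg (w ^+ i)).
Proof. by rewrite /det_torsion det_diag_last. Qed.

Lemma det_torsion_sd (a : L) : a != 0 -> det_torsion (sd a).
Proof. by move=> a0; apply: det_torsion1s; apply: det_scaled_diag. Qed.

Hint Resolve det_torsion1 det_torsion_scalar det_torsion_dg : core.

Lemma rho1 : rho 1 = 1%g.
Proof.
by apply: (mulgI (rho 1)); rewrite -rhoM ?mulr1 ?mulg1.
Qed.

Lemma rhoV s : det_torsion s -> rho s^-1 = (rho s)^-1%g.
Proof.
move=> ds; apply: (mulgI (rho s)); rewrite -rhoM ?mulgV ?mulrV ?rho1 //.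
  exact: det_torsion_unit.
exact: det_torsionV.
Qed.

Lemma rhoX s k : det_torsion s -> rho (s ^+ k) = (rho s ^+ k)%g.
Proof.
move=> ds; elim: k => [|k IHk]; first by rewrite rho1.
by rewrite exprS expgS -IHk rhoM //; apply: det_torsionX.
Qed.

Lemma rho_eq s t : det_torsion s -> det_torsion t -> rho s = rho t -> s = t.
Proof.
move=> ds dt e; have /rho_inj : det_torsion (s * t^-1).
  by apply: det_torsionM => //; apply: det_torsionV.
rewrite rhoM ?rhoV ?e ?mulgV //; last exact: det_torsionV.
by move=> /(_ erefl) /(congr1 ( *%R^~ t)); rewrite mul1r mulrVK // det_torsion_unit.
Qed.

Lemma covers_rho s : det_torsion s -> covers s (rho s).
Proof.
move=> ds t dt; rewrite -rhoV // -!rhoM //; try exact: det_torsionV.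
by apply: det_torsionM.
Qed.

Lemma coversM m m' g g' : m \is a GRing.unit -> m' \is a GRing.unit ->
  covers m g -> covers m' g' -> covers (m * m') (g * g')%g.
Proof.
move=> mU m'U cm cm' s ds.
rewrite invrM // !mulrA -(mulrA m m') -(mulrA m (m' * s)) cm; last exact: det_torsionJ.
by rewrite cm' // invgM !mulgA.
Qed.

Lemma coversV m g : m \is a GRing.unit -> covers m g -> covers m^-1 g^-1%g.
Proof.
move=> mU cm s ds; have := cm (m^-1 * s * m^-1^-1).
rewrite invrK !mulrA mulrV // mul1r mulrK // => ->.
  by rewrite invgK !mulgA mulVg mul1g mulgVK.
by rewrite -[m in _ * m]invrK; apply: det_torsionJ; rewrite ?unitrV.
Qed.

Lemma coversX m g k : m \is a GRing.unit -> covers m g -> covers (m ^+ k) (g ^+ k)%g.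
Proof.
move=> mU cm; elim: k => [|k IHk]; first by rewrite expr0 expg0 -rho1; apply: covers_rho.
by rewrite exprS expgS; apply: coversM; rewrite ?unitrX.
Qed.

Lemma centerP z : reflect (forall x, z * x = x * z)%g (z \in center H).
Proof. exact: asboolP. Qed.

Lemma centerC z x : z \in center H -> commute z x.
Proof. by move=> /centerP zC; apply: zC. Qed.

Lemma covers1 z : z \in center H -> covers 1 z.
Proof.
by move=> /centerP zC s ds; rewrite invr1 mulr1 mul1r zC mulgK.
Qed.

Lemma coversZ a m g : a != 0 -> m \is a GRing.unit -> covers m g -> covers (a *: m) g.
Proof.
move=> a0 mU cm s ds; rewrite invrZ ?unitfE // -scalerAl -scalerAl -scalerAr.
by rewrite scalerA mulfV // scale1r; apply: cm.
Qed.

Lemma covers_scalar m : m \is a GRing.unit -> covers m 1%g -> exists2 a, a != 0 & m = a%:M.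
Proof.
move=> mU cm; have [i j ij|a mE] := @comm_elem_scalar L n m.
  have ds : det_torsion (elem i j 1) by apply/det_torsion1s/det_elem.
  have := cm _ ds; rewrite mul1g invg1 mulg1 => /rho_eq => /(_ (det_torsionJ mU ds) ds).
  by move=> /(congr1 ( *%R^~ m)); rewrite mulrVK.
exists a => //; apply: contraTneq mU => a0; rewrite mE a0.
by rewrite -[_ \is a _]/(_ \in unitmx) unitmxE det_scalar expr0n unitr0.
Qed.

Lemma covers_unique m g g' : m \is a GRing.unit -> covers m g -> covers m g' ->
  (g^-1 * g')%g \in center H.
Proof.
move=> mU cm cm'; apply: covers1_center; rewrite -(mulVr mU).
by apply: coversM; rewrite ?unitrV //; apply: coversV.
Qed.

Lemma covers_proportional m m' g : m \is a GRing.unit -> m' \is a GRing.unit ->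
  covers m g -> covers m' g -> exists2 a, a != 0 & m' = a *: m.
Proof.
move=> mU m'U cm cm'; have [||a a0 e] := @covers_scalar (m^-1 * m').
- by rewrite unitrMl ?unitrV.
- by rewrite -(mulVg g); apply: coversM; rewrite ?unitrV //; apply: coversV.
exists a => //; rewrite -(mulVKr mU m') e -[RHS]mul_scalar_mx.
by rewrite -scalar_mxC.
Qed.

Lemma rho_scalar_center i : rho (w ^+ i)%:M \in center H.
Proof.
apply: covers1_center => s ds; rewrite -covers_rho // invr1 mulr1 mul1r.
have e : (w ^+ i)%:M * s = s * (w ^+ i)%:M by apply/esym/scalar_mxC.
by rewrite e mulrK // det_torsion_unit.
Qed.

Lemma dg_unit (a : L) : a != 0 -> dg a \is a GRing.unit.
Proof. exact: diag_last_unit. Qed.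

Definition over (a : L) (g : H) := a != 0 /\ covers (dg a) g.

Lemma overM a b g g' : over a g -> over b g' -> over (a * b) (g * g')%g.
Proof.
move=> [a0 ca] [b0 cb]; split; first exact: mulf_neq0.
by rewrite diag_lastM; apply: coversM; rewrite ?dg_unit.
Qed.

Lemma overV a g : over a g -> over a^-1 g^-1%g.
Proof.
move=> [a0 ca]; split; first by rewrite invr_eq0.
by rewrite diag_lastV //; apply: coversV; rewrite ?dg_unit.
Qed.

Lemma overX a g k : over a g -> over (a ^+ k) (g ^+ k)%g.
Proof.
move=> [a0 ca]; split; first exact: expf_neq0.
by rewrite diag_lastX; apply: coversX; rewrite ?dg_unit.
Qed.

Lemma over1 z : z \in center H -> over 1 z.
Proof. by move=> zC; split; rewrite ?oner_eq0 // diag_last1; apply: covers1. Qed.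

Lemma over_unique a b g : over a g -> over b g -> a = b.
Proof.
move=> oa ob; have [c0 cc] := overM oa (overV ob); rewrite mulgV in cc.
have [x _ e] := covers_scalar (dg_unit c0) cc.
have [/(congr1 ( *%R^~ b)) + _] := diag_last_scalar (ltn0Sn _) e.
by rewrite mul1r mulfVK //; case: ob.
Qed.

Lemma over_center a z : over a z -> z \in center H -> a = 1.
Proof. by move=> oa zC; apply: over_unique oa (over1 zC). Qed.

Lemma over1_center z : over 1 z -> z \in center H.
Proof. by case=> _; rewrite diag_last1; apply: covers1_center. Qed.

(** diag(1, .., 1, a^n) is a times [sd a], scalars act trivially by conjugation, and [sd a] has
    determinant 1. So n-th powers have the multiplicative lift [rho (sd a)]. *)
Lemma over_sd (a : L) : a != 0 -> over (a ^+ n) (rho (sd a)).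
Proof.
move=> a0; split; first exact: expf_neq0.
have -> : dg (a ^+ n) = a *: sd a by rewrite scalerA mulfV // scale1r.
apply: coversZ => //; first exact/det_torsion_unit/det_torsion_sd.
exact/covers_rho/det_torsion_sd.
Qed.

Lemma over_dg i : over (w ^+ i) (rho (dg (w ^+ i))).
Proof. by split=> //; apply: covers_rho. Qed.

Lemma over_comm a b g g' : over a g -> over b g' -> (g * g' = g' * g)%g.
Proof. by move=> [a0 ca] [b0 cb]; apply: (covers_diag_comm a0 b0). Qed.

Lemma over_total (a : L) : a != 0 -> exists g, over a g.
Proof. by move=> a0; have [g cg] := covers_total (dg_unit a0); exists g. Qed.

Lemma w_root (x : L) : x ^+ N = 1 -> exists i, x = w ^+ i.
Proof. by move=> /(prim_rootP w_prim)[i ->]; exists i. Qed.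

Let zeta := rho w%:M.

Let zetaX i : (zeta ^+ i)%g = rho (w ^+ i)%:M.
Proof.
have dw : det_torsion w%:M by have := det_torsion_scalar 1; rewrite expr1.
rewrite -rhoX //; congr rho; elim: i => [|i IHi]; first by rewrite !expr0.
by rewrite !exprS IHi -[LHS]/(_ *m _) -scalar_mxM.
Qed.

Let zetaN : (zeta ^+ N = 1)%g.
Proof. by rewrite zetaX wN rho1. Qed.

Let zeta_center : zeta \in center H.
Proof. by have := rho_scalar_center 1; rewrite expr1. Qed.

Let zetaX_center i : (zeta ^+ i)%g \in center H.
Proof. by rewrite zetaX rho_scalar_center. Qed.

Let scalar_inj (a b : L) : a%:M = b%:M :> 'M_n -> a = b.
Proof. by move/(congr1 (fun m : 'M_n => m ord0 ord0)); rewrite !mxE eqxx !mulr1n. Qed.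

Let scalarX (a : L) k : (a%:M : 'M[L]_n) ^+ k = (a ^+ k)%:M.
Proof. by elim: k => [|k IHk]; rewrite ?expr0 // !exprS IHk -[LHS]/(_ *m _) -scalar_mxM. Qed.

Let zeta_order i : (zeta ^+ i = 1)%g -> (N %| i)%N.
Proof.
rewrite zetaX => /rho_inj => /(_ (det_torsion_scalar i)) /scalar_inj e.
by rewrite (prim_order_dvd w_prim) e.
Qed.

Lemma center_closed : group_closed (center H).
Proof.
split=> [|x y /centerP xC /centerP yC]; first by apply/centerP => x; rewrite mul1g mulg1.
by apply/centerP => t; rewrite -mulgA -[t in LHS]invgK -invgM -[in LHS](yC t^-1%g) invgM invgK !mulgA xC.
Qed.

Lemma center_comm : {in center H &, forall x y, x * y = y * x}%g.
Proof. by move=> x y /centerP xC _; apply: xC. Qed.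

Definition center_sub := AbelianSub center_closed center_comm.

(** By [center_torsion] the torsion of the centre consists of the powers of [zeta], so the trivial
    subgroup can be taken as [B0]. *)
Lemma center_complement : exists B : abelian_sub H, [/\ {subset B <= center H},
  forall i, rho (w ^+ i)%:M \in B -> (N %| i)%N &
  forall z, z \in center H -> exists2 b, b \in B & exists i, z = (b * rho (w ^+ i)%:M)%g].
Proof.
have [||||||B [_ BC zB CB]] :=
  @asub_complement H center_sub (fun x => x = 1%g) zeta N _ _ _ N0.
- by split=> // x y -> ->; rewrite mulgV.
- by move=> x ->; exact: center_closed.1.
- exact: zeta_center.
- exact: zetaN.
- exact: zeta_order.
- move=> x k xC k0 /(center_torsion xC k0)[i ->]; exists 1%g => //.
  by exists i; rewrite mul1g zetaX.
exists B; split=> // [i|z zC]; first by rewrite -zetaX; apply: zB.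
by have [b bB [i ->]] := CB z zC; exists b => //; exists i; rewrite zetaX.
Qed.


Lemma rho_sdM a b : a != 0 -> b != 0 -> rho (sd (a * b)) = (rho (sd a) * rho (sd b))%g.
Proof. by move=> a0 b0; rewrite scaled_diagM rhoM //; apply: det_torsion_sd. Qed.

Lemma rho_sdV a : a != 0 -> rho (sd a^-1) = (rho (sd a))^-1%g.
Proof.
move=> a0; apply: (mulgI (rho (sd a))).
by rewrite mulgV -rho_sdM ?invr_eq0 // mulfV // scaled_diag1 rho1.
Qed.

(** * Splitting off torsion over the diagonal matrices *)

Section Lift.
Variable B : abelian_sub H.
Hypothesis BC : {subset B <= center H}.
Hypothesis zB : forall i, rho (w ^+ i)%:M \in B -> (N %| i)%N.
Hypothesis CB : forall z, z \in center H ->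
  exists2 b, b \in B & exists i, z = (b * rho (w ^+ i)%:M)%g.

Let BcommL b x : b \in B -> (b * x = x * b)%g.
Proof. by move=> /BC/centerP ->. Qed.

(** g^n and [rho (sd a)] lie over the same a^n, so they differ by a central element. The condition
    asks that this element have no torsion component; multiplying g by a suitable
    [rho (dg (w ^+ i))] achieves it. *)
Definition root_sub_pred := [pred g | `[< exists2 a, over a g &
  exists2 b, b \in B & (g ^+ n = rho (sd a) * b)%g >]].

Lemma root_sub_closed : group_closed root_sub_pred.
Proof.
split.
  apply/asboolP; exists 1; first exact/over1/center_closed.1.
  by exists 1%g; [exact: gpred1|rewrite expg1n scaled_diag1 rho1 mulg1].
move=> x y /asboolP[a oa [b bB xn]] /asboolP[c oc [d dB yn]]; apply/asboolP.
exists (a / c); first exact: overM oa (overV oc).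
exists (b * d^-1)%g; first by rewrite gpredM ?gpredV.
rewrite expgnFl; last exact: over_comm oa oc.
have [[a0 _] [c0 _]] := (oa, oc).
rewrite xn yn rho_sdM ?invr_eq0 // rho_sdV // invgM -!mulgA; congr (_ * _)%g.
by rewrite mulgA [LHS]BcommL // gpredM ?gpredV.
Qed.

Lemma root_sub_comm : {in root_sub_pred &, forall x y, x * y = y * x}%g.
Proof. by move=> x y /asboolP[a oa _] /asboolP[b ob _]; apply: over_comm oa ob. Qed.

Definition root_sub := AbelianSub root_sub_closed root_sub_comm.

(** With a = w^-n, the n-th power of the scalar w is the factor a^-1 in [sd a], so [tors_gen ^+ n]
    is exactly [rho (sd a)] and [tors_gen] belongs to [root_sub]. *)
Let tors_gen := rho (dg (w ^- n) * w%:M).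

Let dw : det_torsion w%:M.
Proof. by have := det_torsion_scalar 1; rewrite expr1. Qed.

Let wn := w ^- n.

Let wnN : wn ^+ N = 1.
Proof. by rewrite exprVn exprAC wN expr1n invr1. Qed.

Let wn0 : wn != 0. Proof. by rewrite invr_eq0 expf_neq0. Qed.

Let ddw k : det_torsion (dg (wn ^+ k)).
Proof. by rewrite /det_torsion det_diag_last exprAC wnN expr1n. Qed.

Let ddw1 : det_torsion (dg wn). Proof. exact: (ddw 1). Qed.

Let tors_genE : tors_gen = (rho (dg wn) * zeta)%g.
Proof. by rewrite /tors_gen rhoM. Qed.

Let tors_genX k : (tors_gen ^+ k)%g = (rho (dg (wn ^+ k)) * zeta ^+ k)%g.
Proof.
rewrite tors_genE expgMn; last by exact: commute_sym (centerC _ zeta_center).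
by rewrite diag_lastX rhoX.
Qed.

Let over_gen k : over (wn ^+ k) (tors_gen ^+ k)%g.
Proof.
rewrite tors_genX -[X in over X _]mulr1; apply: overM; last exact/over1/zetaX_center.
by split; [rewrite expf_neq0|apply: covers_rho].
Qed.

Let rho_sd_split a : a ^+ N = 1 -> rho (sd a) = (rho (dg (a ^+ n)) * rho (a^-1)%:M)%g.
Proof.
move=> aN; rewrite -rhoM; first by congr rho; rewrite -[RHS]/(_ *m _) mul_mx_scalar.
  by rewrite /det_torsion det_diag_last exprAC aN expr1n.
by rewrite /det_torsion det_scalar exprAC exprVn aN invr1 expr1n.
Qed.

Let asub_is_subgroup : is_subgroup (fun x => x \in B).
Proof. by split=> [|x y xB yB]; rewrite ?gpred1 // gpredM ?gpredV. Qed.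

(** Write x as [rho (dg a)] times b' zeta^j, where a = w^i. Comparing n-th powers puts zeta^(j n +
    i) into [B], so [N] divides j n + i; thus a = w^(-n j) and x = b' tors_gen^j. *)
Let root_sub_torsion x k : x \in root_sub -> (0 < k)%N -> (x ^+ k)%g \in B ->
  exists2 b, b \in B & exists i, x = (b * tors_gen ^+ i)%g.
Proof.
move=> /asboolP[a oa [b bB xn]] k0 xkB.
have aN : a ^+ N = 1.
  by apply: (torsL k0); apply: over_center (overX k oa) (BC xkB).
have [i aE] := w_root aN.
have da : det_torsion (dg a) by rewrite /det_torsion det_diag_last.
have [a0 ca] := oa.
have zC := covers_unique (dg_unit a0) (covers_rho da) ca.
set z := (_ * _)%g in zC; have xE : x = (rho (dg a) * z)%g by rewrite mulVKg.
have [b' b'B [j zE]] := CB zC; rewrite -zetaX in zE.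
have zn : (z ^+ n = rho (a^-1)%:M * b)%g.
  apply: (mulgI (rho (dg (a ^+ n)))); rewrite [RHS]mulgA -rho_sd_split // -xn xE.
  rewrite [RHS]expgMn; last by exact: commute_sym (centerC _ zC).
  by rewrite diag_lastX rhoX.
have : (zeta ^+ (j * n + i))%g \in B.
  have -> : (zeta ^+ (j * n + i) = b'^-1 ^+ n * b)%g.
    have : (rho a%:M * z ^+ n = b)%g.
      rewrite zn mulgA -rhoM.
      - by rewrite -[_ * _]/(_ *m _) -scalar_mxM mulfV // rho1 mul1g.
      - by rewrite /det_torsion det_scalar exprAC aN expr1n.
      - by rewrite /det_torsion det_scalar exprAC exprVn aN invr1 expr1n.
    rewrite zE expgMn; last exact: BcommL.
    move=> <-; rewrite expgnDr expgnA aE -zetaX expVgn.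
    rewrite [(zeta ^+ i * _)%g](centerP _ (zetaX_center i)).
    by move: (b' ^+ n)%g (_ ^+ n)%g (zeta ^+ i)%g => u v t; rewrite -!mulgA mulKg.
  by rewrite gpredM ?gpredXn ?gpredV.
rewrite zetaX => /zB; rewrite (prim_order_dvd w_prim) => /eqP ji.
exists b' => //; exists j; rewrite tors_genX mulgA [(b' * _)%g]BcommL // -mulgA -zE.
have -> : wn ^+ j = a.
  apply: (mulIf (wi0 (j * n))); rewrite exprVn -exprM [(n * j)%N]mulnC mulVf ?wi0 //.
  by rewrite aE -exprD addnC ji.
by [].
Qed.

(** [Q] is a complement of the powers of [tors_gen] in [root_sub] that contains [B]: the abelian
    extension of A by [B] from which the cocycle is read off. It contains [rho (sd a)] because this
    is g^n up to [B]. *)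
Lemma diagonal_lift : exists Q : abelian_sub H, [/\ {subset B <= Q},
  forall g, g \in Q -> exists a, over a g,
  forall g a, g \in Q -> over a g -> a ^+ N = 1 -> g \in B,
  forall a, a != 0 -> exists2 g, g \in Q & exists b i, over b g /\ a = b * w ^+ i &
  forall g a, g \in Q -> over a g -> rho (sd a) \in Q].
Proof.
have [||||||Q [BQ QM zQ MQ]] := @asub_complement H root_sub (fun x => x \in B) tors_gen N _ _ _ N0.
- exact: asub_is_subgroup.
- move=> b bB; apply/asboolP; exists 1; first exact/over1/BC.
  by exists (b ^+ n)%g; rewrite ?gpredXn // scaled_diag1 rho1 mul1g.
- apply/asboolP; exists wn; first exact: (over_gen 1).
  exists 1%g; first exact: gpred1.
  by rewrite mulg1 rho_sd_split // tors_genX zetaX /wn invrK.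
- by rewrite tors_genX wnN diag_last1 rho1 mul1g.
- move=> i iB; have e := over_center (over_gen i) (BC iB).
  by move: iB; rewrite tors_genX e diag_last1 rho1 mul1g zetaX; apply: zB.
- exact: root_sub_torsion.
exists Q; split=> //.
- by move=> g /QM/asboolP[a oa _]; exists a.
- move=> g a gQ oa aN.
  have gN : (g ^+ N)%g \in center H by apply: over1_center; rewrite -aN; apply: overX.
  have [b bB [j gE]] := CB gN; rewrite -zetaX in gE.
  have gNN : (g ^+ (N * N))%g \in B.
    rewrite expgnA gE expgMn; last exact: BcommL.
    by rewrite expgnAC zetaN expg1n mulg1 gpredXn.
  have [|b' b'B [i gE']] := root_sub_torsion (QM _ gQ) _ gNN; first by rewrite muln_gt0 N0.
  have /zQ/dvdnP[q iE] : (tors_gen ^+ i)%g \in Q.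
    have -> : (tors_gen ^+ i = b'^-1 * g)%g by rewrite gE' mulKg.
    by rewrite gpredM ?gpredV // BQ.
  rewrite gE' tors_genX iE mulnC exprM wnN expr1n diag_last1 rho1 mul1g.
  by rewrite expgnA zetaN expg1n mulg1.
- move=> a a0; have [g og] := over_total a0.
  have zC : ((rho (sd a))^-1 * g ^+ n)%g \in center H.
    by apply: over1_center; rewrite -(mulVf (expf_neq0 n a0)); apply: overM (overV (over_sd a0)) (overX n og).
  have [b bB [i zE]] := CB zC.
  (* g^n has the unwanted torsion factor zeta^i; dividing g by [rho (dg (w ^+ i))] cancels it, at
     the cost of replacing a by a / w^i. *)
  have : (g * (rho (dg (w ^+ i)))^-1)%g \in root_sub.
    have oi := over_dg i; have oV := overV oi.
    apply/asboolP; exists (a / w ^+ i); first exact: overM.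
    exists b => //; rewrite expgMn; last exact: over_comm og oV.
    have -> : (g ^+ n = rho (sd a) * b * rho (w ^+ i)%:M)%g by rewrite -mulgA -zE mulVKg.
    rewrite rho_sdM ?invr_eq0 // [rho (sd (w ^+ i)^-1)]rho_sd_split; last by rewrite exprVn wiN invr1.
    rewrite invrK -!mulgA; congr (_ * _)%g.
    rewrite [RHS]mulgA -[RHS]BcommL //; congr (_ * _)%g.
    rewrite (centerP _ (rho_scalar_center i)); congr (_ * _)%g.
    rewrite -rhoV // -rhoX; last exact: det_torsionV.
    by rewrite -diag_lastV // diag_lastX.
  move=> /MQ[q qQ [j gE]]; exists q => //; have [c oc] : exists c, over c q.
    by have /asboolP[c oc _] := QM _ qQ; exists c.
  have e : a / w ^+ i = c * wn ^+ j.
    apply: over_unique (overM oc (over_gen j)).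
    by rewrite -gE; apply: overM og (overV (over_dg i)).
  have [k kE] : exists k, wn ^+ j = w ^+ k by apply: w_root; rewrite exprAC wnN expr1n.
  exists c, (k + i)%N; split=> //; rewrite exprD -kE mulrA -e mulfVK ?wi0 //.
- move=> g a gQ oa; have /asboolP[a' oa' [b bB gn]] := QM _ gQ.
  rewrite -(over_unique oa' oa); have -> : (rho (sd a') = g ^+ n * b^-1)%g by rewrite gn mulgK.
  by rewrite gpredM ?gpredXn // gpredV BQ.
Qed.

End Lift.

(** * The cocycle and the isomorphism *)

Section Deform.
Variables B Q : abelian_sub H.
Hypothesis BC : {subset B <= center H}.
Hypothesis zB : forall i, rho (w ^+ i)%:M \in B -> (N %| i)%N.
Hypothesis CB : forall z, z \in center H ->
  exists2 b, b \in B & exists i, z = (b * rho (w ^+ i)%:M)%g.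
Hypothesis BQ : {subset B <= Q}.
Hypothesis Q_tors : forall g a, g \in Q -> over a g -> a ^+ N = 1 -> g \in B.
Hypothesis Q_cover : forall a, a != 0 ->
  exists2 g, g \in Q & exists b i, over b g /\ a = b * w ^+ i.
Hypothesis Q_sd : forall g a, g \in Q -> over a g -> rho (sd a) \in Q.

Let uvalX (x : units L) k : uval (x ^+ k)%g = uval x ^+ k.
Proof. by elim: k => // k IHk; rewrite expgS exprS -IHk. Qed.

Let uval0 (x : units L) : uval x != 0.
Proof. by rewrite -unitfE uvalP. Qed.

Let unit_ex (a : L) : a != 0 -> exists x : units L, uval x = a.
Proof. by rewrite -unitfE => aU; exists (Units aU). Qed.

(** Elements of [Q] over torsion lie in [B], and [Q] reaches every unit up to a power of w; so the
    units under [Q] form a complement of the torsion, and this is the choice of A. *)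
Definition lift_pred := [pred a : units L | `[< exists2 g, g \in Q & over (uval a) g >]].

Lemma lift_pred_torsion a : a \in lift_pred -> uval a ^+ N = 1 -> a = 1%g.
Proof.
move=> /asboolP[g gQ og] aN; apply: val_inj.
exact: over_center og (BC (Q_tors gQ og aN)).
Qed.

Lemma lift_complement : is_complement predT (torsion (units L)) lift_pred.
Proof.
split=> //.
- split; first by apply/asboolP; exists 1%g; [exact: gpred1|exact/over1/center_closed.1].
  move=> x y /asboolP[g gQ og] /asboolP[g' gQ' og']; apply/asboolP.
  by exists (g * g'^-1)%g; [rewrite gpredM ?gpredV|exact: overM og (overV og')].
- move=> x xA /asboolP[m m0 xm]; apply: lift_pred_torsion => //.
  by apply: (torsL m0); rewrite -uvalX xm.
- move=> x _; have [g gQ [b [i [og xE]]]] := Q_cover (uval0 x).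
  have [b0 _] := og; have [y yE] := unit_ex b0; have [t tE] := unit_ex (wi0 i).
  exists y; first by apply/asboolP; exists g; rewrite ?yE.
  exists t; last by apply: val_inj; rewrite /= yE tE.
  by apply/asboolP; exists N => //; apply: val_inj; rewrite /= uvalX tE wiN.
Qed.

Definition lift_compl := TorsionComplement lift_complement.
Local Notation A := (subgroup (tcompl lift_compl)).
Definition scal (a : A) : L := uval (sgval a).

Let scal0 a : scal a != 0. Proof. exact: uval0. Qed.
Let scalM a b : scal (a * b)%g = scal a * scal b. Proof. by []. Qed.
Let scalX a k : scal (a ^+ k)%g = scal a ^+ k.
Proof. by elim: k => // k IHk; rewrite expgS exprS -IHk. Qed.
Let scal_inj : injective scal.
Proof. by move=> a b e; do 2!apply: val_inj. Qed.
Let scal_tors a : scal a ^+ N = 1 -> a = 1%g.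
Proof. by move=> e; apply: val_inj; apply: lift_pred_torsion => //; apply: sgvalP. Qed.
Let scal_over a : exists2 g, g \in Q & over (scal a) g.
Proof. by have /asboolP := sgvalP a. Qed.

Let A_torsionfree (a : A) k : (0 < k)%N -> (a ^+ k = 1)%g -> a = 1%g.
Proof.
by move=> k0 ak; apply/scal_tors/(torsL k0); rewrite -scalX ak.
Qed.

Let A_expI (a b : A) k : (0 < k)%N -> (a ^+ k = b ^+ k)%g -> a = b.
Proof.
move=> k0 e; apply/eqP; rewrite -divg_eq1; apply/eqP.
apply: (A_torsionfree k0); rewrite expgnFl ?e ?mulgV //; exact: mulgC.
Qed.

Definition scalar_pred := [pred m : GL n L | `[< exists a : A, mxval m = (scal a)%:M >]].

Let scalar_center (x : GL n L) a : mxval x = a%:M -> x \in center (GL n L).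
Proof.
by move=> xE; apply/asboolP => y; apply: val_inj; rewrite /= xE; apply/esym/scalar_mxC.
Qed.

Lemma scalar_complement : is_complement (center (GL n L))
  (predI (torsion (GL n L)) (center (GL n L))) scalar_pred.
Proof.
split.
- split; first by apply/asboolP; exists 1%g.
  move=> x y /asboolP[a xE] /asboolP[b yE]; apply/asboolP; exists (a * b^-1)%g.
  rewrite /= xE yE scalM scalar_mxM; congr (_ *m _).
  by rewrite /= invmx_scalar.
- by move=> x /asboolP[a xE]; apply: scalar_center xE.
- move=> x /asboolP[a xE] /andP[/asboolP[m m0 xm] _].
  suff a1 : a = 1%g by apply: val_inj; rewrite /= xE a1.
  apply: (A_torsionfree m0); apply: scal_inj; rewrite scalX; apply: scalar_inj.
  by rewrite -scalarX -xE -mxvalX xm.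
- move=> z /asboolP zC; have [a zE] : exists a, mxval z = a%:M.
    apply: comm_elem_scalar => i j ij.
    have /(congr1 (@mxval _ _)) := zC (MkGL (elem_unit 1 ij)); exact.
  have a0 : a != 0.
    apply: contraTneq (mxvalP z) => a0; rewrite zE a0.
    by rewrite unitmxE det_scalar expr0n unitr0.
  have [x xE] := unit_ex a0; have [b bA [t tT xbt]] : exists2 b, b \in lift_pred &
    exists2 t, t \in torsion (units L) & x = (b * t)%g.
    by have [_ _ _] := lift_complement; apply.
  have scU (u : units L) : ((uval u)%:M : 'M[L]_n) \in unitmx.
    by rewrite unitmxE det_scalar unitfE expf_neq0.
  exists (MkGL (scU b)); first by apply/asboolP; exists (@Subgroup _ (tcompl lift_compl) b bA).
  exists (MkGL (scU t)); last first.
    by apply: val_inj; rewrite /= zE -xE xbt -scalar_mxM.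
  apply/andP; split; last exact: scalar_center.
  have /asboolP[m m0 tm] := tT; apply/asboolP; exists m => //.
  by apply: val_inj; rewrite /= mxvalX scalarX -uvalX tm.
Qed.

Definition scalar_addition := Addition scalar_complement.

Local Notation C := (AmodAn n lift_compl).

(** The class 1 gets the representative 1 so that the cocycle is normalised. *)
Definition rep (c : C) : A := if c == 1%g then 1%g else repr c.

Lemma repK c : quotient_pi _ (rep c) = c.
Proof.
rewrite /rep; case: eqP => [->|_]; last exact: quotient_reprK.
by [].
Qed.

Lemma rep1 : rep 1%g = 1%g. Proof. by rewrite /rep eqxx. Qed.

Lemma rep_class (a : A) c : quotient_pi _ a = c -> exists b, a = (rep c * b ^+ n)%g.
Proof.
rewrite -{1}(repK c) => /esym/quotient_piP/asboolP[b e]; exists b.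
by rewrite -e mulVKg.
Qed.


Lemma gam_subproof : exists gam : C -> asub_group Q,
  (forall c, over (scal (rep c)) (aval (gam c))) /\ gam 1%g = 1%g.
Proof.
have /choice[gam gamP] : forall c, exists g : asub_group Q,
    over (scal (rep c)) (aval g) /\ (c = 1%g -> g = 1%g).
  move=> c; have [->|c1] := eqVneq c 1%g.
    by exists 1%g; split=> //; rewrite rep1; exact/over1/center_closed.1.
  have [g gQ og] := scal_over (rep c); have [g' g'E] := aval_ex gQ.
  by exists g'; rewrite g'E; split=> // c1'; rewrite c1' eqxx in c1.
by exists gam; split=> [c|]; [case: (gamP c)|apply: (gamP 1%g).2].
Qed.

Lemma sdq_subproof : exists sdq : A -> asub_group Q,
  forall a, aval (sdq a) = rho (sd (scal a)).
Proof.
have h a : exists s : asub_group Q, aval s = rho (sd (scal a)).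
  by have [g gQ og] := scal_over a; apply: aval_ex; apply: Q_sd gQ og.
by have /choice[s sP] := h; exists s.
Qed.

Lemma root_subproof : exists rt : C -> C -> A,
  forall c c', (rep c * rep c' = rep (c * c') * rt c c' ^+ n)%g.
Proof.
have h c c' : exists a, (rep c * rep c' = rep (c * c') * a ^+ n)%g.
  by apply: rep_class; rewrite quotient_piM !repK.
have /choice[rt rtP] : forall cc : C * C, exists a,
    (rep cc.1 * rep cc.2 = rep (cc.1 * cc.2) * a ^+ n)%g by move=> [c c'].
by exists (fun c c' => rt (c, c')) => c c'; apply: (rtP (c, c')).
Qed.

Definition gam := projT1 (cid gam_subproof).
Definition sdq := projT1 (cid sdq_subproof).
Definition rt := projT1 (cid root_subproof).

Let over_gam c : over (scal (rep c)) (aval (gam c)).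
Proof. exact: (projT2 (cid gam_subproof)).1. Qed.
Let gam1 : gam 1%g = 1%g.
Proof. exact: (projT2 (cid gam_subproof)).2. Qed.
Let sdqE a : aval (sdq a) = rho (sd (scal a)).
Proof. exact: (projT2 (cid sdq_subproof)). Qed.
Let rtE c c' : (rep c * rep c' = rep (c * c') * rt c c' ^+ n)%g.
Proof. exact: (projT2 (cid root_subproof)). Qed.

Let sdqM a b : sdq (a * b)%g = (sdq a * sdq b)%g.
Proof. by apply: aval_inj; rewrite avalM !sdqE scalM rho_sdM. Qed.

Let sdq1 : sdq 1%g = 1%g.
Proof. by apply: aval_inj; rewrite sdqE scaled_diag1 rho1. Qed.

(** n-th roots in the torsion-free group A are unique, so the identity can be checked on n-th
    powers. *)
Let rtM x y z : (rt x y * rt (x * y) z = rt y z * rt x (y * z))%g.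
Proof.
apply: (@A_expI _ _ n) => //; rewrite !expgMnC.
apply: (mulgI (rep (x * y * z)%g)).
have e (u v : A) c : (rep c * (u * v) = rep c * v * u)%g by rewrite [(u * v)%g]mulgC mulgA.
rewrite [LHS]e [RHS]e -rtE -[(x * y * z)%g]mulgA -rtE.
by rewrite -mulgA [(rep z * _)%g]mulgC mulgA -rtE -[RHS]mulgA -rtE mulgA.
Qed.

Let rtC x y : rt x y = rt y x.
Proof.
apply: (@A_expI _ _ n) => //; apply: (mulgI (rep (x * y)%g)).
by rewrite -rtE mulgC rtE [(x * y)%g]mulgC.
Qed.

Let rt1 x : rt 1%g x = 1%g.
Proof.
apply: (@A_torsionfree _ n) => //; apply: (mulgI (rep (1 * x)%g)).
by rewrite -rtE rep1 !mul1g mulg1.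
Qed.

(** [rep c * rep c'] and [rep (c * c')] differ by the n-th power of [rt c c'], which lifts through
    [sdq]; what remains lies over 1, hence in [B]. This is the factor set of [Q] modulo the image of
    [sdq], an extension of A / A^n by [B]. *)
Definition defect c c' : asub_group Q :=
  (gam c * gam c' * (gam (c * c') * sdq (rt c c'))^-1)%g.

Let defectB c c' : aval (defect c c') \in B.
Proof.
apply: (@Q_tors _ 1); rewrite ?expr1n ?avalP //.
have -> : 1 = scal (rep c) * scal (rep c') / (scal (rep (c * c')%g) * scal (rt c c') ^+ n).
  by rewrite -scalX -!scalM rtE scalM mulfV // -scalM.
rewrite !(avalM, avalV); apply: overM; first by apply: overM.
by apply/overV/overM => //; rewrite sdqE; apply: over_sd.
Qed.

Lemma cocycle_subproof : exists h : C -> C -> asub_group B,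
  forall c c', aval (h c c') = aval (defect c c').
Proof.
have /choice[h hP] : forall cc : C * C, exists b : asub_group B,
    aval b = aval (defect cc.1 cc.2) by move=> cc; apply: aval_ex.
by exists (fun c c' => h (c, c')) => c c'; apply: (hP (c, c')).
Qed.

Definition defect_cocycle := projT1 (cid cocycle_subproof).
Let hE c c' : aval (defect_cocycle c c') = aval (defect c c').
Proof. exact: (projT2 (cid cocycle_subproof)). Qed.

Let regroup (G : abelianGroupType) (x y z p q s t : G) :
  (p * z * (q * s)^-1 * (x * y * (p * t)^-1) = x * y * z * (q * (t * s))^-1)%g.
Proof.
rewrite !invgM (AC ((2*2)*(2*2)) ((1*8)*((5*6)*2)*((3*7)*4)))%AC.
by rewrite /= mulgV mul1g.
Qed.

Lemma defect_cocycleM x y z : (defect_cocycle (x * y) z * defect_cocycle x y =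
  defect_cocycle x (y * z) * defect_cocycle y z)%g.
Proof.
apply: aval_inj; rewrite !avalM !hE -!avalM; congr aval.
rewrite /defect regroup [(gam x * gam (y * z)%g)%g]mulgC regroup -!sdqM rtM.
by rewrite -[(x * y * z)%g]mulgA [(gam y * _ * _)%g]mulgC !mulgA.
Qed.

Lemma defect_cocycle1 x : defect_cocycle 1%g x = 1%g.
Proof.
apply: aval_inj; rewrite hE /defect gam1 rt1 sdq1 mulg1 !mul1g mulgV.
by [].
Qed.

Lemma defect_cocycleC x y : defect_cocycle x y = defect_cocycle y x.
Proof.
by apply: aval_inj; rewrite !hE /defect rtC [(x * y)%g]mulgC [(gam x * _)%g]mulgC.
Qed.

Lemma defect_cocycleg1 x : defect_cocycle x 1%g = 1%g.
Proof. by rewrite defect_cocycleC defect_cocycle1. Qed.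

Definition deformation_cocycle : sym_cocycle C (asub_group B) :=
  SymCocycle defect_cocycleM defect_cocycle1 defect_cocycleg1 defect_cocycleC.

Local Notation K0 := scalar_addition.
Local Notation Kf := (quotient (addition_pred K0)).
Local Notation bar := (@det_bar n L lift_compl K0).

(* Modulo scalars from [A] every element of [Kf] has exactly one representative
   whose determinant is the chosen representative of its class, up to torsion. *)
Definition normal (x : Kf) (m : 'M[L]_n) := exists2 g : GL n L,
  quotient_pi (addition_pred K0) g = x & m = mxval g /\
  exists i, \det m = scal (rep (bar x)) * w ^+ i.

Lemma normal_unit x m : normal x m -> m \is a GRing.unit.
Proof. by case=> g _ [-> _]; apply: mxvalP. Qed.

Lemma normal_ex x : exists m, normal x m.
Proof.
have [a aE] := rep_class (erefl (bar x)).
have [t tT dE] := tcompl_projP lift_compl (Defs.GL_det (repr x)).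
have /w_root[i tE] : uval t ^+ N = 1.
  have /asboolP[m m0 tm] := tT; apply: (torsL m0).
  by rewrite -uvalX tm.
have aU : ((scal a)%:M : 'M[L]_n) \in unitmx.
  by rewrite unitmxE det_scalar unitfE expf_neq0.
have aK : MkGL aU \in K0 by apply/asboolP; exists a.
exists (mxval (repr x * (MkGL aU)^-1)%g); exists (repr x * (MkGL aU)^-1)%g.
  rewrite -[RHS]quotient_reprK; apply/esym/quotient_piP.
  by rewrite mulKg gpredV.
split=> //; exists i; rewrite /= det_mulmx invmx_scalar det_scalar.
have -> : \det (mxval (repr x)) = uval (Defs.GL_det (repr x)) by [].
rewrite dE aE -[uval _]/(scal (rep (bar x) * a ^+ n)%g * uval t) tE scalM scalX.
by rewrite exprVn mulrAC mulfK ?expf_neq0.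
Qed.

Lemma normal_unique x m m' : normal x m -> normal x m' -> m = m'.
Proof.
move=> [g <- [-> [i di]]] [g' e [-> [j dj]]].
have /asboolP[a aE] : (g^-1 * g')%g \in addition_pred K0 by apply/quotient_piP.
have g'E : mxval g' = mxval g *m (scal a)%:M.
  by rewrite -aE -[RHS]/(mxval (g * (g^-1 * g'))%g) mulVKg.
rewrite g'E; suff -> : a = 1%g by rewrite mulmx1.
apply: scal_tors; apply: (@torsL _ (n * N)%N); first by rewrite muln_gt0.
have e1 : w ^+ i * scal a ^+ n = w ^+ j.
  apply: (mulfI (scal0 (rep (bar (quotient_pi (addition_pred K0) g))))).
  by rewrite -dj g'E det_mulmx di det_scalar mulrA.
by have := congr1 (fun y => y ^+ N) e1; rewrite exprMn !wiN mul1r -exprM.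
Qed.

Definition nrep x := projT1 (cid (normal_ex x)).
Let nrepP x : normal x (nrep x). Proof. exact: projT2 (cid (normal_ex x)). Qed.

Local Notation dr c := (dg (scal (rep c))).

Let drU c : dr c \is a GRing.unit. Proof. exact: dg_unit. Qed.

(** The factor in K_1 left after removing the diagonal one: its determinant is torsion, so [rho]
    applies to it. *)
Let tail x := (dr (bar x))^-1 * nrep x.

Let nrepE x : nrep x = dr (bar x) * tail x.
Proof. by rewrite /tail mulVKr. Qed.

Let tail_torsion x : det_torsion (tail x).
Proof.
have [g _ [_ [i di]]] := nrepP x.
by rewrite /det_torsion detM detV det_diag_last di mulKf // wiN.
Qed.

Definition lift_sec (x : Kf) : H := (aval (gam (bar x)) * rho (tail x))%g.

Lemma covers_lift_sec x : covers (nrep x) (lift_sec x).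
Proof.
rewrite nrepE; apply: coversM => //; first exact/det_torsion_unit.
  by have [] := over_gam (bar x).
exact: covers_rho.
Qed.

Lemma nrepM x y : nrep (x * y)%g = (scal (rt (bar x) (bar y)))^-1 *: (nrep x * nrep y).
Proof.
set a := rt _ _; apply: (@normal_unique (x * y)%g); first exact: nrepP.
have [g gx [mx [i di]]] := nrepP x; have [g' g'y [my [j dj]]] := nrepP y.
have aU : ((scal a)%:M : 'M[L]_n) \in unitmx.
  by rewrite unitmxE det_scalar unitfE expf_neq0.
have aK : MkGL aU \in K0 by apply/asboolP; exists a.
exists ((MkGL aU)^-1 * (g * g'))%g.
  rewrite -gx -g'y -quotient_piM; apply/quotient_piP.
  rewrite invgM invgK -mulgA.
  have /addition_center/asboolP -> := aK.
  by rewrite mulKg.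
split; first by rewrite /= invmx_scalar mul_scalar_mx mx my.
exists (i + j)%N; rewrite detZ detM di dj gmulfM -/(bar x) exprD.
have : scal (rep (bar x)) * scal (rep (bar y)) = scal (rep (bar x * bar y)%g) * scal a ^+ n.
  by rewrite -scalM rtE scalM scalX.
rewrite (mulrACA (scal (rep (bar x)))) => ->; rewrite exprVn.
have u0 : scal a ^+ n != 0 by rewrite expf_neq0.
by move: (scal a ^+ n) u0 => u u0; rewrite -!mulrA mulrCA mulKf.
Qed.

(** [rho (tail x)] passes [gam (bar y)] through the conjugation action. The product of the two [gam]
    then leaves the defect and the lift of an n-th power, whose scalar is the one by which
    [nrep (x * y)] differs from [nrep x * nrep y]. *)
Lemma lift_secM x y :
  (lift_sec x * lift_sec y = aval (defect_cocycle (bar x) (bar y)) * lift_sec (x * y))%g.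
Proof.
have gyP := over_gam (bar y); have [_ cy] := gyP.
have move_gam : (rho (tail x) * aval (gam (bar y)) =
    aval (gam (bar y)) * rho ((dr (bar y))^-1 * tail x * dr (bar y)))%g.
  have := coversV (drU _) cy (tail_torsion x); rewrite invrK => ->.
  by rewrite invgK !mulgA mulgV mul1g.
have tJ : det_torsion ((dr (bar y))^-1 * tail x * dr (bar y)).
  by rewrite -[X in _ * X]invrK; apply: det_torsionJ; rewrite ?unitrV.
rewrite /lift_sec -mulgA [(rho _ * _)%g]mulgA move_gam -mulgA -rhoM // !mulgA.
rewrite hE gmulfM -/(bar x) /defect !(avalM, avalV) sdqE.
rewrite -!mulgA; congr (_ * (_ * _))%g.
rewrite -/(bar x) -/(bar y) invgM -!mulgA mulKg.
apply: (mulgI (rho (sd (scal (rt (bar x) (bar y)))))); rewrite mulVKg.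
rewrite -rhoM; [|exact: det_torsion_sd|exact: det_torsionM].
congr rho; rewrite [tail (x * y)%g]/tail nrepM gmulfM -/(bar x) -/(bar y).
set a := rt _ _; rewrite /scaled_diag -scalerAl -scalerAr; congr (_ *: _).
rewrite [nrep x]nrepE [nrep y]nrepE; move: (tail x) (tail y) => tx ty.
rewrite !mulrA; congr (_ * _ * _ * _).
have e : dr (bar x) * dr (bar y) = dr (bar x * bar y)%g * dg (scal a ^+ n).
  by rewrite -!diag_lastM -!scalM rtE scalM scalX.
apply: (mulrI (drU (bar x * bar y)%g)); rewrite mulrA -e mulrK // mulVKr //.
Qed.

Definition deformation_map (u : GL_deformation K0 deformation_cocycle) : H :=
  (aval u.1 * lift_sec u.2)%g.

Lemma deformation_mapM : {morph deformation_map : u v / (u * v)%g}.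
Proof.
move=> [b x] [c y]; rewrite /deformation_map.
rewrite -[LHS]/(aval b * aval c * aval (defect_cocycle (bar x) (bar y)) * lift_sec (x * y))%g.
rewrite -mulgA -lift_secM /=; move: (centerC (lift_sec x) (BC (avalP c))).
move: (aval b) (aval c) (lift_sec x) (lift_sec y) => u v s t cC.
by rewrite -!mulgA; congr (_ * _)%g; rewrite !mulgA cC.
Qed.

(** Equal images make [nrep y] a multiple of [nrep x] by some l. Determinants give equal classes in
    A / A^n and l = w^k; then [rho] of the scalar w^k lies in [B], which forces l = 1. *)
Lemma deformation_map_inj : injective deformation_map.
Proof.
move=> [b x] [c y]; rewrite /deformation_map /= => e.
have e1 : (lift_sec y = (aval c)^-1 * aval b * lift_sec x)%g by rewrite -mulgA e mulKg.
have zC : ((aval c)^-1 * aval b)%g \in center H.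
  by apply: BC; rewrite gpredM ?gpredV ?avalP.
have nU x' : nrep x' \is a GRing.unit := normal_unit (nrepP x').
have cx : covers (nrep x) (lift_sec y).
  by rewrite e1 -[nrep x]mul1r; apply: coversM (covers1 zC) (covers_lift_sec x); rewrite ?unitr1.
have [l l0 le] := covers_proportional (nU x) (nU y) cx (covers_lift_sec y).
have [exy /w_root[k lk]] : bar y = bar x /\ l ^+ N = 1.
  have [_ _ [_ [i di]]] := nrepP x; have [_ _ [_ [j dj]]] := nrepP y.
  have [l' l'E] := unit_ex l0.
  have [_ _ _ /(_ l' isT)[a aA [t tT lE]]] := lift_complement.
  pose a' : A := @Subgroup _ (tcompl lift_compl) a aA.
  have tN : uval t ^+ N = 1.
    by have /asboolP[m m0 tm] := tT; apply: (torsL m0); rewrite -uvalX tm.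
  have {}lE : l = scal a' * uval t by rewrite -l'E lE.
  have e2 : scal (rep (bar y) * (rep (bar x) * a' ^+ n)^-1)%g ^+ N = 1.
    have -> : scal (rep (bar y) * (rep (bar x) * a' ^+ n)^-1)%g =
        scal (rep (bar y)) / (scal (rep (bar x)) * scal a' ^+ n) by rewrite -scalX.
    have : scal (rep (bar y)) * w ^+ j = scal (rep (bar x)) * scal a' ^+ n * (uval t ^+ n * w ^+ i).
      rewrite -dj le detZ di lE exprMn.
      move: (scal a' ^+ n) (uval t ^+ n) (scal (rep (bar x))) => p q s.
      by rewrite mulrACA [p * s]mulrC.
    have tn : (uval t ^+ n) ^+ N = 1 by rewrite exprAC tN expr1n.
    have p0 : scal a' ^+ n != 0 by rewrite expf_neq0.
    move: (scal a' ^+ n) (uval t ^+ n) tn p0 => p q qN p0.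
    move=> /(congr1 (fun y => y ^+ N)); rewrite !(exprMn N) !wiN qN !mulr1 => e2.
    by rewrite exprVn (exprMn N) -e2 mulfV ?expf_neq0.
  have e3 : (rep (bar y) = rep (bar x) * a' ^+ n)%g.
    by apply/eqP; rewrite -divg_eq1; apply/eqP/scal_tors.
  have e4 : bar y = bar x.
    rewrite -[bar y]repK -[RHS]repK; apply/esym/quotient_piP/asboolP.
    by exists a'; rewrite e3 mulKg.
  split=> //.
  have a1 : a' = 1%g.
    apply: (@A_torsionfree _ n) => //; apply: (mulgI (rep (bar x))).
    by rewrite -e3 e4 mulg1.
  by rewrite lE a1 mul1r.
have ty : tail y = tail x * (w ^+ k)%:M.
  by rewrite /tail exy le lk -scalerAr -[RHS]/(_ *m _) mul_mx_scalar.
have ly : lift_sec y = (lift_sec x * rho (w ^+ k)%:M)%g.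
  by rewrite /lift_sec exy ty rhoM // mulgA.
have wB : rho (w ^+ k)%:M = ((aval c)^-1 * aval b)%g.
  apply: (mulgI (lift_sec x)); rewrite -ly e1.
  by rewrite (centerC (lift_sec x) zC).
have l1 : l = 1.
  have /zB : rho (w ^+ k)%:M \in B by rewrite wB gpredM ?gpredV ?avalP.
  by rewrite (prim_order_dvd w_prim) lk => /eqP.
have xy : x = y.
  have [g ex [gx _]] := nrepP x; have [g' ey [g'y _]] := nrepP y.
  by rewrite -ex -ey; congr quotient_pi; apply: val_inj; rewrite /= -gx -g'y le l1 scale1r.
rewrite xy in e *; congr (_, _).
by apply: aval_inj; apply: (mulIg (lift_sec y)).
Qed.

(** g covers a matrix, which a scalar from A brings to normal form. A central factor b times [rho]
    of the scalar w^i remains: b is the first coordinate, and w^i is absorbed by multiplying x by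
    that scalar, which leaves [bar x] unchanged. *)
Lemma deformation_map_surj g : exists u, deformation_map u = g.
Proof.
have [m mU cm] := covers_surj g.
have mU' : m \in unitmx by [].
pose x : Kf := quotient_pi (addition_pred K0) (MkGL mU').
have [g0 g0x [g0E [j dj]]] := nrepP x.
have /asboolP[a aE] : (g0^-1 * MkGL mU')%g \in addition_pred K0.
  by apply/quotient_piP; rewrite g0x.
have mE : m = scal a *: nrep x.
  have -> : m = mxval (g0 * (g0^-1 * MkGL mU'))%g by rewrite mulVKg.
  by rewrite g0E -[LHS]/(mxval g0 *m mxval (g0^-1 * MkGL mU')%g) aE mul_mx_scalar.
have cx : covers (nrep x) g.
  have -> : nrep x = (scal a)^-1 *: m by rewrite mE scalerA mulVf // scale1r.
  by apply: coversZ; rewrite ?invr_eq0.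
have nU : nrep x \is a GRing.unit := normal_unit (nrepP x).
have [b bB [i zE]] := CB (covers_unique nU (covers_lift_sec x) cx).
have WU : ((w ^+ i)%:M : 'M[L]_n) \in unitmx by apply: (det_torsion_unit (det_torsion_scalar i)).
pose x' : Kf := (x * quotient_pi (addition_pred K0) (MkGL WU))%g.
have exx : bar x' = bar x.
  rewrite gmulfM -[RHS]mulg1; congr (_ * _)%g; rewrite /= det_barE.
  rewrite -[X in tcompl_proj _ X]mul1g -[X in (X * _)%g]/(sgval (1%g : A)).
  rewrite tcompl_projE //; apply/asboolP; exists N => //; apply: val_inj.
  by rewrite /= uvalX /= det_torsion_scalar.
have nx' : nrep x' = nrep x * (w ^+ i)%:M.
  apply: (@normal_unique x'); first exact: nrepP.
  exists (g0 * MkGL WU)%g; first by rewrite quotient_piM g0x.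
  split; first by rewrite g0E.
  exists (j + i * n)%N; rewrite exx detM dj det_scalar exprD exprM.
  by rewrite mulrA.
have [b' b'E] := aval_ex bB; exists (b', x').
have tx' : tail x' = tail x * (w ^+ i)%:M by rewrite /tail exx nx' mulrA.
have lx' : lift_sec x' = (lift_sec x * rho (w ^+ i)%:M)%g.
  by rewrite /lift_sec exx tx' rhoM // mulgA.
rewrite /deformation_map /= b'E lx' -[RHS](mulVKg (lift_sec x)) zE.
by move: (centerC (lift_sec x) (BC bB)); move: (lift_sec x) => s bC; rewrite !mulgA bC.
Qed.

Lemma isomorphic_deformation : isomorphic H (GL_deformation K0 deformation_cocycle).
Proof.
have /choice[f fK] := deformation_map_surj.
have Kf' : cancel deformation_map f.
  by move=> u; apply: deformation_map_inj; rewrite fK.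
have fM : {morph f : x y / (x * y)%g}.
  by move=> x y; apply: deformation_map_inj; rewrite deformation_mapM !fK.
pose f' := isMultiplicative.Build H (GL_deformation K0 deformation_cocycle) f fM.
pose F : {multiplicative H -> GL_deformation K0 deformation_cocycle} :=
  HB.pack f f'.
by exists F; exists deformation_map.
Qed.

End Deform.

Lemma reconstruction : exists (A : torsion_complement (units L))
    (K0 : addition (GL n L)) (B : abelian_sub H) (h : sym_cocycle (AmodAn n A) (asub_group B)),
  [/\ {subset B <= center H}, forall i, rho (w ^+ i)%:M \in B -> (N %| i)%N,
    forall z, z \in center H -> exists2 b, b \in B & exists i, z = (b * rho (w ^+ i)%:M)%g
    & isomorphic H (GL_deformation K0 h)].
Proof.
have [B [BC zB CB]] := center_complement.
have [Q [BQ _ Qt Qc Qs]] := diagonal_lift BC zB CB.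
exists (lift_compl BC Qt Qc), (scalar_addition BC Qt Qc), B.
exists (deformation_cocycle BC Qt Qc Qs); split=> //.
exact: isomorphic_deformation.
Qed.

End Reconstruction.

Ltac weaken := apply: dterm_weak; [by move=> ? ? ?; cbn [fst snd]; reflexivity|].

(** * Definability in groups *)

Section GroupDefinability.
Variables (I : Type) (Gr : I -> groupType) (PV : Type).
Variable par : forall i, PV -> group_model (Gr i).

Local Notation M := (fun i => group_model (Gr i)).
Local Notation pt := (point_sort (M := M) par).

Section Terms.
Variable G : context M.

Lemma dterm_one : dterm par (G := G) (fun i _ => (1 : Gr i)).
Proof.
have := @dterm_app _ _ M _ par G (GroupOne : op group_signature)
  (fun (j : 'I_0) _ _ => match notF (ltn_ord j) with end).
by apply; case.
Qed.

Lemma dterm_inv (t : forall i, env G i -> Gr i) :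
  dterm par t -> dterm par (fun i e => (t i e)^-1).
Proof.
move=> dt; have := @dterm_app _ _ M _ par G (GroupInv : op group_signature)
  (fun (j : 'I_1) => t).
by apply=> j.
Qed.

Lemma dterm_mul (t s : forall i, env G i -> Gr i) :
  dterm par t -> dterm par s -> dterm par (fun i e => t i e * s i e).
Proof.
move=> dt ds; have := @dterm_app _ _ M _ par G (GroupMul : op group_signature)
  (fun (j : 'I_2) => if val j == 0 then t else s).
by apply=> j; case: ifP.
Qed.

Lemma dterm_exp (t : forall i, env G i -> Gr i) k :
  dterm par t -> dterm par (fun i e => t i e ^+ k).
Proof.
move=> dt; elim: k => [|k IHk]; first exact: dterm_one.
have -> : (fun i e => t i e ^+ k.+1) = (fun i e => t i e * t i e ^+ k).
  by apply: functional_extensionality_dep => i; apply: funext => e; rewrite expgS.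
exact: dterm_mul.
Qed.

Lemma definable_eqG (t s : forall i, env G i -> Gr i) :
  dterm par t -> dterm par s -> definable par (fun i e => t i e = s i e).
Proof. exact: definable_eq. Qed.

Lemma definable_allG (Q : forall i, env G i -> Gr i -> Prop) :
  definable par (G := extend G pt) (fun i e => Q i e.1 e.2) ->
  definable par (fun i e => forall x, Q i e x).
Proof. exact: (definable_all (s := pt)). Qed.

Lemma definable_exG (Q : forall i, env G i -> Gr i -> Prop) :
  definable par (G := extend G pt) (fun i e => Q i e.1 e.2) ->
  definable par (fun i e => exists x, Q i e x).
Proof. exact: (definable_ex (s := pt)). Qed.

Lemma dterm_var : dterm par (G := extend G pt) (fun i e => e.2).
Proof. refine (@dterm_new _ _ M _ par G pt tt). Qed.

End Terms.
End GroupDefinability.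

Ltac dterm_solve := first [assumption | apply: dterm_var | apply: dterm_one
  | apply: dterm_mul; dterm_solve | apply: dterm_inv; dterm_solve
  | apply: dterm_exp; dterm_solve | weaken; dterm_solve
  | match goal with H : _ |- _ => apply: H end].

(** * The definable field *)

Section RawField.
Variable n' : nat.
Local Notation n := n'.+3.

Definition params : finType := ('I_n + 'I_n * 'I_n + unit)%type.

Definition o0 : 'I_n := ord0.
Definition o1 : 'I_n := @Ordinal n 1 isT.
Definition o2 : 'I_n := @Ordinal n 2 isT.

Section Raw.
Variables (G : groupType) (p : params -> G).

Definition refl i := p (inl (inl i)).
Definition weyl i j := p (inl (inr (i, j))).
Definition unip := p (inr tt).

Definition in_torus t := forall i, t * refl i = refl i * t.

Definition in_root x := x = 1 \/ exists t, in_torus t /\ x = t * unip * t^-1.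

Definition root_elt i j x := weyl i j * x * (weyl i j)^-1.

Definition comm_mul (x y : G) := x * y * x^-1 * y^-1.

(* [[x_02(a), x_21(b)] = x_01(ab)]. *)
Definition root_mul x y := comm_mul (root_elt o0 o2 x) (root_elt o2 o1 y).

(** The first two clauses allow simultaneous diagonalisation of the reflections, the third keeps
    their centraliser inside the diagonal matrices, and the last gives 1 <> 0 in the field and an
    off-diagonal entry of [unip]. *)
Definition torus_ax := [/\ forall i, refl i * refl i = 1,
  forall i j, refl i * refl j = refl j * refl i,
  forall s t, in_torus s -> in_torus t -> s * t = t * s &
  ~ in_torus unip].

Definition root_ax :=
  (forall x y, in_root x -> in_root y -> in_root (x * y^-1) /\ x * y = y * x) /\
  (forall x, in_root x -> root_mul unip x = x /\
     (x <> 1 -> exists y, in_root y /\ root_mul y x = unip)) /\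
  (forall x y, in_root x -> in_root y ->
     in_root (root_mul x y) /\ root_mul x y = root_mul y x) /\
  (forall x y z, in_root x -> in_root y -> in_root z ->
     root_mul x (root_mul y z) = root_mul (root_mul x y) z /\
     root_mul (x * y) z = root_mul x z * root_mul y z).

Definition frame_ax := torus_ax /\ root_ax.

End Raw.

Section RawDefinability.
Variables (I : Type) (Gr : I -> groupType) (PV : Type).
Variable par : forall i, PV -> group_model (Gr i).
Local Notation M := (fun i => group_model (Gr i)).

Implicit Type G : context M.

Definition dparams G (p : forall i, env G i -> params -> Gr i) :=
  forall q, dterm par (fun i e => p i e q).

Lemma dparams_weak G (p : forall i, env G i -> params -> Gr i) (s : coded_sort par) :
  dparams p -> dparams (G := extend G s) (fun i e => p i e.1).
Proof. by move=> dp q; weaken; apply: dp. Qed.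

Lemma definable_in_torus G p (t : forall i, env G i -> Gr i) : dparams p ->
  dterm par t -> definable par (fun i e => in_torus (p i e) (t i e)).
Proof.
move=> dp dt; apply: definable_allfin => i; apply: definable_eqG; rewrite /refl; dterm_solve.
Qed.

Lemma definable_in_root G p (t : forall i, env G i -> Gr i) : dparams p ->
  dterm par t -> definable par (fun i e => in_root (p i e) (t i e)).
Proof.
move=> dp dt; have dp' := dparams_weak (s := point_sort par) dp.
apply: definable_or; first by apply: definable_eqG; dterm_solve.
apply: (definable_exG (Q := fun i e s => in_torus (p i e) s /\ t i e = s * unip (p i e) * s^-1)).
apply: definable_and; first by apply: (definable_in_torus dp'); dterm_solve.
by apply: definable_eqG; rewrite /unip; dterm_solve.
Qed.

Lemma dterm_root_elt G p i j (x : forall i, env G i -> Gr i) : dparams p ->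
  dterm par x -> dterm par (fun k e => root_elt (p k e) i j (x k e)).
Proof. by move=> dp dx; rewrite /root_elt /weyl; dterm_solve. Qed.

Lemma dterm_comm_mul G (x y : forall i, env G i -> Gr i) :
  dterm par x -> dterm par y -> dterm par (fun k e => comm_mul (x k e) (y k e)).
Proof. by move=> dx dy; rewrite /comm_mul; dterm_solve. Qed.

Lemma dterm_root_mul G p (x y : forall i, env G i -> Gr i) : dparams p ->
  dterm par x -> dterm par y -> dterm par (fun k e => root_mul (p k e) (x k e) (y k e)).
Proof. by move=> dp dx dy; apply: dterm_comm_mul; apply: dterm_root_elt. Qed.

Lemma definable_all_root G p (Q : forall i, env G i -> Gr i -> Prop) : dparams p ->
  definable par (G := extend G (point_sort par)) (fun i e => Q i e.1 e.2) ->
  definable par (fun i e => forall x, in_root (p i e) x -> Q i e x).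
Proof.
move=> dp dQ; apply: (definable_allG (Q := fun i e x => in_root (p i e) x -> Q i e x)).
apply: definable_imp => //; apply: (definable_in_root (dparams_weak (s := point_sort par) dp)).
exact: dterm_var.
Qed.

Lemma definable_torus_ax G p : dparams p ->
  definable par (fun i (e : env G i) => torus_ax (p i e)).
Proof.
move=> dp.
have : definable par (fun i (e : env G i) =>
    (forall k, refl (p i e) k * refl (p i e) k = 1) /\
    (forall k l, refl (p i e) k * refl (p i e) l = refl (p i e) l * refl (p i e) k) /\
    (forall s t, in_torus (p i e) s -> in_torus (p i e) t -> s * t = t * s) /\
    ~ in_torus (p i e) (unip (p i e))).
  apply: definable_and.
    by apply: definable_allfin => k; apply: definable_eqG; rewrite /refl; dterm_solve.
  apply: definable_and.
    apply: definable_allfin => k; apply: definable_allfin => l.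
    by apply: definable_eqG; rewrite /refl; dterm_solve.
  apply: definable_and; last first.
    by apply: definable_not; apply: definable_in_torus; rewrite /unip; dterm_solve.
  have dp' := dparams_weak (s := point_sort par) dp.
  have dp'' := dparams_weak (s := point_sort par) dp'.
  apply: definable_allG; apply: definable_allG => /=.
  apply: definable_imp; first by apply: (definable_in_torus dp''); dterm_solve.
  apply: definable_imp; first by apply: (definable_in_torus dp''); dterm_solve.
  by apply: definable_eqG; dterm_solve.
by apply: definable_iff => i e; split=> [[? [? []]]|[]].
Qed.

Lemma definable_root_ax G p : dparams p ->
  definable par (fun i (e : env G i) => root_ax (p i e)).
Proof.
move=> dp; have dp1 := dparams_weak (s := point_sort par) dp.
have dp2 := dparams_weak (s := point_sort par) dp1.
have dp3 := dparams_weak (s := point_sort par) dp2.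
repeat apply: definable_and.
- have : definable par (fun i (e : env G i) => forall x, in_root (p i e) x ->
    forall y, in_root (p i e) y -> in_root (p i e) (x * y^-1) /\ x * y = y * x).
    apply: (definable_all_root dp); apply: (definable_all_root dp1).
    apply: definable_and; first by apply: (definable_in_root dp2); dterm_solve.
    by apply: definable_eqG; dterm_solve.
  by apply: definable_iff => i e; split=> h x y *; apply: h.
- apply: (definable_all_root dp); apply: definable_and.
    by apply: definable_eqG; [apply: (dterm_root_mul dp1); rewrite /unip|]; dterm_solve.
  apply: definable_imp; first by apply/definable_not/definable_eqG; dterm_solve.
  apply: definable_exG; apply: definable_and.
    by apply: (definable_in_root dp2); dterm_solve.
  by apply: definable_eqG; [apply: (dterm_root_mul dp2)|rewrite /unip]; dterm_solve.
- have : definable par (fun i (e : env G i) => forall x, in_root (p i e) x ->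
    forall y, in_root (p i e) y -> in_root (p i e) (root_mul (p i e) x y) /\
      root_mul (p i e) x y = root_mul (p i e) y x).
    apply: (definable_all_root dp); apply: (definable_all_root dp1).
    apply: definable_and.
      by apply: (definable_in_root dp2); apply: (dterm_root_mul dp2); dterm_solve.
    by apply: definable_eqG; apply: (dterm_root_mul dp2); dterm_solve.
  by apply: definable_iff => i e; split=> h x y *; apply: h.
have : definable par (fun i (e : env G i) => forall x, in_root (p i e) x ->
    forall y, in_root (p i e) y -> forall z, in_root (p i e) z ->
     root_mul (p i e) x (root_mul (p i e) y z) = root_mul (p i e) (root_mul (p i e) x y) z /\
     root_mul (p i e) (x * y) z = root_mul (p i e) x z * root_mul (p i e) y z).
  apply: (definable_all_root dp); apply: (definable_all_root dp1).
  apply: (definable_all_root dp2); apply: definable_and; apply: definable_eqG;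
    by rewrite /root_mul /comm_mul /root_elt /weyl; dterm_solve.
by apply: definable_iff => i e; split=> h x y z *; apply: h.
Qed.

Lemma definable_frame_ax G p : dparams p ->
  definable par (fun i (e : env G i) => frame_ax (p i e)).
Proof.
by move=> dp; apply: definable_and; [apply: definable_torus_ax|apply: definable_root_ax].
Qed.

End RawDefinability.
End RawField.

Section FieldCode.
Variable n' : nat.
Local Notation n := n'.+3.

(** The field is not fixed to be the set of root elements, so that in GL_n(F) it can be taken to be
    F itself. *)
Record fieldcode (G : groupType) (p : params n' -> G) := FieldCode {
  fld : fieldType;
  fval : fld -> G;
  fvalD : forall a b, fval (a + b)%R = fval a * fval b;
  fvalM : forall a b, fval (a * b)%R = root_mul p (fval a) (fval b);
  fval1 : fval 1%R = unip p;
  fval_inj : injective fval;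
  fvalP : forall x, in_root p x <-> exists a, fval a = x }.

Section Build.
Variables (G : groupType) (p : params n' -> G).

Lemma in_root1 : in_root p 1. Proof. by left. Qed.

Lemma in_root_unip : in_root p (unip p).
Proof. by right; exists 1; split; [move=> i; rewrite mul1g mulg1|rewrite invg1 mulg1 mul1g]. Qed.

(** [ax] is an argument of the type because the field structure put on it depends on the axioms. *)
Definition root_field (ax : frame_ax p) : Type := {x : G | `[< in_root p x >]}.

Variable ax : frame_ax p.
Local Notation T := (root_field ax).

HB.instance Definition _ := Choice.copy T {x : G | `[< in_root p x >]}.

Let elt (x : T) : G := val x.
Let eltP (x : T) : in_root p (elt x). Proof. exact/asboolP/(valP x). Qed.
Let elt_inj : injective elt. Proof. exact: val_inj. Qed.
Let mk x (rx : in_root p x) : T := exist _ x (asboolT rx).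

Let ax_div : forall x y, in_root p x -> in_root p y -> in_root p (x * y^-1).
Proof. by move=> x y rx ry; have [_ [/(_ x y rx ry)[]]] := ax. Qed.
Let ax_comm : forall x y, in_root p x -> in_root p y -> x * y = y * x.
Proof. by move=> x y rx ry; have [_ [/(_ x y rx ry)[]]] := ax. Qed.
Let ax_one : forall x, in_root p x -> root_mul p (unip p) x = x.
Proof. by move=> x rx; have [_ [_ [/(_ x rx)[]]]] := ax. Qed.
Let ax_inv : forall x, in_root p x -> x <> 1 -> exists y, in_root p y /\ root_mul p y x = unip p.
Proof. by move=> x rx; have [_ [_ [/(_ x rx)[]]]] := ax. Qed.
Let ax_mul : forall x y, in_root p x -> in_root p y -> in_root p (root_mul p x y).
Proof. by move=> x y rx ry; have [_ [_ [_ [/(_ x y rx ry)[]]]]] := ax. Qed.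
Let ax_mulC : forall x y, in_root p x -> in_root p y -> root_mul p x y = root_mul p y x.
Proof. by move=> x y rx ry; have [_ [_ [_ [/(_ x y rx ry)[]]]]] := ax. Qed.
Let ax_mulA : forall x y z, in_root p x -> in_root p y -> in_root p z ->
  root_mul p x (root_mul p y z) = root_mul p (root_mul p x y) z.
Proof. by move=> x y z rx ry rz; have [_ [_ [_ [_ /(_ x y z rx ry rz)[]]]]] := ax. Qed.
Let ax_mulD : forall x y z, in_root p x -> in_root p y -> in_root p z ->
  root_mul p (x * y) z = root_mul p x z * root_mul p y z.
Proof. by move=> x y z rx ry rz; have [_ [_ [_ [_ /(_ x y z rx ry rz)[]]]]] := ax. Qed.

Let ax_opp x : in_root p x -> in_root p x^-1.
Proof. by move=> rx; rewrite -[x^-1]mul1g; apply: ax_div => //; apply: in_root1. Qed.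
Let ax_add x y : in_root p x -> in_root p y -> in_root p (x * y).
Proof. by move=> rx ry; rewrite -[y]invgK; apply: ax_div => //; apply: ax_opp. Qed.

Let zero : T := mk in_root1.
Let one : T := mk in_root_unip.
Let opp x : T := mk (ax_opp (eltP x)).
Let add x y : T := mk (ax_add (eltP x) (eltP y)).
Let mul x y : T := mk (ax_mul (eltP x) (eltP y)).

Let addA : associative add. Proof. by move=> x y z; apply: elt_inj; apply: mulgA. Qed.
Let addC : commutative add. Proof. by move=> x y; apply: elt_inj; apply: ax_comm; apply: eltP. Qed.
Let add0 : left_id zero add. Proof. by move=> x; apply: elt_inj; apply: mul1g. Qed.
Let addN : left_inverse zero opp add. Proof. by move=> x; apply: elt_inj; apply: mulVg. Qed.

HB.instance Definition _ := GRing.isZmodule.Build T addA addC add0 addN.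

Let mulA : associative mul. Proof. by move=> x y z; apply: elt_inj; apply: ax_mulA; apply: eltP. Qed.
Let mulC : commutative mul. Proof. by move=> x y; apply: elt_inj; apply: ax_mulC; apply: eltP. Qed.
Let mul1 : left_id one mul. Proof. by move=> x; apply: elt_inj; apply: ax_one; apply: eltP. Qed.
Let mulD : left_distributive mul add.
Proof. by move=> x y z; apply: elt_inj; apply: ax_mulD; apply: eltP. Qed.
Let one_neq0 : one != 0%R.
Proof.
apply/eqP => /(congr1 elt) /= u1; have [[_ _ _ nu] _] := ax; apply: nu.
by rewrite -[unip p]/(elt one) u1 => i; rewrite mul1g mulg1.
Qed.

HB.instance Definition _ :=
  GRing.Zmodule_isComNzRing.Build T mulA mulC mul1 mulD one_neq0.

Let inv_ex (x : T) : exists y : T, (x != 0 -> y * x = 1)%R /\ (x = 0 -> y = 0)%R.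
Proof.
have [->|x0] := eqVneq x 0%R; first by exists 0%R.
have [|y [ry yx]] := ax_inv (eltP x).
  by move=> x1; case/eqP: x0; apply: elt_inj.
exists (mk ry); split=> [_|x0']; first exact: elt_inj.
by rewrite x0' eqxx in x0.
Qed.

Let inv (x : T) : T := projT1 (cid (inv_ex x)).
Let invP (x : T) : x != 0%R -> (inv x * x)%R = 1%R.
Proof. exact: (projT2 (cid (inv_ex x))).1. Qed.
Let inv0 : inv 0%R = 0%R.
Proof. exact: (projT2 (cid (inv_ex 0%R))).2. Qed.

HB.instance Definition _ := GRing.ComNzRing_isField.Build T invP inv0.

Lemma frame_fieldcode : exists fc : fieldcode p, True.
Proof.
unshelve eexists (@FieldCode G p T elt _ _ _ _ _) => //.
move=> x; split=> [rx|[a <-]]; last exact: eltP.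
by exists (mk rx).
Qed.

End Build.

Section Converse.
Variables (G : groupType) (p : params n' -> G) (fc : fieldcode p).
Local Notation v := (fval (f := fc)).

Lemma fval0 : v 0%R = 1.
Proof. by apply: (mulgI (v 0%R)); rewrite -fvalD addr0 mulg1. Qed.

Lemma fvalN a : v (- a)%R = (v a)^-1.
Proof. by apply: (mulgI (v a)); rewrite -fvalD subrr mulgV fval0. Qed.

(** The axioms are the field laws read through [fval]; in GL_n(F) they follow from the laws of F. *)
Lemma fieldcode_root_ax : root_ax p.
Proof.
split; last split; last split.
- move=> _ _ /fvalP-/(_ fc)[a <-] /fvalP-/(_ fc)[b <-]; split.
    by apply/(fvalP fc); exists (a - b)%R; rewrite fvalD fvalN.
  by rewrite -!fvalD addrC.
- move=> _ /fvalP-/(_ fc)[a <-]; split; first by rewrite -(fval1 fc) -fvalM mul1r.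
  move=> a1; exists (v a^-1%R); split; first by apply/(fvalP fc); exists a^-1%R.
  rewrite -fvalM mulVf ?fval1 //; apply/eqP => a0.
  by apply: a1; rewrite a0 fval0.
- move=> _ _ /fvalP-/(_ fc)[a <-] /fvalP-/(_ fc)[b <-]; rewrite -!fvalM mulrC; split=> //.
  by apply/(fvalP fc); exists (b * a)%R.
- move=> _ _ _ /fvalP-/(_ fc)[a <-] /fvalP-/(_ fc)[b <-] /fvalP-/(_ fc)[c <-].
  by rewrite -fvalD -!fvalM -fvalD mulrA mulrDl.
Qed.

End Converse.
End FieldCode.

(** * Coordinatised groups *)

Section Frames.
Variable n' : nat.
Local Notation n := n'.+3.
Local Open Scope ring_scope.

(** Frames index the class over which definability is uniform. Formulas see only the group and the
    parameters; [fcode] says which scalars the root elements stand for. *)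
Record frame := Frame {
  fgroup : groupType;
  fparam : params n' -> fgroup;
  fcode : fieldcode fparam }.

Definition ffld (c : frame) : fieldType := fld (fcode c).
Definition fv (c : frame) (a : ffld c) : fgroup c := fval a.

Local Notation M := (fun c => group_model (fgroup c)).
Definition fpar (c : frame) : params n' -> M c := @fparam c.

Implicit Type G : context M.
Local Notation par := fpar.

Lemma dparams_par G : dparams par (G := G) (fun c _ => @fparam c).
Proof. by move=> q; apply: dterm_param. Qed.

Lemma fv_dom : definable par (G := tuple_context M unit)
  (fun c y => exists x : ffld c, forall j : unit, fv x = y j).
Proof.
have := definable_in_root (par := par) (@dparams_par _)
  (t := fun c (y : env (tuple_context M unit) c) => y tt).
move=> h; apply: (definable_iff _ (h _)) => [c y|].
  rewrite (fvalP (fcode c)); split=> [[a ay]|[a ay]]; exists a => //.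
  by move=> [].
by move=> k r; exists (Var _ (r (inr tt))) => c y e [_ /(_ tt)].
Qed.

Lemma fv_matrix_dom : definable par (G := tuple_context M ('I_n * 'I_n)%type)
  (fun c y => exists x : 'M[ffld c]_n, forall ij, fv (x ij.1 ij.2) = y ij).
Proof.
have : definable par (G := tuple_context M ('I_n * 'I_n)%type)
    (fun c y => forall ij, in_root (@fparam c) (y ij)).
  apply: definable_allfin => ij; apply: definable_in_root; first exact: @dparams_par.
  by move=> k r; exists (Var _ (r (inr ij))) => c y e [_ /(_ ij)].
apply: definable_iff => c y; split=> [h|[x xy] ij].
  have /choice[x xy] : forall ij, exists a : ffld c, fv a = y ij.
    by move=> ij; apply/(fvalP (fcode c)).
  by exists (\matrix_(i, j) x (i, j)) => -[i j]; rewrite mxE xy.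
by apply/(fvalP (fcode c)); exists (x ij.1 ij.2); apply: xy.
Qed.

Definition scalar_sort : coded_sort par := CodedSort fv_dom.
Definition matrix_sort : coded_sort par := CodedSort fv_matrix_dom.

Section Terms.
Variable G : context M.

Definition lterm (t : forall c, env G c -> ffld c) :=
  dterm par (G := G) (fun c e => fv (t c e)).
Definition mterm (t : forall c, env G c -> 'M[ffld c]_n) :=
  forall i j, lterm (fun c e => t c e i j).

Lemma dterm_eq (t s : forall c, env G c -> fgroup c) :
  (forall c e, t c e = s c e) -> dterm par s -> dterm par t.
Proof.
move=> ts; rewrite (_ : t = s) //.
by apply: functional_extensionality_dep => c; apply: funext => e; rewrite ts.
Qed.

Lemma lterm_eq (t s : forall c, env G c -> ffld c) :
  (forall c e, t c e = s c e) -> lterm s -> lterm t.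
Proof. by move=> ts; apply: dterm_eq => c e; rewrite ts. Qed.

Lemma definable_eqL t s : lterm t -> lterm s ->
  definable par (G := G) (fun c e => t c e = s c e).
Proof.
move=> dt ds; apply: (definable_iff _ (definable_eqG dt ds)) => c e.
by split=> [/fval_inj|->].
Qed.

Lemma definable_eqM t s : mterm t -> mterm s ->
  definable par (G := G) (fun c e => t c e = s c e).
Proof.
move=> dt ds; have : definable par (G := G) (fun c e => forall i j, t c e i j = s c e i j).
  by apply: definable_allfin => i; apply: definable_allfin => j; apply: definable_eqL.
by apply: definable_iff => c e; split=> [ts|->//]; apply/matrixP.
Qed.

Lemma lterm1 : lterm (fun c _ => 1).
Proof.
by apply: dterm_eq (@dparams_par G (inr tt)) => c e; apply: fval1.
Qed.

Lemma ltermB t s : lterm t -> lterm s -> lterm (fun c e => t c e - s c e).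
Proof.
move=> dt ds; apply: dterm_eq (dterm_mul dt (dterm_inv ds)) => c e.
by rewrite /fv fvalD fvalN.
Qed.

Lemma lterm0 : lterm (fun c _ => 0).
Proof. by apply: lterm_eq (ltermB lterm1 lterm1) => c e; rewrite subrr. Qed.

Lemma ltermN t : lterm t -> lterm (fun c e => - t c e).
Proof. by move=> dt; apply: lterm_eq (ltermB lterm0 dt) => c e; rewrite sub0r. Qed.

Lemma ltermD t s : lterm t -> lterm s -> lterm (fun c e => t c e + s c e).
Proof.
by move=> dt ds; apply: lterm_eq (ltermB dt (ltermN ds)) => c e; rewrite opprK.
Qed.

Lemma ltermM t s : lterm t -> lterm s -> lterm (fun c e => t c e * s c e).
Proof.
move=> dt ds; apply: dterm_eq (dterm_root_mul (@dparams_par G) dt ds) => c e.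
exact: fvalM.
Qed.

Lemma lterm_nat k : lterm (fun c _ => k%:R).
Proof.
elim: k => [|k IHk]; first exact: lterm0.
by apply: lterm_eq (ltermD lterm1 IHk) => c e; rewrite mulrS.
Qed.

Lemma ltermX t k : lterm t -> lterm (fun c e => t c e ^+ k).
Proof.
move=> dt; elim: k => [|k IHk]; first exact: lterm1.
by apply: lterm_eq (ltermM dt IHk) => c e; rewrite exprS.
Qed.

Lemma lterm_sum (J : Type) (s : seq J) (t : J -> forall c, env G c -> ffld c) :
  (forall j, lterm (t j)) -> lterm (fun c e => \sum_(j <- s) t j c e).
Proof.
move=> dt; elim: s => [|j s IHs].
  by apply: lterm_eq lterm0 => c e; rewrite big_nil.
by apply: lterm_eq (ltermD (dt j) IHs) => c e; rewrite big_cons.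
Qed.

Lemma lterm_prod (J : Type) (s : seq J) (t : J -> forall c, env G c -> ffld c) :
  (forall j, lterm (t j)) -> lterm (fun c e => \prod_(j <- s) t j c e).
Proof.
move=> dt; elim: s => [|j s IHs].
  by apply: lterm_eq lterm1 => c e; rewrite big_nil.
by apply: lterm_eq (ltermM (dt j) IHs) => c e; rewrite big_cons.
Qed.

(** The size n is fixed, so the Leibniz sum is a term. *)
Lemma lterm_det m : mterm m -> lterm (fun c e => \det (m c e)).
Proof.
move=> dm; apply: lterm_sum => s; apply: ltermM.
  by apply: ltermX; apply: ltermN; apply: lterm1.
by apply: lterm_prod => i; apply: dm.
Qed.

Lemma mtermM m m' : mterm m -> mterm m' -> mterm (fun c e => m c e * m' c e).
Proof.
move=> dm dm' i j; apply: (lterm_eq (s := fun c e => \sum_(k <- index_enum _) m c e i k * m' c e k j)).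
  by move=> c e; rewrite mxE.
by apply: lterm_sum => k; apply: ltermM; [apply: dm|apply: dm'].
Qed.

Lemma mterm_scalar a : lterm a -> mterm (fun c e => (a c e)%:M).
Proof.
move=> da i j; apply: (lterm_eq (s := fun c e => a c e * (i == j)%:R)).
  by move=> c e; rewrite mxE mulr_natr.
by apply: ltermM => //; apply: lterm_nat.
Qed.

Lemma mterm1 : mterm (fun c e => 1).
Proof. by apply: mterm_scalar; apply: lterm1. Qed.

Lemma mterm_diag_last a : lterm a -> mterm (fun c e => diag_last n'.+2 (a c e)).
Proof.
move=> da i j; apply: (lterm_eq (s := fun c e =>
  (if i == ord_max then a c e else 1) * (i == j)%:R)).
  by move=> c e; rewrite (diag_lastE (a c e)) mulr_natr.
by apply: ltermM; [case: (i == ord_max) => //; apply: lterm1|apply: lterm_nat].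
Qed.

Lemma mterm_elem k l a : lterm a -> mterm (fun c e => elem k l (a c e)).
Proof.
move=> da i j; apply: (lterm_eq (s := fun c e =>
  (i == j)%:R + a c e * ((i == k) && (j == l))%:R)).
  by move=> c e; rewrite elemE mulr_natr.
by apply: ltermD; [|apply: ltermM] => //; apply: lterm_nat.
Qed.

Lemma definable_allL (Q : forall c, env G c -> ffld c -> Prop) :
  definable par (G := extend G scalar_sort) (fun c e => Q c e.1 e.2) ->
  definable par (fun c e => forall x, Q c e x).
Proof. exact: (definable_all (s := scalar_sort)). Qed.

Lemma definable_exL (Q : forall c, env G c -> ffld c -> Prop) :
  definable par (G := extend G scalar_sort) (fun c e => Q c e.1 e.2) ->
  definable par (fun c e => exists x, Q c e x).
Proof. exact: (definable_ex (s := scalar_sort)). Qed.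

Lemma definable_allM (Q : forall c, env G c -> 'M[ffld c]_n -> Prop) :
  definable par (G := extend G matrix_sort) (fun c e => Q c e.1 e.2) ->
  definable par (fun c e => forall x, Q c e x).
Proof. exact: (definable_all (s := matrix_sort)). Qed.

Lemma definable_exM (Q : forall c, env G c -> 'M[ffld c]_n -> Prop) :
  definable par (G := extend G matrix_sort) (fun c e => Q c e.1 e.2) ->
  definable par (fun c e => exists x, Q c e x).
Proof. exact: (definable_ex (s := matrix_sort)). Qed.

End Terms.

Lemma lterm_var G : lterm (G := extend G scalar_sort) (fun c e => e.2).
Proof. exact: (@dterm_new _ _ M _ par G scalar_sort tt). Qed.

Lemma mterm_var G : mterm (G := extend G matrix_sort) (fun c e => e.2).
Proof. by move=> i j; apply: (@dterm_new _ _ M _ par G matrix_sort (i, j)). Qed.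

Lemma lterm_weak G (s : coded_sort par) (t : forall c, env G c -> ffld c)
    (t' : forall c, env (extend G s) c -> ffld c) :
  (forall c e x, t' c (e, x) = t c e) -> lterm t -> lterm t'.
Proof. by move=> t't; apply: dterm_weak => c e x; rewrite t't. Qed.

Lemma mterm_weak G (s : coded_sort par) (t : forall c, env G c -> 'M[ffld c]_n)
    (t' : forall c, env (extend G s) c -> 'M[ffld c]_n) :
  (forall c e x, t' c (e, x) = t c e) -> mterm t -> mterm t'.
Proof.
by move=> t't dt i j; apply: lterm_weak (dt i j) => c e x; rewrite t't.
Qed.

End Frames.

Ltac lweaken := apply: lterm_weak; [by move=> ? ? ?; cbn [fst snd]; reflexivity|].
Ltac mweaken := apply: mterm_weak; [by move=> ? ? ?; cbn [fst snd]; reflexivity|].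

Ltac fterm_solve := cbn beta; lazymatch goal with
  | |- lterm _ => first [assumption | apply: lterm_var | apply: lterm1
     | apply: ltermX; fterm_solve | apply: ltermM; fterm_solve
     | apply: lterm_det; fterm_solve | lweaken; fterm_solve]
  | |- mterm _ => first [assumption | apply: mterm_var | apply: mterm1
     | apply: mterm_scalar; fterm_solve | apply: mterm_diag_last; fterm_solve
     | apply: mterm_elem; fterm_solve | apply: mtermM; fterm_solve
     | mweaken; fterm_solve]
  | |- _ => first [assumption | apply: dterm_var | apply: dterm_one
     | apply: dterm_mul; fterm_solve | apply: dterm_inv; fterm_solve
     | apply: dterm_exp; fterm_solve | weaken; fterm_solve]
  end.

Section Coordinates.
Variables (n' N K : nat).
Local Notation n := n'.+3.
Local Open Scope ring_scope.

Local Notation M := (fun c : frame n' => group_model (fgroup c)).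
Local Notation par := (@fpar n').
Implicit Type G : context M.

Definition root_at (c : frame n') i j (a : ffld c) : fgroup c :=
  root_elt (@fparam n' c) i j (fv a).

(** One word read twice, in elementary matrices over the field and in root elements of the group;
    this matches matrices with group elements. *)
Fixpoint word_rel (c : frame n') k (m : 'M[ffld c]_n) (g : fgroup c) : Prop :=
  if k is k'.+1 then word_rel k' m g \/ exists i j, i != j /\
    exists a m' g', m = elem i j a * m' /\ g = (root_at i j a * g')%g /\ word_rel k' m' g'
  else m = 1 /\ g = 1%g.

(* Every matrix of torsion determinant is [diag(1, .., 1, w^k)] times a product of
   [K] elementary matrices when [K] is large; [d] stands for [diag(1, .., 1, w)]. *)
Definition coordinates (c : frame n') (w : ffld c) (d : fgroup c) (m : 'M[ffld c]_n) (g : fgroup c) :=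
  exists k : 'I_N, exists m' g', m = diag_last n'.+2 (w ^+ k) * m' /\ g = (d ^+ k * g')%g /\
    word_rel K m' g'.

(* [mi] stands for [m^-1]: as a separate argument it keeps the definition within
   the ring operations. *)
Definition conj_coord (c : frame n') (w : ffld c) (d : fgroup c) (m mi : 'M[ffld c]_n) (g : fgroup c) :=
  forall s s', det_torsion N s -> coordinates w d s s' ->
    coordinates w d (m * s * mi) (g * s' * g^-1)%g.

Definition coord_hom (c : frame n') (w : ffld c) (d : fgroup c) :=
  (forall m, det_torsion N m -> exists g, coordinates w d m g) /\
  (forall m g m' g', coordinates w d m g -> coordinates w d m' g' -> coordinates w d (m * m') (g * g')%g) /\
  (forall m g g', coordinates w d m g -> coordinates w d m g' -> g = g') /\
  (forall m, coordinates w d m 1%g -> m = 1).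

Definition coord_action (c : frame n') (w : ffld c) (d : fgroup c) :=
  (forall g, exists m mi, m * mi = 1 /\ conj_coord w d m mi g) /\
  (forall m mi, m * mi = 1 -> exists g, conj_coord w d m mi g) /\
  (forall g, conj_coord w d 1 1 g -> forall x, (g * x = x * g)%g) /\
  (forall z, (forall x, (z * x = x * z)%g) -> (z ^+ N)%g = 1%g ->
     exists i : 'I_N, coordinates w d (w ^+ i)%:M z) /\
  (forall a ai b bi g g', a * ai = 1 -> b * bi = 1 ->
     conj_coord w d (diag_last n'.+2 a) (diag_last n'.+2 ai) g ->
     conj_coord w d (diag_last n'.+2 b) (diag_last n'.+2 bi) g' -> (g * g' = g' * g)%g).

(** What the reconstruction asks, except that torsion of every order has exponent dividing [N]: that
    is a scheme of sentences and is transferred separately. *)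
Definition coordinatised (c : frame n') := exists w d,
  (w ^+ N = 1 /\ forall i : 'I_N, (0 < i)%N -> w ^+ i <> 1) /\
  (@coord_hom c w d /\ @coord_action c w d).

Lemma dterm_root_at G i j (a : forall c, env G c -> ffld c) :
  lterm a -> dterm par (fun c e => root_at i j (a c e)).
Proof. exact: (dterm_root_elt i j (@dparams_par n' G)). Qed.

Lemma definable_word_rel k G (m : forall c, env G c -> 'M[ffld c]_n)
    (g : forall c, env G c -> fgroup c) : mterm m -> dterm par g ->
  definable par (fun c e => word_rel k (m c e) (g c e)).
Proof.
elim: k G m g => [|k IHk] G m g dm dg /=.
  by apply: definable_and; [apply: definable_eqM|apply: definable_eqG]; fterm_solve.
apply: definable_or; first exact: IHk.
apply: definable_exfin => i; apply: definable_exfin => j.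
apply: definable_and; first exact: definable_cst.
apply: definable_exL; apply: definable_exM; apply: definable_exG; cbn beta.
apply: definable_and; first by apply: definable_eqM; fterm_solve.
apply: definable_and; last by apply: IHk; fterm_solve.
apply: definable_eqG; first by fterm_solve.
by apply: dterm_mul; [apply: dterm_root_at|]; fterm_solve.
Qed.

Lemma definable_coord G (w : forall c, env G c -> ffld c) (d : forall c, env G c -> fgroup c)
    (m : forall c, env G c -> 'M[ffld c]_n) (g : forall c, env G c -> fgroup c) :
  lterm w -> dterm par d -> mterm m -> dterm par g ->
  definable par (fun c e => coordinates (w c e) (d c e) (m c e) (g c e)).
Proof.
move=> dw dd dm dg; apply: definable_exfin => k.
apply: definable_exM; apply: definable_exG; cbn beta.
apply: definable_and; first by apply: definable_eqM; fterm_solve.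
apply: definable_and; first by apply: definable_eqG; fterm_solve.
by apply: definable_word_rel; fterm_solve.
Qed.

Lemma definable_det_torsion G (m : forall c, env G c -> 'M[ffld c]_n) :
  mterm m -> definable par (fun c e => det_torsion N (m c e)).
Proof. by move=> dm; apply: definable_eqL; fterm_solve. Qed.

Lemma definable_conj_coord G (w : forall c, env G c -> ffld c) (d : forall c, env G c -> fgroup c)
    (m mi : forall c, env G c -> 'M[ffld c]_n) (g : forall c, env G c -> fgroup c) :
  lterm w -> dterm par d -> mterm m -> mterm mi -> dterm par g ->
  definable par (fun c e => conj_coord (w c e) (d c e) (m c e) (mi c e) (g c e)).
Proof.
move=> dw dd dm dmi dg; apply: definable_allM; apply: definable_allG; cbn beta.
apply: definable_imp; first by apply: definable_det_torsion; fterm_solve.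
by apply: definable_imp; apply: definable_coord; fterm_solve.
Qed.

Lemma definable_coord_hom G (w : forall c, env G c -> ffld c) (d : forall c, env G c -> fgroup c) :
  lterm w -> dterm par d -> definable par (fun c e => coord_hom (w c e) (d c e)).
Proof.
move=> dw dd; apply: definable_and; [|apply: definable_and; [|apply: definable_and]].
- apply: definable_allM; cbn beta.
  apply: definable_imp; first by apply: definable_det_torsion; fterm_solve.
  by apply: definable_exG; cbn beta; apply: definable_coord; fterm_solve.
- apply: definable_allM; apply: definable_allG; apply: definable_allM; apply: definable_allG.
  by cbn beta; do 2?[apply: definable_imp]; apply: definable_coord; fterm_solve.
- apply: definable_allM; apply: definable_allG; apply: definable_allG; cbn beta.
  apply: definable_imp; first by apply: definable_coord; fterm_solve.
  apply: definable_imp; first by apply: definable_coord; fterm_solve.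
  by apply: definable_eqG; fterm_solve.
- apply: definable_allM; cbn beta.
  apply: definable_imp; first by apply: definable_coord; fterm_solve.
  by apply: definable_eqM; fterm_solve.
Qed.

Lemma definable_coord_action G (w : forall c, env G c -> ffld c) (d : forall c, env G c -> fgroup c) :
  lterm w -> dterm par d -> definable par (fun c e => coord_action (w c e) (d c e)).
Proof.
move=> dw dd; do 4?[apply: definable_and].
- apply: definable_allG; apply: definable_exM; apply: definable_exM; cbn beta.
  apply: definable_and; first by apply: definable_eqM; fterm_solve.
  by apply: definable_conj_coord; fterm_solve.
- apply: definable_allM; apply: definable_allM; cbn beta.
  apply: definable_imp; first by apply: definable_eqM; fterm_solve.
  by apply: definable_exG; cbn beta; apply: definable_conj_coord; fterm_solve.
- apply: definable_allG; cbn beta; apply: definable_imp.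
    by apply: definable_conj_coord; fterm_solve.
  by apply: definable_allG; cbn beta; apply: definable_eqG; fterm_solve.
- apply: definable_allG; cbn beta; apply: definable_imp.
    by apply: definable_allG; cbn beta; apply: definable_eqG; fterm_solve.
  apply: definable_imp; first by apply: definable_eqG; fterm_solve.
  by apply: definable_exfin => i; apply: definable_coord; fterm_solve.
- do 4!apply: definable_allL; do 2!apply: definable_allG; cbn beta.
  apply: definable_imp; first by apply: definable_eqL; fterm_solve.
  apply: definable_imp; first by apply: definable_eqL; fterm_solve.
  apply: definable_imp; first by apply: definable_conj_coord; fterm_solve.
  apply: definable_imp; first by apply: definable_conj_coord; fterm_solve.
  by apply: definable_eqG; fterm_solve.
Qed.

Lemma definable_coordinatised :
  definable par (G := empty_context M) (fun c _ => coordinatised c).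
Proof.
apply: definable_exL; apply: definable_exG; cbn beta.
apply: definable_and; last first.
  by apply: definable_and; [apply: definable_coord_hom|apply: definable_coord_action]; fterm_solve.
apply: definable_and; first by apply: definable_eqL; fterm_solve.
apply: definable_allfin => i; apply: definable_imp; first exact: definable_cst.
by apply/definable_not/definable_eqL; fterm_solve.
Qed.

End Coordinates.

Local Open Scope ring_scope.

Lemma prim_root_of_order (L : fieldType) (N : nat) (w : L) : (0 < N)%N -> w ^+ N = 1 ->
  (forall i : 'I_N, (0 < i)%N -> w ^+ i <> 1) -> N.-primitive_root w.
Proof.
move=> N0 wN wi; have [m mw mN] := prim_order_exists N0 wN.
have m0 := prim_order_gt0 mw.
have [mN'|mN'|<- //] := ltngtP m N.
  by case: (wi (Ordinal mN') m0); apply: prim_expr_order mw.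
by have := dvdn_leq N0 mN; rewrite leqNgt mN'.
Qed.

Lemma coordinatised_deformation n' N K (c : frame n') : (0 < N)%N -> coordinatised N K c ->
  (forall (x : ffld c) k, (0 < k)%N -> x ^+ k = 1 -> x ^+ N = 1) ->
  (forall (z : fgroup c) k, z \in center (fgroup c) -> (0 < k)%N ->
     (z ^+ k)%g = 1%g -> (z ^+ N)%g = 1%g) ->
  exists (A : torsion_complement (units (ffld c))) (K0 : addition (GL n'.+3 (ffld c)))
    (B : abelian_sub (fgroup c)) (h : sym_cocycle (AmodAn n'.+3 A) (asub_group B)),
  [/\ {subset B <= center (fgroup c)},
    forall b, b \in B -> (b ^+ N)%g = 1%g -> b = 1%g,
    forall z, z \in center (fgroup c) -> exists2 b, b \in B & exists2 t,
       t \in center (fgroup c) /\ (t ^+ N)%g = 1%g & z = (b * t)%g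
    & isomorphic (fgroup c) (GL_deformation K0 h)].
Proof.
move=> N0 [w [d [[wN wi] [[tot [mul [fun1 inj]]] [surj [total [one [ztor dcomm]]]]]]]] torsL torsZ.
have w_prim := prim_root_of_order N0 wN wi.
(* By totality the default value 1 can occur only for matrices whose determinant is not torsion. *)
pose rho (m : 'M[ffld c]_n'.+3) : fgroup c := xget 1%g [set g | coordinates N K w d m g].
have rhoP m : det_torsion N m -> coordinates N K w d m (rho m).
  by move=> /tot[g cg]; rewrite /rho; case: xgetP => [x ->//|/(_ g)].
have rhoE m g : det_torsion N m -> coordinates N K w d m g -> rho m = g.
  by move=> /rhoP cm cg; apply: fun1 cm cg.
have rhoM s t : det_torsion N s -> det_torsion N t -> rho (s * t) = (rho s * rho t)%g.
  move=> ds dt; apply: rhoE; first exact: det_torsionM.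
  by apply: mul; apply: rhoP.
have rho_inj s : det_torsion N s -> rho s = 1%g -> s = 1.
  by move=> /rhoP cs s1; apply: inj; rewrite -s1.
have detJ (m s : 'M[ffld c]_n'.+3) : m \is a GRing.unit -> det_torsion N s -> det_torsion N (m * s * m^-1).
  by move=> mU; apply: det_torsionJ.
have conj_covers m g : m \is a GRing.unit ->
    conj_coord N K w d m m^-1 g <-> covers N rho m g.
  move=> mU; split=> [cm s ds|cm s s' ds cs].
    by apply: rhoE; [exact: detJ|apply: cm => //; apply: rhoP].
  by rewrite -(rhoE _ _ ds cs) -cm //; apply/rhoP/detJ.
have unit_pair (m mi : 'M[ffld c]_n'.+3) : m * mi = 1 -> m \is a GRing.unit /\ mi = m^-1.
  move=> e; have [mU _] : m \in unitmx /\ mi \in unitmx by apply: mulmx1_unit.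
  by split=> //; rewrite -(mulKr mU mi) e mulr1.
have c1 g : covers N rho 1 g -> g \in center (fgroup c).
  move=> cg; apply/asboolP/one; have := (conj_covers 1 g (unitr1 _)).2 cg.
  by rewrite invr1.
have [A [K0 [B [h [BC zB CB iso]]]]] : exists (A : torsion_complement (units (ffld c)))
    (K0 : addition (GL n'.+3 (ffld c)))
    (B : abelian_sub (fgroup c)) (h : sym_cocycle (AmodAn n'.+3 A) (asub_group B)),
  [/\ {subset B <= center (fgroup c)}, forall i, rho (w ^+ i)%:M \in B -> (N %| i)%N,
    forall z, z \in center (fgroup c) ->
      exists2 b, b \in B & exists i, z = (b * rho (w ^+ i)%:M)%g
    & isomorphic (fgroup c) (GL_deformation K0 h)].
  apply: (reconstruction w_prim torsL rhoM rho_inj).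
  - move=> g; have [m [mi [/unit_pair[mU ->] cm]]] := surj g.
    by exists m => //; apply/conj_covers.
  - move=> m mU; have [g cg] := total m m^-1 (mulrV mU).
    by exists g; apply/conj_covers.
  - exact: c1.
  - move=> z k zC k0 zk; have /asboolP zC' := zC.
    have [i ci] := ztor z zC' (torsZ z k zC k0 zk); exists i.
    by apply/esym/rhoE => //; apply: (det_torsion_scalar n'.+1 w_prim).
  - move=> a b g g' a0 b0 ca cb.
    apply: (dcomm a a^-1 b b^-1); rewrite ?mulfV // diag_lastV //; apply/conj_covers => //;
      exact: diag_last_unit.
exists A, K0, B, h; split=> //.
- move=> b bB bN; have [i ci] := ztor b (elimT (asboolP _) (BC b bB)) bN.
  have di : det_torsion N ((w ^+ i)%:M : 'M_n'.+3) by apply: (det_torsion_scalar _ w_prim).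
  have /zB : rho (w ^+ i)%:M \in B by rewrite (rhoE _ _ di ci).
  rewrite (prim_order_dvd w_prim) => /eqP wi1; move: ci di; rewrite wi1 => ci di.
  rewrite -(rhoE _ _ di ci); apply: (mulgI (rho 1%:M)).
  by rewrite -rhoM // mulr1 mulg1.
- move=> z /CB[b bB [i zE]]; exists b => //; exists (rho (w ^+ i)%:M) => //; split.
    exact: (rho_scalar_center w_prim rhoM c1).
  rewrite -(rhoX rhoM); last exact: (det_torsion_scalar n'.+1 w_prim).
  by rewrite -rmorphXn /= exprAC wN expr1n; exact: (rho1 rhoM).
Qed.

(** * The standard frame of the general linear group *)

Section StandardFrame.
Variables (n' : nat) (F : fieldType).
Local Notation n := n'.+3.
Hypothesis two_neq0 : (2%:R : F) != 0.

Local Notation GLn := (GL n F).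
Local Notation o0 := (o0 n').
Local Notation o1 := (o1 n').
Local Notation o2 := (o2 n').

Lemma GL_eq (x y : GLn) : mxval x = mxval y -> x = y.
Proof. exact: val_inj. Qed.

Lemma GL_comm_eq (x y z : GLn) : mxval x *m mxval y = mxval z *m mxval x ->
  (x * y * x^-1)%g = z.
Proof.
move=> e; apply: (mulIg x); rewrite mulgVK; exact: GL_eq.
Qed.

Definition reflection i : 'M[F]_n := diag_mx (\row_k if k == i then -1 else 1).

Lemma reflection_sq i : reflection i *m reflection i = 1%:M.
Proof.
rewrite mulmx_diag -diag_const_mx; congr diag_mx; apply/rowP => k; rewrite !mxE.
by case: ifP; rewrite ?mulrNN mulr1.
Qed.

Lemma reflection_unit i : reflection i \in unitmx.
Proof. by have /mulmx1_unit[] := reflection_sq i. Qed.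

(** The second transposition starts from where the first has sent j, so that for distinct i and j
    the product takes i to 0 and j to 1. *)
Definition root_perm (i j : 'I_n) : {perm 'I_n} :=
  (tperm i o0 * tperm (tperm i o0 j) o1)%g.

Lemma root_perm1 i j : i != j -> root_perm i j i = o0.
Proof.
move=> ij; have h : tperm i o0 j != o0.
  apply: contraNneq ij => e; rewrite -(inj_eq (@perm_inj _ (tperm i o0))).
  by rewrite e tpermL.
by rewrite permM tpermL (tpermD h).
Qed.

Lemma root_perm2 i j : root_perm i j j = o1.
Proof. by rewrite permM tpermL. Qed.

Lemma o01 : o0 != o1. Proof. by []. Qed.

Definition std_param (q : params n') : GLn := match q with
  | inl (inl i) => MkGL (reflection_unit i)
  | inl (inr ij) => MkGL (unitmx_perm F (root_perm ij.1 ij.2))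
  | inr _ => MkGL (elem_unit 1 o01) end.

Definition std_val (a : F) : GLn := MkGL (elem_unit a o01).

(** Off the diagonal, commuting with reflection i gives 2 t_ij = 0; here the characteristic
    enters. *)
Lemma std_torus (t : GLn) : in_torus std_param t <-> is_diag_mx (mxval t).
Proof.
split=> [tT|/is_diag_mxP tD i].
  apply/is_diag_mxP => i j ij; have /(congr1 (@mxval _ _)) /matrixP /(_ i j) := tT i.
  rewrite /= mul_mx_diag mul_diag_mx !mxE eqxx mulN1r.
  have -> : (j == i) = false by apply/eqP => ji; rewrite ji eqxx in ij.
  rewrite mulr1 => /eqP; rewrite -subr_eq0 opprK -mulr2n -mulr_natl mulf_eq0.
  by rewrite (negPf two_neq0) => /eqP.
apply: GL_eq; rewrite /= mul_mx_diag mul_diag_mx; apply/matrixP => k l; rewrite !mxE.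
have [<-|kl] := eqVneq k l; first by rewrite mulrC.
by rewrite tD ?mul0r ?mulr0.
Qed.

Lemma diag_mx_elem (d : 'rV[F]_n) (i j : 'I_n) a : d 0 j != 0 -> i != j ->
  diag_mx d *m elem i j a = elem i j (d 0 i * a / d 0 j) *m diag_mx d.
Proof.
move=> dj ij; apply/matrixP => k l; rewrite mul_diag_mx mul_mx_diag !mxE.
have [<-|kl] := eqVneq k l.
  have -> : (k == i) && (k == j) = false.
    by apply/negP => /andP[/eqP ki /eqP kj]; rewrite -ki kj eqxx in ij.
  by rewrite !mulr0 !addr0 mulrC.
rewrite !add0r; case: eqP => [->|_]; last by rewrite !(mulr0, mul0r).
by case: eqP => [->|_]; [rewrite /= !mulr1 divfK|rewrite /= !(mulr0, mul0r)].
Qed.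

Lemma std_root (x : GLn) : in_root std_param x <-> exists a, std_val a = x.
Proof.
split=> [[->|[t [/std_torus/is_diag_mxP tD ->]]]|[a <-]].
- by exists 0; apply: GL_eq; rewrite /= elem0.
- pose d := \row_i mxval t i i; have tE : mxval t = diag_mx d.
    apply/matrixP => i j; rewrite !mxE; have [->|ij] := eqVneq i j; first by rewrite mulr1n.
    by rewrite mulr0n tD.
  have d1 : d 0 o1 != 0.
    have := mxvalP t; rewrite tE unitmxE det_diag unitfE => /prodf_neq0; exact.
  exists (d 0 o0 / d 0 o1); apply/esym/GL_comm_eq; rewrite tE /=.
  by rewrite diag_mx_elem ?o01 // mulr1.
have [->|a0] := eqVneq a 0; first by left; apply: GL_eq; rewrite /= elem0.
right; pose d := (\row_k if k == o0 then a else 1) : 'rV[F]_n.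
have dU : diag_mx d \in unitmx.
  rewrite unitmxE det_diag unitfE; apply/prodf_neq0 => k _.
  by rewrite mxE; case: ifP; rewrite ?oner_eq0.
exists (MkGL dU); split; first by apply/std_torus/diag_mx_is_diag.
apply/esym/GL_comm_eq; rewrite /= diag_mx_elem ?o01 //; first by rewrite !mxE /= divr1 mulr1.
by rewrite mxE /= oner_eq0.
Qed.

Lemma perm_mx_elem (i j : 'I_n) (a : F) : i != j ->
  perm_mx (root_perm i j) *m elem o0 o1 a = elem i j a *m perm_mx (root_perm i j).
Proof.
move=> ij; rewrite /elem mulmxDr mulmxDl mulmx1 mul1mx -scalemxAr -scalemxAl.
congr (_ + _ *: _); rewrite -row_permE.
apply/matrixP => k l; rewrite !mxE (bigD1 j) //= big1 ?addr0.
  rewrite !mxE eqxx andbT root_perm2 -{1}(root_perm1 ij) (inj_eq perm_inj).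
  by rewrite [o1 == l]eq_sym; case: (_ == _); rewrite ?mul1r ?mul0r.
by move=> m /negPf mj; rewrite mxE mj andbF mul0r.
Qed.

Lemma std_root_elt i j (a : F) : i != j ->
  mxval (root_elt std_param i j (std_val a)) = elem i j a.
Proof.
move=> ij; rewrite /root_elt (_ : (_ * _ * _)%g = MkGL (elem_unit a ij)) //.
by apply: GL_comm_eq; rewrite /= perm_mx_elem.
Qed.

Lemma elem_commutator m (i j k : 'I_m) (a b : F) : i != j -> j != k -> i != k ->
  elem i j a *m elem j k b = elem i k (a * b) *m (elem j k b *m elem i j a).
Proof.
move=> ij jk ik; rewrite /elem !(mulmxDl, mulmxDr, mul1mx, mulmx1).
rewrite -!scalemxAl -!scalemxAr -?scalemxAl -?scalemxAr !mul_delta_mx_cond.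
rewrite !eqxx [k == i]eq_sym [k == j]eq_sym (negPf ik) (negPf jk).
rewrite !mulr0n !mulr1n !scaler0 !addr0 ?mulmx0 ?mul0mx !scaler0 !addr0 scalerA.
by rewrite addrA; congr (_ + _); rewrite addrAC.
Qed.

Lemma std_root_mul a b : root_mul std_param (std_val a) (std_val b) = std_val (a * b).
Proof.
rewrite /root_mul /comm_mul; set x := root_elt _ _ _ _; set y := root_elt _ _ _ _.
have xE : mxval x = elem o0 o2 a by apply: std_root_elt.
have yE : mxval y = elem o2 o1 b by apply: std_root_elt.
clearbody x y.
have -> : (x * y = std_val (a * b) * (y * x))%g.
  by apply: GL_eq; rewrite /= xE yE elem_commutator.
by rewrite mulgA !mulgK.
Qed.

Definition std_fieldcode : fieldcode std_param.
Proof.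
apply: (@FieldCode n' GLn std_param F std_val).
- by move=> a b; apply: GL_eq; rewrite /= elemD.
- by move=> a b; rewrite std_root_mul.
- by apply: GL_eq.
- move=> a b /(congr1 (@mxval _ _)) /matrixP /(_ o0 o1).
  by rewrite /= !elemE !eqxx !add0r.
- exact: std_root.
Defined.

Lemma std_frame_ax : frame_ax std_param.
Proof.
split; last exact: (fieldcode_root_ax std_fieldcode).
split.
- by move=> i; apply: GL_eq; rewrite /= reflection_sq.
- by move=> i j; apply: GL_eq; rewrite /= diag_mxC.
- move=> s t /std_torus/diag_mxP[d sE] /std_torus/diag_mxP[d' tE].
  by apply: GL_eq; rewrite /= sE tE diag_mxC.
- move=> /std_torus/is_diag_mxP /(_ o0 o1 isT) /=.
  by rewrite elemE !eqxx add0r => /eqP; rewrite oner_eq0.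
Qed.

Definition std_frame := Frame std_fieldcode.

End StandardFrame.

Section StandardCoordinates.
Variables (n' : nat) (F : fieldType).
Local Notation n := n'.+3.
Hypothesis two_neq0 : (2%:R : F) != 0.
Variables (N K : nat) (w : F).
Hypothesis w_prim : N.-primitive_root w.
Hypothesis gen : forall m : 'M[F]_n, m \in unitmx ->
  exists2 e, elem_prod K e & m = diag_last n'.+2 (\det m) *m e.

Local Notation GLn := (GL n F).
Local Notation c := (std_frame n' two_neq0).
Local Notation dg := (diag_last n'.+2).

Let N0 : (0 < N)%N. Proof. exact: prim_order_gt0 w_prim. Qed.
Let wN : w ^+ N = 1. Proof. exact: prim_expr_order w_prim. Qed.
Let w0 : w != 0.
Proof. by apply/eqP => w0; move: wN; rewrite w0 expr0n gtn_eqF // => /esym/eqP; rewrite oner_eq0. Qed.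

Lemma std_word k (m : 'M[F]_n) (g : GLn) :
  word_rel (c := c) k m g <-> mxval g = m /\ elem_prod k m.
Proof.
elim: k m g => [|k IHk] m g /=.
  by split=> [[-> ->]|[<- m1]]; split=> //; apply: GL_eq.
split=> [[/IHk[-> ?]|[i [j [ij [a [m' [g' [-> [-> /IHk[g'E m'P]]]]]]]]]]|
    [gm [mP|[i [j [ij [a [m' [mE m'P]]]]]]]]].
- by split=> //; left.
- split; last by right; exists i, j; split=> //; exists a, m'.
  by rewrite -[LHS]/(mxval (root_elt (@std_param n' F) i j (@std_val n' F a)) *m mxval g') std_root_elt // g'E.
- by left; apply/IHk.
right; exists i, j; split=> //.
have m'U : m' \in unitmx by rewrite unitmxE (det_elem_prod m'P) unitr1.
exists a, m', (MkGL m'U); split=> //; split; last by apply/IHk.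
apply: GL_eq; rewrite gm mE.
by rewrite -[RHS]/(mxval (root_elt (@std_param n' F) i j (@std_val n' F a)) *m m') std_root_elt.
Qed.

Let dgU : dg w \in unitmx. Proof. exact: diag_last_unit. Qed.
Let d : GLn := MkGL dgU.

Let dX k : mxval (d ^+ k)%g = dg (w ^+ k).
Proof. by rewrite mxvalX diag_lastX. Qed.

(** A torsion determinant is some w^k with k < N, and [gen] provides a word of length [K] for the
    factor of determinant 1. *)
Lemma std_coordinates (m : 'M[F]_n) (g : GLn) :
  coordinates N K (c := c) w d m g <-> mxval g = m /\ det_torsion N m.
Proof.
split=> [[k [m' [g' [-> [-> /std_word[g'E m'P]]]]]]|[gE mT]].
  split; first by rewrite -g'E -dX.
  rewrite /det_torsion detM det_diag_last (det_elem_prod m'P) mulr1.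
  by rewrite exprAC wN expr1n.
have [e eP mE] := gen (det_torsion_unit w_prim mT).
have [k dk] := prim_rootP w_prim mT.
have eU : e \in unitmx by rewrite unitmxE (det_elem_prod eP) unitr1.
exists k, e, (MkGL eU); rewrite -dk; split=> //; split; last by apply/std_word.
by apply: GL_eq; rewrite gE -[RHS]/(mxval (d ^+ k)%g *m e) dX -dk.
Qed.

(** m^-1 g commutes with all elementary matrices, hence is scalar. *)
Lemma std_conj (m mi : 'M[F]_n) (g : GLn) : m * mi = 1 ->
  conj_coord N K (c := c) w d m mi g -> exists a, mxval g = a *: m.
Proof.
move=> mm cm.
have [mU _] : m \in unitmx /\ mi \in unitmx by apply: mulmx1_unit.
have mi1 : mi *m m = 1%:M by apply: mulmx1C.
have [i j ij|a aE] := @comm_elem_scalar F n (mi *m mxval g).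
  have eT : det_torsion N (elem i j 1 : 'M[F]_n) by rewrite /det_torsion det_elem // expr1n.
  have /cm /(_ ((std_coordinates _ (MkGL (elem_unit 1 ij))).2 (conj erefl eT))) /std_coordinates[e _] := eT.
  have e' : mxval g *m elem i j 1 = m *m elem i j 1 *m mi *m mxval g.
    rewrite -[m *m _ *m mi]/(m * elem i j 1 * mi) -e /=.
    by rewrite mulmxKV // mxvalP.
  by rewrite -mulmxA e' !mulmxA mi1 mul1mx.
exists a; rewrite -[mxval g]mul1mx -[1%:M]mm -[m * mi]/(m *m mi) -mulmxA aE.
by rewrite mul_mx_scalar.
Qed.

Lemma std_conj_self (g : GLn) :
  conj_coord N K (c := c) w d (mxval g) (invmx (mxval g)) g.
Proof.
move=> s s' sT /std_coordinates[s'E _]; apply/std_coordinates; split.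
  by rewrite -s'E.
by apply: det_torsionJ => //; apply: mxvalP.
Qed.

Lemma std_coordinatised : coordinatised N K c.
Proof.
exists w, d; split; [split=> // i i0 wi|split].
- by have := prim_order_dvd w_prim i; rewrite wi eqxx gtnNdvd.
- split; last split; last split.
  + move=> m mT; exists (MkGL (det_torsion_unit w_prim mT : m \in unitmx)).
    exact/std_coordinates.
  + move=> m g m' g' /std_coordinates[gE mT] /std_coordinates[g'E m'T].
    apply/std_coordinates; split; last exact: det_torsionM.
    by rewrite -gE -g'E.
  + move=> m g g' /std_coordinates[gE _] /std_coordinates[g'E _].
    by apply: GL_eq; rewrite gE g'E.
  + by move=> m /std_coordinates[].
split; last split; last split; last split.
- move=> g; exists (mxval g), (invmx (mxval g)); split; last exact: std_conj_self.
  by apply: mulmxV; apply: mxvalP.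
- move=> m mi mm; have [mU _] : m \in unitmx /\ mi \in unitmx by apply: mulmx1_unit.
  exists (MkGL mU); have -> : mi = invmx m.
    by rewrite -[mi]mul1mx -(mulVmx mU) -mulmxA [m *m mi]mm mulmx1.
  exact: (std_conj_self (MkGL mU)).
- move=> g cg x; have [|a gE] := std_conj _ cg; first exact: mulr1.
  apply: GL_eq; rewrite /= gE -[1]/(1%:M) scale_scalar_mx.
  by rewrite mulr1 scalar_mxC.
- move=> z zC zN; have [i j ij|a zE] := @comm_elem_scalar F n (mxval z).
    by have /(congr1 (@mxval _ _)) := zC (MkGL (elem_unit 1 ij)).
  have aN : a ^+ N = 1.
    have /(congr1 (@mxval _ _)) := zN; rewrite mxvalX zE -rmorphXn /= => /matrixP /(_ ord0 ord0).
    by rewrite !mxE eqxx !mulr1n.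
  have [i ai] := prim_rootP w_prim aN; exists i; apply/std_coordinates.
  split; first by rewrite zE ai.
  exact: (det_torsion_scalar n'.+1 w_prim).
- move=> a ai b bi g g' aa bb cg cg'.
  have e (x xi : F) : x * xi = 1 -> dg x * dg xi = 1 by rewrite -diag_lastM => ->; apply: diag_last1.
  have [s gE] := std_conj (e _ _ aa) cg; have [t g'E] := std_conj (e _ _ bb) cg'.
  apply: GL_eq; rewrite /= gE g'E -!scalemxAl -!scalemxAr.
  by rewrite scalerA [RHS]scalerA mulrC; congr (_ *: _); apply: diag_lastC.
Qed.

End StandardCoordinates.

(** * Rigidity of frames in the general linear group *)

Section RootShape.
Variables (F : fieldType) (m : nat).
Implicit Types (x y : 'M[F]_m) (d : 'I_m -> F).

Definition diag_conj d x : 'M[F]_m := \matrix_(i, j) (d i * x i j / d j).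

Definition dilation (a : 'I_m) (s : F) i := if i == a then s else 1.

Lemma dilation_neq0 a s i : s != 0 -> dilation a s i != 0.
Proof. by move=> s0; rewrite /dilation; case: ifP; rewrite ?oner_eq0. Qed.

Variables (Y : 'M[F]_m -> Prop) (M : 'M[F]_m) (s : F).
Hypotheses (MU : M \in unitmx) (s0 : s != 0) (s1 : s ^+ 2 != 1).
Hypotheses (YM : Y M) (M_diag : ~~ is_diag_mx M).
Hypothesis Y_div : forall x y, Y x -> Y y -> Y (x *m invmx y).
Hypothesis Y_comm : forall x y, Y x -> Y y -> x *m y = y *m x.
Hypothesis Y_conj : forall d x, (forall i, d i != 0) -> Y x -> Y (diag_conj d x).
Hypothesis Y_trans : forall x, Y x -> x != 1%:M ->
  exists2 d, (forall i, d i != 0) & x = diag_conj d M.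

Let s_neq1 : s != 1. Proof. by apply: contraNneq s1 => ->; rewrite expr1n. Qed.

Let dil a := diag_conj (dilation a s) M.
Let Y_dil a : Y (dil a).
Proof. by apply: Y_conj => // i; apply: dilation_neq0. Qed.

Let dilE a i j : dil a i j = (dilation a s i * M i j / dilation a s j).
Proof. by rewrite mxE. Qed.

(* Commuting [M] with its conjugate by a dilation at [a]. *)
Let cross a j k : j != a -> k != a -> M j a * M a k = 0.
Proof.
move=> ja ka; have /matrixP /(_ j k) := Y_comm (Y_dil a) YM.
rewrite !mxE (bigD1 a) //= [RHS](bigD1 a) //= !dilE /dilation !eqxx (negPf ja) (negPf ka).
rewrite mul1r divr1 [X in _ + X = _](eq_bigr (fun l => M j l * M l k)); last first.
  by move=> l /negPf la; rewrite dilE /dilation (negPf ja) la mul1r divr1.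
rewrite [X in _ = _ + X](eq_bigr (fun l => M j l * M l k)); last first.
  by move=> l /negPf la; rewrite dilE /dilation (negPf ka) la mul1r divr1.
move=> /addIr /eqP; rewrite mulrAC mulrCA -subr_eq0 -[_ * (M j a * _)]mulrC -mulrBr mulf_eq0.
case/orP=> [/eqP //|]; rewrite subr_eq0 => /eqP e; case/eqP: s1.
by rewrite expr2 -{1}e mulVf.
Qed.

(** Conjugation by a diagonal matrix keeps the diagonal and the zero pattern, and by transitivity
    every nontrivial element of [Y] is such a conjugate of [M]. *)
Let support x : Y x -> x != 1%:M -> forall i j,
  (M i i = x i i) /\ (x i j = 0 -> M i j = 0).
Proof.
move=> Yx /(Y_trans Yx)[d d0 ->] i j; rewrite !mxE; split.
  by rewrite mulrAC mulfV // mul1r.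
by move=> /eqP; rewrite !mulf_eq0 invr_eq0 (negPf (d0 i)) (negPf (d0 j)) orbF => /eqP.
Qed.

(** Quotients of dilations of [M] by [M] lie in [Y] and are sparse; [support] passes the sparsity on
    to [M], until a single off-diagonal entry is left. *)
Lemma root_shape : exists a b, a != b /\ exists2 u, u != 0 & M = elem a b u.
Proof.
have [a [b [ab Mab]]] : exists a b, a != b /\ M a b != 0.
  apply: contrapT => nM; case/negP: M_diag; apply/is_diag_mxP => i j ij.
  by apply/eqP; apply: contrapT => Mij; apply: nM; exists i, j; split=> //; apply/negP.
have cola j : j != a -> M j a = 0.
  move=> ja; have := cross ja; rewrite eq_sym in ab => /(_ b ab) /eqP.
  by rewrite mulf_eq0 (negPf Mab) orbF => /eqP.
(* As column a of [M] vanishes off the diagonal, the dilation at a changes only row a of [M], so y0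
   differs from the identity in that row only. *)
have [y0 yE] : exists y, y *m M = dil a by exists (dil a *m invmx M); rewrite mulmxKV.
have Yy : Y y0 by rewrite -(mulmxK MU y0) yE; apply: Y_div.
have y1 : y0 != 1%:M.
  apply/eqP => y1; have /matrixP /(_ a b) := yE.
  rewrite y1 mul1mx dilE /dilation eqxx eq_sym (negPf ab) divr1 => /eqP.
  by rewrite -subr_eq0 -{1}[M a b]mul1r -mulrBl mulf_eq0 (negPf Mab) orbF subr_eq0 eq_sym (negPf s_neq1).
have yrow j l : j != a -> y0 j l = (j == l)%:R.
  move=> ja; have : row j y0 = row j 1%:M.
    rewrite -(mulmxK MU y0) yE -(mulmxV MU) !row_mul; congr (_ *m _).
    apply/rowP => k; rewrite !mxE /dilation (negPf ja) mul1r.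
    by case: eqP => [->|_]; [rewrite cola // mul0r|rewrite divr1].
  by move=> /rowP /(_ l); rewrite !mxE.
have Mjl j l : j != a -> M j l = (j == l)%:R.
  move=> ja; have [e1 e2] := support Yy y1 j l; have [jl|jl] := eqVneq j l.
    by rewrite -jl e1 yrow // eqxx.
  by rewrite e2 // yrow // (negPf jl).
(* Entry (a, a) of y0 M = dil a reads y0_aa M_aa = M_aa, and M_aa = 0 would make column a zero. *)
have Maa : M a a = 1.
  have [-> _] := support Yy y1 a a; have /matrixP /(_ a a) := yE.
  rewrite mxE (bigD1 a) //= big1 ?addr0 => [|l la]; last by rewrite Mjl // (negPf la) mulr0.
  rewrite dilE /dilation eqxx mulrAC mulfV // mul1r => /eqP.
  rewrite -subr_eq0 -{2}[M a a]mul1r -mulrBl mulf_eq0 subr_eq0 => /orP[/eqP //|/eqP Maa].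
  have : M *m delta_mx a (0 : 'I_1) = 0.
    apply/matrixP => i j; rewrite !mxE (bigD1 a) //= big1 ?addr0.
      rewrite !mxE !ord1 !eqxx mulr1; have [->//|ia] := eqVneq i a.
      by rewrite cola.
    by move=> k /negPf ka; rewrite !mxE ka mulr0.
  move=> /(congr1 (mulmx (invmx M))); rewrite mulKmx // mulmx0 => /matrixP /(_ a 0).
  by rewrite !mxE !eqxx => /eqP; rewrite oner_eq0.
(* The dilation at b changes [M] only in the entry (a, b), so its quotient by [M] is elementary. *)
have dE : elem a b ((s^-1 - 1) * M a b) *m M = dil b.
  apply/matrixP => i j; rewrite dilE /elem mulmxDl mul1mx -scalemxAl mxE [X in _ + X]mxE.
  rewrite [X in _ * X]mxE (bigD1 b) //= big1 ?addr0; last first.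
    by move=> k /negPf kb; rewrite mxE kb andbF mul0r.
  rewrite mxE eqxx andbT [M b j]Mjl ?(eq_sym b) // /dilation.
  have [->|ia] := eqVneq i a.
    rewrite (negPf ab) mul1r mul1r; have [->|jb] := eqVneq j b.
      by rewrite mulr1 mulrBl mul1r addrC subrK mulrC.
    by rewrite mulr0 addr0 divr1.
  rewrite mul0r mulr0 addr0 Mjl //; have [->|ij] := eqVneq i j; last by rewrite mulr0 mul0r.
  by case: ifP => _; rewrite mulr1 ?divr1 // mulfV.
pose u := (s^-1 - 1) * M a b.
have u0 : u != 0.
  rewrite mulf_neq0 // subr_eq0; apply: contraNneq s_neq1 => e.
  by rewrite -[s]invrK e invr1.
have Yz : Y (elem a b u) by rewrite -[elem a b u](mulmxK MU) dE; apply: Y_div.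
have z1 : elem a b u != 1%:M.
  apply/eqP => /matrixP /(_ a b) /eqP.
  by rewrite elemE !eqxx mxE (negPf ab) add0r mulr1n (negPf u0).
exists a, b; split=> //; exists (M a b) => //; apply/matrixP => i j; rewrite elemE.
have [e1 e2] := support Yz z1 i j; have [<-|ij] := eqVneq i j.
  rewrite e1 elemE eqxx; case: (i =P a) => [->|_]; last by rewrite !mulr0n.
  by rewrite (negPf ab) !mulr0n.
have [/andP[/eqP -> /eqP ->]|nab] := boolP ((i == a) && (j == b)).
  by rewrite add0r mulr1n.
by rewrite addr0 e2 // elemE (negPf ij) (negPf nab) addr0.
Qed.

End RootShape.

(** The minimal polynomial divides (X - 1)(X + 1), whose roots are distinct as 2 <> 0. *)
Lemma involution_diagonalizable (F : fieldType) m (x : 'M[F]_m.+1) : (2%:R : F) != 0 ->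
  x *m x = 1%:M -> diagonalizable x.
Proof.
move=> two0 xx; apply/diagonalizableP; exists [:: 1; -1].
  by rewrite /= inE andbT -subr_eq0 opprK.
apply: mxminpoly_min; rewrite !big_cons big_nil mulr1 rmorphM /=.
rewrite !rmorphB /= horner_mx_X !horner_mx_C -[_ * _]/(_ *m _).
rewrite raddfN /= opprK mulmxBl !mulmxDr xx mul1mx !mulmx1.
by rewrite [_ + x]addrC subrr.
Qed.

Section Rigidity.
Variables (n' : nat) (F : fieldType).
Local Notation n := n'.+3.
Hypothesis two_neq0 : (2%:R : F) != 0.
Variables (p : params n' -> GL n F) (s : F).
Hypotheses (s0 : s != 0) (s1 : s ^+ 2 != 1) (ax : frame_ax p).

Local Notation GLn := (GL n F).

Lemma GL_mulE (x y : GLn) : mxval (x * y)%g = mxval x *m mxval y. Proof. by []. Qed.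
Lemma GL_invE (x : GLn) : mxval (x^-1)%g = invmx (mxval x). Proof. by []. Qed.

Lemma torus_diagonal : exists q : GLn, forall i, is_diag_mx (mxval (q * refl p i * q^-1)%g).
Proof.
have [[sq comm _ _] _] := ax.
have [P PU /allP PD] : codiagonalizable [seq mxval (refl p i) | i <- enum 'I_n].
  apply/codiagonalizableP; split=> [_ _ /mapP[i _ ->] /mapP[j _ ->]|_ /mapP[i _ ->]].
    by have /(congr1 (@mxval _ _)) := comm i j.
  by apply: involution_diagonalizable => //; have /(congr1 (@mxval _ _)) := sq i.
exists (MkGL PU) => i; apply/is_diag_mxP; apply/(diagonalizable_forP _ PU).
by apply: PD; apply: map_f; rewrite mem_enum.
Qed.

(** The Weyl parameters are arbitrary here, so products cannot be computed from them. [root_shape]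
    gives the additive group; the multiplication is then forced by the field axioms, because
    [root_mul] is quadratic in its first argument. *)
Lemma frame_rigid : exists fc : fieldcode p, fld fc = F.
Proof.
have [q qD] := torus_diagonal; have [[_ _ tC uT] [rdiv [rone [rmul rdist]]]] := ax.
have qVK (x : GLn) : (q^-1 * (q * x * q^-1) * q = x)%g by rewrite !mulgA mulVg mul1g mulgVK.
have VqK (x : GLn) : (q * (q^-1 * x * q) * q^-1 = x)%g by rewrite !mulgA mulgV mul1g mulgK.
have torus_of (t : GLn) : is_diag_mx (mxval t) -> in_torus p (q^-1 * t * q)%g.
  move=> /diag_mxP[d tE] i; have /diag_mxP[d' rE] := qD i.
  have tr : (t * (q * refl p i * q^-1) = (q * refl p i * q^-1) * t)%g.
    by apply: GL_eq; rewrite GL_mulE [RHS]GL_mulE rE tE diag_mxC.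
  apply: (mulgI q); apply: (mulIg q^-1%g).
  by move: tr; rewrite !mulgA mulgV mul1g !mulgK => ->.
(* The conjugated torus contains the standard reflections; being commutative, it lies in their
   centraliser, the diagonal matrices. *)
have torus_diag (t : GLn) : in_torus p t -> is_diag_mx (mxval (q * t * q^-1)%g).
  move=> tT; apply/std_torus => // i.
  have rD : is_diag_mx (mxval (std_param F (inl (inl i)))) by apply: diag_mx_is_diag.
  have := tC _ _ tT (torus_of _ rD) => e.
  rewrite -[refl _ i]/(std_param F (inl (inl i))) -[in LHS](VqK (std_param F _)).
  rewrite -[in RHS](VqK (std_param F _)); move: e; set r := (_ * _ * q)%g; clearbody r => e.
  by rewrite !mulgA !mulgVK -!(mulgA q) e.
pose M := mxval (q * unip p * q^-1)%g.
pose Y (x : 'M[F]_n) := exists2 g, in_root p g & x = mxval (q * g * q^-1)%g.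
have diag_unit (d : 'I_n -> F) : (forall i, d i != 0) -> diag_mx (\row_i d i) \in unitmx.
  by move=> d0; rewrite unitmxE det_diag unitfE; apply/prodf_neq0 => i _; rewrite mxE.
have conjE (d : 'I_n -> F) (d0 : forall i, d i != 0) (x : 'M[F]_n) :
    diag_mx (\row_i d i) *m x *m invmx (diag_mx (\row_i d i)) = diag_conj d x.
  apply: (can_inj (mulmxK (diag_unit d d0))); rewrite mulmxKV ?diag_unit //.
  rewrite mul_diag_mx mul_mx_diag; apply/matrixP => i j; rewrite !mxE divfK //.
have [] := @root_shape F n Y M s.
- exact: mxvalP.
- exact: s0.
- exact: s1.
- by exists (unip p) => //; apply: in_root_unip.
- apply/negP => MD; apply: uT; rewrite -(qVK (unip p)); exact: torus_of.
- move=> _ _ [g rg ->] [h rh ->]; exists (g * h^-1)%g; first by case: (rdiv g h rg rh).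
  by rewrite -GL_invE -GL_mulE !invgM invgK !mulgA mulgVK.
- move=> _ _ [g rg ->] [h rh ->]; rewrite -!GL_mulE; congr mxval.
  by rewrite !mulgA !mulgVK -!(mulgA q); case: (rdiv g h rg rh) => _ ->.
- move=> d x d0 [g rg ->]; pose D := MkGL (diag_unit d d0).
  exists (q^-1 * D * q * g * (q^-1 * D * q)^-1)%g.
    case: rg => [->|[t [tT ->]]]; first by left; rewrite mulg1 mulgV.
    right; exists (q^-1 * D * q * t)%g; split; last by rewrite !invgM !mulgA.
    have DT : in_torus p (q^-1 * D * q)%g by apply: (torus_of D); rewrite /= diag_mx_is_diag.
    by move: (q^-1 * D * q)%g DT => D' DT i; rewrite -mulgA tT mulgA DT mulgA.
  rewrite -conjE // -[diag_mx _]/(mxval D) -GL_invE -!GL_mulE; congr mxval.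
  by rewrite !invgM invgK !mulgA mulgV mul1g !mulgK.
- move=> _ [g [->|[t [tT ->]]] ->] x1.
    by case/eqP: x1; rewrite mulg1 mulgV.
  have /diag_mxP[d tE] := torus_diag _ tT.
  have d0 i : d 0 i != 0.
    have := mxvalP (q * t * q^-1)%g; rewrite tE unitmxE det_diag unitfE.
    by move=> /prodf_neq0; apply.
  exists (fun i => d 0 i) => //; rewrite -conjE //.
  have -> : diag_mx (\row_i d 0 i) = mxval (q * t * q^-1)%g.
    by rewrite tE; congr diag_mx; apply/rowP => i; rewrite mxE.
  rewrite -GL_invE -!GL_mulE; congr mxval.
  by rewrite !invgM invgK !mulgA !mulgVK.
move=> a [b [ab [u u0 ME]]].
(* The factor u normalises the parametrisation so that [v 1] is [unip]. *)
pose v (x : F) : GLn := (q^-1 * MkGL (elem_unit (u * x) ab) * q)%g.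
pose E : 'M[F]_n := u *: (invmx (mxval q) *m delta_mx a b *m mxval q).
have vE x : mxval (v x) = 1%:M + x *: E.
  rewrite !GL_mulE GL_invE /= /elem mulmxDr mulmx1 mulmxDl mulVmx ?mxvalP //.
  by rewrite -scalemxAr -scalemxAl scalerA mulrC.
have vD x y : v (x + y) = (v x * v y)%g.
  have eD : MkGL (elem_unit (u * (x + y)) ab) =
      (MkGL (elem_unit (u * x) ab) * MkGL (elem_unit (u * y) ab))%g.
    by apply: GL_eq; rewrite /= mulrDr elemD.
  by rewrite /v eD !mulgA mulgK.
have v0 : v 0 = 1%g by apply: GL_eq; rewrite vE scale0r addr0.
have vN x : v (- x) = (v x)^-1%g.
  by apply: (mulgI (v x)); rewrite -vD subrr v0 mulgV.
have v1 : v 1 = unip p.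
  rewrite -(qVK (unip p)) /v; congr (_ * _ * _)%g; apply: GL_eq.
  by rewrite /= mulr1 -ME.
have E0 : E != 0.
  apply: contraNneq u0 => E0; have := vE 1; rewrite E0 scaler0 addr0 => e.
  have : MkGL (elem_unit (u * 1) ab) = 1%g.
    by rewrite -(VqK (MkGL _)) -/(v 1) (GL_eq (e : _ = mxval (1%g : GLn))) mulg1 mulgV.
  move=> /(congr1 (@mxval _ _)) /matrixP /(_ a b) /eqP.
  by rewrite /= elemE !eqxx mulr1 mulr1n mxE (negPf ab) add0r.
have v_inj : injective v.
  move=> x y /(congr1 (@mxval _ _)); rewrite !vE => /addrI /eqP.
  by rewrite -subr_eq0 -scalerBl scaler_eq0 (negPf E0) orbF subr_eq0 => /eqP.
have vP g : in_root p g <-> exists x, v x = g.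
  split=> [[->|[t [tT ->]]]|[x <-]]; first by exists 0.
    have /diag_mxP[d tE] := torus_diag _ tT.
    have d0 i : d 0 i != 0.
      have := mxvalP (q * t * q^-1)%g; rewrite tE unitmxE det_diag unitfE.
      by move=> /prodf_neq0; apply.
    exists (d 0 a / d 0 b).
    apply: (mulgI q); apply: (mulIg q^-1%g); rewrite VqK; apply/esym.
    have -> : (q * (t * unip p * t^-1) * q^-1 =
        (q * t * q^-1) * (q * unip p * q^-1) * (q * t * q^-1)^-1)%g.
      by rewrite !invgM invgK !mulgA !mulgVK.
    apply: GL_comm_eq; rewrite -/M ME tE /= diag_mx_elem ?d0 //.
    by rewrite mulrAC mulrC.
  have [->|x0] := eqVneq x 0; first by left.
  have d0 i : dilation a x i != 0 by apply: dilation_neq0.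
  pose D := MkGL (diag_unit _ d0); right; exists (q^-1 * D * q)%g; split.
    by apply: (torus_of D); rewrite /= diag_mx_is_diag.
  have -> : (q^-1 * D * q * unip p * (q^-1 * D * q)^-1 =
      q^-1 * (D * (q * unip p * q^-1) * D^-1) * q)%g.
    by rewrite !invgM invgK !mulgA.
  congr (_ * _ * _)%g; apply/esym/GL_comm_eq; rewrite -/M ME /= diag_mx_elem //; last first.
    by rewrite mxE.
  by rewrite !mxE /dilation eqxx eq_sym (negPf ab) divr1 mulrC.
clearbody v E.
have vM x y : v (x * y) = root_mul p (v x) (v y).
  have [r rE] : exists r, r = root_elt p (o2 n') (o1 n') (v y) by eexists.
  pose R := mxval r.
  pose W := mxval (weyl p (o0 n') (o2 n')).
  have RU : R \in unitmx by apply: mxvalP.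
  have WU : W \in unitmx by apply: mxvalP.
  pose E' := W *m E *m invmx W.
  have eltE z : mxval (root_elt p (o0 n') (o2 n') (v z)) = 1%:M + z *: E'.
    rewrite /root_elt !GL_mulE GL_invE vE mulmxDr mulmx1 mulmxDl mulmxV //.
    by rewrite -scalemxAr -scalemxAl.
  (* The Weyl elements enter only through the matrices E' and R, which do not depend on z; so for
     fixed y the product is a polynomial of degree 2 in z. *)
  have mulE z : mxval (root_mul p (v z) (v y)) =
      1%:M + z *: (E' - R *m E' *m invmx R) - z ^+ 2 *: (E' *m R *m E' *m invmx R).
    rewrite /root_mul /comm_mul -rE.
    have -> : (root_elt p (o0 n') (o2 n') (v z))^-1%g = root_elt p (o0 n') (o2 n') (v (- z)).
      by rewrite vN /root_elt !invgM invgK mulgA.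
    have ez := eltE z; have eNz := eltE (- z).
    move: (root_elt _ _ _ _) (root_elt _ _ _ _) ez eNz => x1 x2 x1E x2E.
    rewrite !GL_mulE GL_invE x1E x2E -/R mulmxDl mul1mx mulmxDr mulmx1 -!scalemxAl.
    rewrite -scalemxAr [(R + _) *m E']mulmxDl -scalemxAl !mulmxDl -!scalemxAl mulmxDl -scalemxAl.
    rewrite mulmxV // mulmxK // scaleNr scalerDr opprD scalerA -expr2 scalerBr.
    by rewrite !addrA.
  set P1 := E' - _ in mulE; set P2 := _ *m invmx R in mulE.
  (* At z = 1 the first factor is the unit; at z = -1 distributivity gives the inverse value. Adding
     the two equations yields 2 P2 = 0, and then P1 = y E. *)
  have yE : y *: E = P1 - P2.
    have ry : in_root p (v y) by apply/vP; exists y.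
    have := mulE 1; rewrite v1 (rone _ ry).1 vE.
    by rewrite expr1n !scale1r -addrA => /addrI.
  have yNE : - (y *: E) = - P1 - P2.
    have := mulE (-1); have -> : root_mul p (v (-1)) (v y) = v (- y).
      have r1 : in_root p (v 1) by apply/vP; exists 1.
      have rN : in_root p (v (-1)) by apply/vP; exists (-1).
      have ry : in_root p (v y) by apply/vP; exists y.
      have [_] := rdist _ _ _ r1 rN ry; rewrite -vD subrr v1 (rone _ ry).1.
      have -> : root_mul p (v 0) (v y) = 1%g.
        by apply: GL_eq; rewrite mulE expr0n !scale0r addr0 subr0.
      by rewrite vN => /esym/mulg1_eq.
    by rewrite vE sqrrN expr1n scale1r !scaleN1r -addrA scaleNr => /addrI.
  have P20 : P2 = 0.
    have : y *: E - y *: E = P1 - P2 + (- P1 - P2) by rewrite {1}yE yNE.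
    rewrite subrr addrACA subrr add0r -mulr2n -scaler_nat.
    by move=> /esym/eqP; rewrite scaler_eq0 (negPf two_neq0) oppr_eq0 => /eqP.
  by apply: GL_eq; rewrite mulE vE -scalerA yE P20 scaler0 !subr0.
by exists (@FieldCode n' GLn p F v vD vM v1 v_inj vP).
Qed.
End Rigidity.

(** * Transfer principles *)

Section TupleTerms.
Variables (S : signature) (I : Type) (M : I -> model S) (PV : Type).
Variable par : forall i, PV -> M i.

Lemma dterm_tuple (J : Type) (j : J) :
  dterm par (G := tuple_context M J) (fun i e => e j).
Proof. by move=> k r; exists (Var _ (r (inr j))) => i y e [_ /(_ j)]. Qed.

Lemma dterm_new_point G : dterm par (G := extend G (point_sort par)) (fun i e => e.2).
Proof. exact: (@dterm_new _ _ M _ par G (point_sort par) tt). Qed.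

End TupleTerms.

(* [N i] is a quotient of the set [D i], which is closed under [mul i], by the
   elements of exponent [n]. *)
Section QuotientInterpretation.
Variables (S : signature) (I : Type) (M : I -> model S).
Variable par : forall i, void -> M i.
Variables (mul : forall i, M i -> M i -> M i) (one : forall i, M i).
Variables (D : forall i, M i -> Prop) (n : nat).

Definition mpow i (x : M i) := iter n (mul x) (one i).

Hypothesis dterm_one' : forall G, dterm par (G := G) (fun i _ => one i).
Hypothesis dterm_mul' : forall G (t s : forall i, env G i -> M i),
  dterm par t -> dterm par s -> dterm par (fun i e => mul (t i e) (s i e)).
Hypothesis definable_D : forall G (t : forall i, env G i -> M i),
  dterm par t -> definable par (fun i e => D (t i e)).

Variables (N : I -> groupType) (code : forall i, N i -> M i -> Prop).
Hypothesis code_ex : forall i (a : N i), exists x, code a x.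
Hypothesis code_inj : forall i (a b : N i) x, code a x -> code b x -> a = b.
Hypothesis code_dom : forall i (x : M i), (exists a, code a x) <-> D x.
Hypothesis code_mul : forall i (a b : N i) x y,
  code a x -> code b y -> code (a * b)%g (mul x y).
Hypothesis code_one : forall i (x : M i), code (1%g : N i) x <-> D x /\ mpow x = one i.

Let dterm_pow G (t : forall i, env G i -> M i) :
  dterm par t -> dterm par (fun i e => mpow (t i e)).
Proof.
move=> dt; rewrite /mpow; elim: n => [|k IHk] /=; first exact: dterm_one'.
exact: dterm_mul'.
Qed.

Let DE i (a : N i) x : code a x -> D x.
Proof. by move=> ax; apply/code_dom; exists a. Qed.

Let unit_code i (a b : N i) x y : code a x -> code b y ->
  (a * b = 1)%g <-> mpow (mul x y) = one i.
Proof.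
move=> ax bY; have axby := code_mul ax bY; split=> [ab|e].
  by move: axby; rewrite ab => /code_one[].
by apply: (code_inj axby); apply/code_one; split=> //; apply: DE axby.
Qed.

(** The language of rings has no inverse, so x and y are said to represent the same element when
    some z is inverse to both modulo exponent n. *)
Lemma quotient_sentence (p : sentence group_signature) :
  definable par (G := empty_context M) (fun i _ => satisfies (group_model (N i)) p).
Proof.
apply: (@interp_sentence _ _ _ _ _ _ (fun i => group_model (N i)) code code_ex code_inj).
- have : definable par (G := extend (extend (empty_context M) (point_sort par)) (point_sort par))
    (fun i e => D e.1.2 /\ D e.2 /\ exists z, D z /\
      mpow (mul e.1.2 z) = one i /\ mpow (mul e.2 z) = one i).
    have v1 : dterm par (G := extend (extend (empty_context M) (point_sort par)) (point_sort par))
      (fun i e => e.1.2) by weaken; apply: dterm_new_point.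
    apply: definable_and; first exact: definable_D.
    apply: definable_and; first by apply: definable_D; apply: dterm_new_point.
    apply: (definable_ex (s := point_sort par) (Q := fun i (e : env (extend (extend
      (empty_context M) (point_sort par)) (point_sort par)) i) z => D z /\
      mpow (mul e.1.2 z) = one i /\ mpow (mul e.2 z) = one i)).
    have v2 := @dterm_new_point _ _ _ _ par (extend (extend (empty_context M) (point_sort par)) (point_sort par)).
    apply: definable_and; first exact: definable_D.
    apply: definable_and; apply: definable_eq; first [exact: dterm_one'|apply: dterm_pow; apply: dterm_mul' => //].
      by weaken.
    by weaken; apply: dterm_new_point.
  apply: definable_iff => i [[e x] y] /=; split=> [[Dx [Dy [z [Dz [xz yz]]]]]|[a ax ay]].
    have [a ax] := (code_dom x).2 Dx; have [b bY] := (code_dom y).2 Dy.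
    have [c cz] := (code_dom z).2 Dz; exists a => //.
    rewrite (_ : a = b) //; apply: (mulIg c).
    by rewrite (unit_code ax cz).2 // (unit_code bY cz).2.
  split; [exact: DE ax|split; [exact: DE ay|]].
  have [z cz] := code_ex a^-1%g; exists z; split; [exact: DE cz|].
  by split; [apply/(unit_code ax cz)|apply/(unit_code ay cz)]; rewrite mulgV.
case.
- exists (fun i e => D e.2 /\ mpow e.2 = one i).
    apply: definable_and; first by apply: definable_D; apply: dterm_new_point.
    by apply: definable_eq; [apply/dterm_pow/dterm_new_point|apply: dterm_one'].
  by move=> i a xs y _; rewrite code_one.
- exists (fun i e => D e.2 /\ mpow (mul (e.1 ord0) e.2) = one i).
    apply: definable_and; first by apply: definable_D; apply: dterm_new_point.
    apply: definable_eq; last exact: dterm_one'.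
    apply/dterm_pow/dterm_mul'; last exact: dterm_new_point.
    by weaken; apply: dterm_tuple.
  move=> i a xs y axs /=; have ax := axs ord0; split=> [[Dy e]|ay].
    have [b bY] := (code_dom y).2 Dy.
    by have /mulg1_eq -> := (unit_code ax bY).2 e.
  by split; [exact: DE ay|apply/(unit_code ax ay); rewrite mulgV].
- exists (fun i e => D e.2 /\ exists z, D z /\ mpow (mul e.2 z) = one i /\
    mpow (mul (mul (e.1 ord0) (e.1 ord_max)) z) = one i).
    apply: definable_and; first by apply: definable_D; apply: dterm_new_point.
    apply: (definable_ex (s := point_sort par)
     (Q := fun i (e : env (extend (tuple_context M 'I_2) (point_sort par)) i) z => D z /\
      mpow (mul e.2 z) = one i /\
      mpow (mul (mul (e.1 ord0) (e.1 ord_max)) z) = one i)).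
    have v2 := @dterm_new_point _ _ _ _ par (extend (tuple_context M 'I_2) (point_sort par)).
    apply: definable_and; first exact: definable_D.
    apply: definable_and; apply: definable_eq; first [exact: dterm_one'|apply: dterm_pow; apply: dterm_mul' => //].
      by weaken; apply: dterm_new_point.
    by apply: dterm_mul'; weaken; weaken; apply: dterm_tuple.
  move=> i a xs y axs /=; have ab := code_mul (axs ord0) (axs ord_max).
  split=> [[Dy [z [Dz [yz xz]]]]|cy].
    have [b bY] := (code_dom y).2 Dy; have [c cz] := (code_dom z).2 Dz.
    rewrite (_ : (a ord0 * a ord_max)%g = b) //; apply: (mulIg c).
    by rewrite (unit_code ab cz).2 // (unit_code bY cz).2.
  split; first exact: DE cy.
  have [z cz] := code_ex (a ord0 * a ord_max)^-1%g; exists z; split; [exact: DE cz|].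
  by split; [apply/(unit_code cy cz)|apply/(unit_code ab cz)]; rewrite mulgV.
Qed.

End QuotientInterpretation.

(** * Transfer along frames *)

Section FrameTransfer.
Variable n' : nat.
Local Notation frame := (frame n').
Local Notation M := (fun c : frame => group_model (fgroup c)).
Local Notation par := (@fpar n').

Lemma definable_ring_sentence (p : sentence ring_signature) :
  definable par (G := empty_context M) (fun c _ => satisfies (ring_model (ffld c)) p).
Proof.
apply: (@interp_sentence _ _ M _ par _ (fun c : frame => ring_model (ffld c))
  (fun c (a : ffld c) (x : fgroup c) => x = fv a)).
- by move=> c a; exists (fv a).
- by move=> c a b x -> /fval_inj.
- have : definable par (G := extend (extend (empty_context M) (point_sort par)) (point_sort par))
    (fun c e => in_root (@fparam n' c) e.2 /\ e.1.2 = e.2 :> fgroup c).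
    apply: definable_and.
      by apply: (definable_in_root (@dparams_par n' _)); apply: dterm_new_point.
    apply: definable_eqG; last exact: dterm_new_point.
    by weaken; apply: dterm_new_point.
  apply: definable_iff => c [[e x] y] /=; split=> [[/(fvalP (fcode c))[a ay] ->]|[a -> ->]].
    by exists a.
  by split=> //; apply/(fvalP (fcode c)); exists a.
have var (J : Type) (j : J) : dterm par
    (G := extend (tuple_context M J) (point_sort par)) (fun c e => e.1 j).
  by weaken; apply: dterm_tuple.
have out J := @dterm_new_point _ _ _ _ par (tuple_context M J).
case.
- exists (fun c e => e.2 = 1%g :> fgroup c).
    by apply: definable_eqG => //; apply: dterm_one.
  by move=> c a xs y _ /=; rewrite -(fval0 (fcode c)).
- exists (fun c e => e.2 = unip (@fparam n' c) :> fgroup c).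
    by apply: definable_eqG => //; apply: dterm_param.
  by move=> c a xs y _ /=; rewrite -(fval1 (fcode c)).
- exists (fun c e => e.2 = ((e.1 ord0 : fgroup c)^-1)%g :> fgroup c).
    by apply: definable_eqG => //; apply: dterm_inv.
  by move=> c a xs y axs /=; rewrite axs /fv fvalN.
- exists (fun c e => e.2 = ((e.1 ord0 : fgroup c) * e.1 ord_max)%g :> fgroup c).
    by apply: definable_eqG => //; apply: dterm_mul.
  by move=> c a xs y axs /=; rewrite !axs /fv fvalD.
- exists (fun c e => e.2 = root_mul (@fparam n' c) (e.1 ord0) (e.1 ord_max) :> fgroup c).
    by apply: definable_eqG => //; apply: (dterm_root_mul (@dparams_par n' _)).
  by move=> c a xs y axs /=; rewrite !axs /fv fvalM.
Qed.

Variable P : frame -> Prop.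
Hypothesis dP : definable par (G := empty_context M) (fun c _ => P c).

(** The defining formula sees only the group and the parameters, which both codes share. *)
Lemma frame_irrelevance (G : groupType) (p : params n' -> G) (fc fc' : fieldcode p) :
  P (Frame fc) -> P (Frame fc').
Proof.
have [phi phiP] := dP (fun v : params n' + void => match v with
  inl q => enum_rank q | inr v => match v with end end).
have h (fc0 : fieldcode p) : holds (M := group_model G) phi (fun j => p (enum_val j)) <-> P (Frame fc0).
  by apply: (phiP (Frame fc0) tt); split=> [q|[]] /=; rewrite enum_rankK.
by move/h => Pfc; apply/h.
Qed.

Let par0 (G : groupType) (v : void) : group_model G := match v with end.

Let dparams0 : dparams par0
  (G := extend (empty_context group_model) (family_sort par0 (params n'))) (fun G e => e.2).
Proof. by move=> q; apply: (@dterm_new _ _ _ _ par0 _ (family_sort par0 (params n')) q). Qed.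

(** The formula for [P] has the same truth value for all codes [fc]; [frame_ax] supplies at least
    one, which excludes the vacuous case. *)
Let definable_frames : definable par0
  (G := extend (empty_context group_model) (family_sort par0 (params n')))
  (fun G e => frame_ax e.2 -> forall fc : fieldcode e.2, P (Frame fc)).
Proof.
move=> k r; have [phi phiP] := definable_frame_ax dparams0 r.
have [psi psiP] := dP (fun v => match v with
  inl q => r (inr (inr q)) | inr v => match v with end end).
exists (Imp phi psi) => G [[] p] e er /=; rewrite (phiP _ _ _ er) /=.
have h (fc : fieldcode p) : holds (M := group_model G) psi e <-> P (Frame fc).
  by apply: (psiP (Frame fc) tt); split=> [q|[]]; apply: (er.2 (inr q)).
split=> [hp ax fc|hp ax]; first exact/h/hp.
by have [fc _] := frame_fieldcode ax; apply/(h fc)/hp.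
Qed.

Variables G H : groupType.
Hypothesis HG : elem_equiv (group_model H) (group_model G).

(** The parameters are a finite tuple, so a quantifier over all of them is first-order in the
    language of groups. *)
Lemma frame_transfer_all :
  (forall p : params n' -> G, frame_ax p -> forall fc : fieldcode p, P (Frame fc)) ->
  forall p : params n' -> H, frame_ax p -> forall fc : fieldcode p, P (Frame fc).
Proof.
have := definable_all (s := family_sort par0 (params n'))
  (Q := fun G e p => frame_ax p -> forall fc : fieldcode p, P (Frame fc)) definable_frames.
by move=> /definable_sentence[s sP] /sP/HG/sP.
Qed.

Lemma frame_transfer_ex :
  (exists p : params n' -> G, frame_ax p /\ forall fc : fieldcode p, P (Frame fc)) ->
  exists p : params n' -> H, frame_ax p /\ forall fc : fieldcode p, P (Frame fc).
Proof.
have := definable_ex (s := family_sort par0 (params n'))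
  (Q := fun G e p => frame_ax p /\ (frame_ax p -> forall fc : fieldcode p, P (Frame fc)))
  (definable_and (definable_frame_ax dparams0) definable_frames).
move=> /definable_sentence[s sP] [p [ax Pp]].
have /sP/HG/sP[q [qax qP]] : exists p : params n' -> G, frame_ax p /\
    (frame_ax p -> forall fc : fieldcode p, P (Frame fc)) by exists p.
by exists q; split=> //; apply: qP.
Qed.

End FrameTransfer.

Lemma units_X (F : comUnitRingType) (x : units F) k : uval (x ^+ k)%g = uval x ^+ k.
Proof. by elim: k => // k IHk; rewrite expgS exprS -IHk. Qed.

Lemma torsion_unitP (F : fieldType) N : (0 < N)%N ->
  (forall (x : F) k, (0 < k)%N -> x ^+ k = 1 -> x ^+ N = 1) ->
  forall x : units F, x \in torsion (units F) <-> uval x ^+ N = 1.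
Proof.
move=> N0 tors x; split=> [/asboolP[m m0 xm]|xN].
  by apply: (tors _ m m0); rewrite -units_X xm.
by apply/asboolP; exists N => //; apply: val_inj; rewrite /= units_X xN.
Qed.

(** A finite group of roots of unity in a field is cyclic; [N] is the number of torsion units. *)
Lemma NFT_prim_root (F : fieldType) : NFT F -> exists N (w : F),
  N.-primitive_root w /\ forall (x : F) k, (0 < k)%N -> x ^+ k = 1 -> x ^+ N = 1.
Proof.
move=> /finite_seqP[s0 s0E]; pose s := undup s0; pose rs := map (@uval F) s.
have sP (x : units F) : (x \in s) = (x \in torsion (units F)).
  rewrite mem_undup; apply/idP/idP => h.
    by have : ([set` s0] : set _)%classic x by []; rewrite -s0E.
  by have : ([set x | x \in torsion (units F)])%classic x by []; rewrite s0E.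
have rs_uniq : uniq rs by rewrite map_inj_uniq ?undup_uniq //; apply: val_inj.
have rsP (x : F) k : (0 < k)%N -> x ^+ k = 1 -> x \in rs.
  move=> k0 xk; have xU : x \is a GRing.unit.
    rewrite unitfE; apply/eqP => x0; move: xk; rewrite x0 expr0n gtn_eqF // => /esym/eqP.
    by rewrite oner_eq0.
  apply/mapP; exists (Units xU) => //; rewrite sP; apply/asboolP; exists k => //.
  by apply: val_inj; rewrite /= units_X.
have rs0 : (0 < size rs)%N.
  by rewrite lt0n; apply/eqP => /size0nil e; have := rsP 1 1%N isT (expr1n _ _); rewrite e.
(* Multiplication by y permutes the torsion units, so comparing their product before and after gives
   y^N = 1. *)
have rsN x : x \in rs -> x ^+ size rs = 1.
  move=> /mapP[y ys ->]; pose f z := uval y * z.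
  have fp : perm_eq (map f rs) rs.
    have fU : uniq (map f rs).
      by rewrite map_inj_uniq //; apply: mulrI; apply: uvalP.
    rewrite uniq_perm //; apply: (uniq_min_size fU _ _).2; rewrite ?size_map //.
    move=> _ /mapP[_ /mapP[z zs ->] ->]; apply/mapP; exists (y * z)%g => //.
    by move: ys zs; rewrite !sP => ys zs; apply: gpredM.
  have prod0 : \prod_(z <- rs) z != 0.
    rewrite prodf_seq_neq0; apply/allP => _ /mapP[z _ ->] /=.
    by rewrite -unitfE uvalP.
  have : \prod_(z <- map f rs) z = \prod_(z <- rs) z by apply: perm_big.
  rewrite big_map big_split /= big_const_seq count_predT iter_mulr_1.
  by rewrite -[RHS]mul1r => /(mulIf prod0).
have /hasP[w _ wP] : has (size rs).-primitive_root rs.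
  by apply: cyclic.has_prim_root => //; apply/allP => x /rsN e; apply/unity_rootP.
by exists (size rs), w; split=> // x k k0 xk; apply: rsN; apply: rsP xk.
Qed.

Lemma elem_equiv_sym (S : signature) (M N : model S) : elem_equiv M N -> elem_equiv N M.
Proof. by move=> e p; rewrite e. Qed.

Lemma elem_equiv_trans (S : signature) (M N P : model S) :
  elem_equiv M N -> elem_equiv N P -> elem_equiv M P.
Proof. by move=> e e' p; rewrite e. Qed.

(** Applied to the negation of a sentence, the one implication yields the other. *)
Lemma elem_equiv_half (S : signature) (M N : model S) :
  (forall p, satisfies M p -> satisfies N p) -> elem_equiv N M.
Proof.
move=> h p; split=> [Np|]; last exact: h.
apply: contrapT => nM; have := h (Imp p (Falsum S 0)); apply; last exact: Np.
by move=> Mp; apply: nM.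
Qed.

(** * Units modulo torsion *)

Section FieldQuotient.
Variables (L F : fieldType) (N : nat).
Hypothesis N0 : (0 < N)%N.
Hypothesis torsL : forall (x : L) k, (0 < k)%N -> x ^+ k = 1 -> x ^+ N = 1.
Hypothesis torsF : forall (x : F) k, (0 < k)%N -> x ^+ k = 1 -> x ^+ N = 1.
Hypothesis LF : elem_equiv (ring_model L) (ring_model F).
Variable A : torsion_complement (units L).

Let Fd (b : bool) : fieldType := if b then L else F.
Let M (b : bool) := ring_model (Fd b).
Let par (b : bool) (v : void) : M b := match v with end.
Let Q (b : bool) : groupType := if b then (subgroup (tcompl A) : groupType) else quotient (torsion (units F)).
Let code (b : bool) : Q b -> Fd b -> Prop := match b with
  | true => fun a x => exists2 t : L, t ^+ N = 1 & x = uval (sgval (a : subgroup (tcompl A))) * t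
  | false => fun a x => exists2 l : units F, uval l = x & quotient_pi (torsion (units F)) l = a
  end.

Let unit_neq0 (K : fieldType) (x : units K) : uval x != 0.
Proof. by rewrite -unitfE uvalP. Qed.

Let root_neq0 (K : fieldType) (t : K) : t ^+ N = 1 -> t != 0.
Proof.
by move=> tN; apply/eqP => t0; move: tN; rewrite t0 expr0n gtn_eqF // => /esym/eqP; rewrite oner_eq0.
Qed.

Let mpowE b (x : Fd b) : mpow (M := M) (fun b => @GRing.mul (Fd b)) (fun b => 1 : Fd b) N x = x ^+ N.
Proof. by rewrite /mpow; elim: N => [|k IHk] //; rewrite iterS IHk exprS. Qed.

(** L and F form a class indexed by [bool], in which A and F^*/T are the units modulo elements of
    exponent [N], by the same formulas. A sentence about the quotients thus becomes one sentence
    about the fields. *)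
Lemma tcompl_equiv : elem_equiv (group_model (subgroup (tcompl A)))
  (group_model (quotient (torsion (units F)))).
Proof.
have tL := torsion_unitP N0 torsL; have tF := torsion_unitP N0 torsF.
have [_ _ A1 AT] := tcomplP A.
have dmul G (t s : forall b, env G b -> M b) : dterm par t -> dterm par s ->
    dterm par (fun b e => (t b e : Fd b) * s b e : M b).
  move=> dt ds; have := @dterm_app _ _ M _ par G (RingMul : op ring_signature)
    (fun j : 'I_2 => if val j == 0 then t else s).
  by apply=> j; case: ifP.
have done' G : dterm par (G := G) (fun b _ => (1 : Fd b) : M b).
  have := @dterm_app _ _ M _ par G (RingOne : op ring_signature)
    (fun (j : 'I_0) _ _ => match notF (ltn_ord j) with end).
  by apply; case.
have dzero G : dterm par (G := G) (fun b _ => (0 : Fd b) : M b).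
  have := @dterm_app _ _ M _ par G (RingZero : op ring_signature)
    (fun (j : 'I_0) _ _ => match notF (ltn_ord j) with end).
  by apply; case.
have dD G (t : forall b, env G b -> M b) : dterm par t ->
    definable par (fun b e => (t b e : Fd b) <> 0).
  by move=> dt; apply: definable_not; apply: definable_eq (dzero G).
move=> p; suff [s sP] : exists s, forall b,
    satisfies (M b) s <-> satisfies (group_model (Q b)) p.
  by rewrite -(sP true) -(sP false); apply: LF.
apply: (@definable_sentence _ _ M par (fun b => satisfies (group_model (Q b)) p)).
apply: (@quotient_sentence _ _ M par (fun b => @GRing.mul (Fd b)) (fun b => 1 : Fd b)
  (fun b x => (x : Fd b) <> 0) N done' dmul dD Q code).
- case=> a; first by exists (uval (sgval a)); exists 1; rewrite ?expr1n ?mulr1.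
  by exists (uval (repr a)), (repr a) => //; apply: quotient_reprK.
- case=> a b x /=; last by move=> [l <- <-] [l' /val_inj -> <-].
  move=> [t tN ->] [u uN e]; apply/eqP; rewrite -divg_eq1; apply/eqP/val_inj.
  apply: A1; first exact: sgvalP.
  apply/tL; have -> : uval (sgval (a / b)%g) = u / t.
    apply: (mulIf (root_neq0 tN)); rewrite divfK ?root_neq0 //=.
    by rewrite mulrAC e mulrAC divff ?unit_neq0 // mul1r.
  by rewrite expr_div_n tN uN divr1.
- case=> x; split.
  + by move=> [a [t tN ->]]; apply/eqP; rewrite mulf_neq0 ?unit_neq0 ?root_neq0.
  + move=> /eqP; rewrite -unitfE => xU; have [a aA [t tT e]] := AT (Units xU) isT.
    exists (@Subgroup _ (tcompl A) a aA); exists (uval t).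
      exact: (tL t).1.
    exact: (congr1 (@uval _) e).
  + by move=> [a [l <- _]]; apply/eqP/unit_neq0.
  + move=> /eqP; rewrite -unitfE => xU; exists (quotient_pi _ (Units xU)).
    by exists (Units xU).
- case=> a b x y /=.
    move=> [t tN ->] [u uN ->]; exists (t * u); first by rewrite exprMn tN uN mulr1.
    by rewrite mulrACA.
  by move=> [l <- <-] [l' <- <-]; exists (l * l')%g; rewrite ?quotient_piM.
case=> x; rewrite mpowE.
  split=> [[t tN ->]|[x0 xN]]; last by exists x => //; rewrite mul1r.
  by rewrite mul1r; split=> //; apply/eqP/root_neq0.
split=> [[l <- /esym/quotient_piP]|[/eqP]].
  rewrite invg1 mul1g => h; split; [exact/eqP/unit_neq0|exact: (tF l).1].
rewrite -unitfE => xU xN; exists (Units xU) => //; apply/esym/quotient_piP.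
by rewrite invg1 mul1g; apply/tF.
Qed.

End FieldQuotient.


Lemma GL_center_scalar (n : nat) (F : fieldType) (x : GL n.+1 F) :
  (forall y, (x * y = y * x)%g) -> exists l : units F, mxval x = (uval l)%:M.
Proof.
move=> xC; have [i j ij|a xE] := @comm_elem_scalar F n.+1 (mxval x).
  by have /(congr1 (@mxval _ _)) := xC (MkGL (elem_unit 1 ij)).
have aU : a \is a GRing.unit.
  have := mxvalP x; rewrite xE unitmxE det_scalar unitrX_pos //.
by exists (Units aU).
Qed.

Lemma scalar_GL_center (n : nat) (F : fieldType) (x : GL n F) (a : F) :
  mxval x = a%:M -> forall y, (x * y = y * x)%g.
Proof. by move=> xE y; apply: val_inj; rewrite /= xE scalar_mxC. Qed.

Lemma scalar_mx_inj (n : nat) (F : fieldType) (a b : F) :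
  a%:M = b%:M :> 'M[F]_n.+1 -> a = b.
Proof. by move=> /matrixP/(_ ord0 ord0); rewrite !mxE eqxx !mulr1n. Qed.

Lemma scalar_GL_expg (n' : nat) (F : fieldType) (x : GL n'.+3 F) (a : F) k :
  mxval x = a%:M -> (x ^+ k)%g = 1%g <-> a ^+ k = 1.
Proof.
move=> xE; split=> [/(congr1 (@mxval _ _))|ak].
  by rewrite mxvalX xE -rmorphXn => /scalar_mx_inj.
by apply: val_inj; rewrite /= mxvalX xE -rmorphXn ak.
Qed.

(** * The centre modulo torsion *)

Section CenterQuotient.
Variables (n' N : nat) (F : fieldType) (H : groupType).
Local Notation GLn := (GL n'.+3 F).
Hypothesis N0 : (0 < N)%N.
Hypothesis torsF : forall (x : F) k, (0 < k)%N -> x ^+ k = 1 -> x ^+ N = 1.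
Hypothesis HG : elem_equiv (group_model H) (group_model GLn).
Variable B : abelian_sub H.
Hypothesis BC : {subset B <= center H}.
Hypothesis B1 : forall b, b \in B -> (b ^+ N)%g = 1%g -> b = 1%g.
Hypothesis CB : forall z, z \in center H -> exists2 b, b \in B &
  exists2 t, t \in center H /\ (t ^+ N)%g = 1%g & z = (b * t)%g.

Let Gr (b : bool) : groupType := if b then H else GLn.
Let par (b : bool) (v : void) : group_model (Gr b) := match v with end.
Let Q (b : bool) : groupType := if b then (asub_group B : groupType) else quotient (torsion (units F)).
Let code (b : bool) : Q b -> Gr b -> Prop := match b with
  | true => fun a x => exists2 t : H, t \in center H /\ (t ^+ N)%g = 1%g & x = (aval (a : asub_group B) * t)%g
  | false => fun a x => exists2 l : units F, mxval (x : GLn) = (uval l)%:M &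
      quotient_pi (torsion (units F)) l = a
  end.

Let mpowE b (x : Gr b) : mpow (M := fun b => group_model (Gr b))
  (fun b x y => (x * y)%g : Gr b) (fun b => 1%g : Gr b) N x = (x ^+ N)%g.
Proof. by rewrite /mpow; elim: N => [|k IHk] //; rewrite iterS IHk expgS. Qed.

(** [B] and F^*/T are the centres of [H] and of GL_n(F) modulo central elements of exponent [N], the
    centre of GL_n(F) being the scalars; the same formulas interpret both. *)
Lemma center_equiv : elem_equiv (group_model (asub_group B))
  (group_model (quotient (torsion (units F)))).
Proof.
have tF := torsion_unitP N0 torsF.
have dD G (t : forall b, env G b -> Gr b) : dterm par t ->
    definable par (fun b e => forall y, (t b e * y = y * t b e)%g).
  by move=> dt; apply: definable_allG; apply: definable_eqG; dterm_solve.
move=> p; suff [s sP] : exists s, forall b,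
    satisfies (group_model (Gr b)) s <-> satisfies (group_model (Q b)) p.
  by rewrite -(sP true) -(sP false); apply: HG.
apply: (@definable_sentence _ _ (fun b => group_model (Gr b)) par (fun b => satisfies (group_model (Q b)) p)).
apply: (@quotient_sentence _ _ (fun b => group_model (Gr b)) par (fun b x y => (x * y)%g : Gr b) (fun b => 1%g : Gr b)
  (fun b x => forall y, (x * y = y * x)%g) N (@dterm_one _ Gr _ par) (@dterm_mul _ Gr _ par) dD Q code).
- case=> a.
    by exists (aval a); exists 1%g; rewrite ?mulg1 //; split; [apply/asboolP => y; rewrite /commute mul1g mulg1|rewrite expg1n].
  have U : ((uval (repr a))%:M : 'M[F]_n'.+3) \in unitmx.
    by rewrite unitmxE det_scalar unitrX ?uvalP.
  by exists (MkGL U), (repr a) => //; apply: quotient_reprK.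
- case=> a b x /=.
    move=> [t [/asboolP tC tN] ->] [u [/asboolP uC uN] e].
    apply/eqP; rewrite -divg_eq1; apply/eqP/aval_inj.
    apply: B1; first exact: avalP.
    have -> : aval (a / b)%g = (u / t)%g.
      rewrite avalM avalV; apply: (mulIg t); rewrite mulgVK.
      by rewrite -mulgA -(tC (aval b)^-1%g) mulgA e -(uC (aval b)) mulgK.
    by rewrite expgMn ?expVgn ?tN ?uN ?invg1 ?mulg1 //; apply: uC.
  move=> [l -> <-] [l' /scalar_mx_inj/val_inj -> <-] //.
- case=> x; split.
  + move=> [a [t [/asboolP tC _] ->]] y; have /asboolP aC := BC (avalP a).
    by rewrite -(mulgA _ t y) (tC y) !mulgA (aC y).
  + move=> xC; have /CB[b bB [t tP ->]] : x \in center H by apply/asboolP.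
    by have [a <-] := aval_ex bB; exists a, t.
  + by move=> [a [l xE _]]; apply: scalar_GL_center xE.
  + by move=> /GL_center_scalar[l xE]; exists (quotient_pi _ l), l.
- case=> a b x y /=.
    move=> [t [/asboolP tC tN] ->] [u [/asboolP uC uN] ->]; exists (t * u)%g.
      split; first by apply/asboolP => z; rewrite /commute -(mulgA t u z) (uC z) mulgA (tC z) mulgA.
      by rewrite expgMn ?tN ?uN ?mulg1.
    change (aval a * t * (aval b * u) = aval a * aval b * (t * u))%g.
    by rewrite -!mulgA; congr (_ * _)%g; rewrite !mulgA; congr (_ * _)%g; apply: tC.
  move=> [l xE <-] [l' yE <-]; exists (l * l')%g; last by rewrite quotient_piM.
  by rewrite -[LHS]/(mxval x *m mxval y) xE yE -scalar_mxM.
case=> x; rewrite mpowE /=.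
  split=> [[t [/asboolP tC tN] xE]|[xC xN]].
    have -> : x = t by rewrite xE; apply: mul1g.
    by [].
  by exists x; [split=> //; apply/asboolP|apply/esym/mul1g].
have X (l : units F) : mxval x = (uval l)%:M -> (x ^+ N)%g = 1%g <-> uval l ^+ N = 1.
  exact: scalar_GL_expg.
split=> [[l xE /esym/quotient_piP]|[/GL_center_scalar[l xE]]].
  rewrite invg1 mul1g => /tF lN; split; last exact: (X l xE).2.
  exact: scalar_GL_center xE.
move=> /(X l xE) lN; exists l => //; apply/esym/quotient_piP.
by rewrite invg1 mul1g; apply: (tF l).2.
Qed.

End CenterQuotient.


Lemma prim_root_NFT (L : fieldType) N (w : L) : N.-primitive_root w ->
  (forall (x : L) k, (0 < k)%N -> x ^+ k = 1 -> x ^+ N = 1) -> NFT L.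
Proof.
move=> w_prim tors; have wU : w \is a GRing.unit.
  by rewrite -(unitrX_pos _ (prim_order_gt0 w_prim)) (prim_expr_order w_prim) unitr1.
apply: (@sub_finite_set _ _ ((fun i => (Units wU ^+ i)%g) @` `I_N)%classic).
  move=> x /(torsion_unitP (prim_order_gt0 w_prim) tors) /(prim_rootP w_prim)[i e].
  by exists (val i) => /=; [exact: ltn_ord|apply: val_inj; rewrite /= units_X e].
exact/finite_image/finite_II.
Qed.

(** Some element differs from 0, 1 and -1; it serves as the factor of the dilations in
    [root_shape]. *)
Lemma infinite_non_square_root (F : fieldType) : infinite_set [set: F] ->
  exists2 s : F, s != 0 & s ^+ 2 != 1.
Proof.
move=> Finf; apply: contrapT => nos; apply: Finf.
apply: (@sub_finite_set _ _ ([set` [:: 0; 1; -1 : F]])%classic); last exact: finite_seq.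
move=> s _ /=; rewrite !inE; have [//|s0] := eqVneq s 0.
by rewrite /= -sqrf_eq1; apply: contrapT => /negP s1; apply: nos; exists s.
Qed.

(** * The frames of [H] *)

Section FieldTransfer.
Variables (n' N K : nat) (F : fieldType) (H : groupType) (w s : F).
Local Notation n := n'.+3.
Hypothesis two_neq0 : (2%:R : F) != 0.
Hypothesis s0 : s != 0.
Hypothesis s1 : s ^+ 2 != 1.
Hypothesis w_prim : N.-primitive_root w.
Hypothesis torsF : forall (x : F) k, (0 < k)%N -> x ^+ k = 1 -> x ^+ N = 1.
Hypothesis gen : forall m : 'M[F]_n, m \in unitmx ->
  exists2 e, elem_prod K e & m = diag_last n'.+2 (\det m) *m e.
Hypothesis HG : elem_equiv (group_model H) (group_model (GL n F)).

Local Notation M := (fun c : frame n' => group_model (fgroup c)).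

(** The one use of an existential transfer: the standard parameters are the witness in GL_n(F). *)
Lemma coordinatised_frame_ex : exists q : params n' -> H,
  frame_ax q /\ forall fc : fieldcode q, coordinatised N K (Frame fc).
Proof.
apply: (@frame_transfer_ex n' _ (@definable_coordinatised n' N K) _ _ HG).
exists (@std_param n' F); split; first exact: std_frame_ax.
move=> fc; apply: (@frame_irrelevance n' _ (@definable_coordinatised n' N K) _ _ (std_fieldcode n' two_neq0)).
exact: (std_coordinatised two_neq0 w_prim gen).
Qed.

(** By rigidity every frame of GL_n(F) may be given the field F, so a definable property of frames
    over F holds there for all admissible tuples, and this universal statement passes to [H]. *)
Lemma frame_transfer_field (P : frame n' -> Prop) :
  definable (@fpar n') (G := empty_context M) (fun c _ => P c) ->
  (forall (p : params n' -> GL n F) (fc : fieldcode p), fld fc = F -> P (Frame fc)) ->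
  forall (q : params n' -> H) (fc : fieldcode q), frame_ax q -> P (Frame fc).
Proof.
move=> dP PF q fc qax; apply: (@frame_transfer_all n' P dP _ _ HG) qax fc => p pax fc.
have [fc0 fc0F] := frame_rigid two_neq0 s0 s1 pax.
exact: (@frame_irrelevance n' P dP _ _ fc0 fc (PF _ _ fc0F)).
Qed.

Variables (q : params n' -> H) (fc : fieldcode q).
Hypothesis q_ax : frame_ax q.

(** Each exponent [k] is a statement of its own; as each of them holds for every frame of [H], any
    single frame satisfies them all. *)
Lemma frame_torsion (x : fld fc) k : (0 < k)%N -> x ^+ k = 1 -> x ^+ N = 1.
Proof.
move=> k0; move: x.
apply: (frame_transfer_field (P := fun c => forall x : ffld c, x ^+ k = 1 -> x ^+ N = 1)) => //.
  apply: definable_allL; apply: definable_imp; apply: definable_eqL; fterm_solve.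
by move=> p fc0 e; rewrite /ffld /= e => x; apply: torsF.
Qed.

Lemma center_torsion (z : H) k : z \in center H -> (0 < k)%N ->
  (z ^+ k)%g = 1%g -> (z ^+ N)%g = 1%g.
Proof.
move=> /asboolP zC k0; move: z zC.
apply: (frame_transfer_field (P := fun c => forall z : fgroup c,
  (forall x, (z * x = x * z)%g) -> (z ^+ k = 1)%g -> (z ^+ N = 1)%g)) fc q_ax => //.
  apply: definable_allG; apply: definable_imp.
    by apply: definable_allG; apply: definable_eqG; fterm_solve.
  by apply: definable_imp; apply: definable_eqG; fterm_solve.
move=> p fc0 _ /= z /GL_center_scalar[l zE].
by move=> /(scalar_GL_expg _ zE) lk; apply/(scalar_GL_expg _ zE)/torsF/lk.
Qed.

Lemma frame_field_equiv : elem_equiv (ring_model (fld fc)) (ring_model F).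
Proof.
apply: elem_equiv_half => p Fp.
apply: (frame_transfer_field (P := fun c => satisfies (ring_model (ffld c)) p) _ _ fc q_ax).
  exact: definable_ring_sentence.
by move=> p' fc0 e; rewrite /ffld /= e.
Qed.

End FieldTransfer.

Theorem theorem6p8 (n : nat) (F : fieldType) (H : groupType) :
  (3 <= n)%N ->
  infinite_set [set: F] ->
  2%N \notin [pchar F]%R ->
  NFT F ->
  elem_equiv (group_model H) (group_model (GL n F)) ->
  exists (L : fieldType) (A : torsion_complement (units L))
         (K0 : addition (GL n L)) (B : abelianGroupType)
         (h : sym_cocycle (AmodAn n A) B),
    [/\ NFT L,
        elem_equiv (ring_model L) (ring_model F),
        elem_equiv (group_model B) (group_model (subgroup (tcompl A))),
        elem_equiv (group_model B) (group_model (quotient (torsion (units F))))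
      & isomorphic H (GL_deformation K0 h)].
Proof.
case: n => [|[|[|n']]] // _ Finf char2 nftF HG.
have two_neq0 : (2%:R != 0 :> F)%R by move: char2; rewrite inE /=.
have [s s0 s1] := infinite_non_square_root Finf.
have [N [w [w_prim torsF]]] := NFT_prim_root nftF.
have N0 := prim_order_gt0 w_prim.
have [K gen] := elem_generation F n'.+2.
have [q [q_ax qP]] := coordinatised_frame_ex two_neq0 w_prim gen HG.
have [fc _] := frame_fieldcode q_ax; pose c := Frame fc.
have cc : coordinatised N K c := qP fc.
have torsL : forall (x : ffld c) k, (0 < k)%N -> (x ^+ k = 1)%R -> (x ^+ N = 1)%R.
  exact: (frame_torsion two_neq0 s0 s1 torsF HG q_ax).
have torsZ := center_torsion two_neq0 s0 s1 torsF HG fc q_ax.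
have LF : elem_equiv (ring_model (ffld c)) (ring_model F).
  exact: (frame_field_equiv two_neq0 s0 s1 HG fc q_ax).
have [A [K0 [B [h [BC B1 CB iso]]]]] := coordinatised_deformation N0 cc torsL torsZ.
have BF := center_equiv N0 torsF HG BC B1 CB.
exists (ffld c), A, K0, (asub_group B), h; split=> //.
  have [v [_ [[vN vi] _]]] := cc.
  exact: (prim_root_NFT (prim_root_of_order N0 vN vi) torsL).
exact: (elem_equiv_trans BF (elem_equiv_sym (tcompl_equiv N0 torsL torsF LF A))).
Qed.
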